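(* Let $G$ be a (4,6)-fullerene graph with $h$ hexagonal faces. (i) If $G$ is the cube, then $M(G,6)=0$. (ii) If $G\in\mathcal{T}$, then $M(G,6)=\frac{81}{80}h^6-\frac{81}{80}h^5-\frac{99}{16}h^4+\frac{405}{16}h^3-\frac{1873}{40}h^2+\frac{1231}{30}h-9$. (iii) If $G\notin\mathcal{T}$, $G$ is not the cube, and $G$ has $y$ dual-squares, then $M(G,6)=\frac{81}{80}h^6-\frac{81}{80}h^5-\frac{99}{16}h^4+\frac{405}{16}h^3-\frac{1873}{40}h^2+\frac{407}{10}h-16+y$.
   Context: A (4,6)-fullerene graph is a plane 3-regular graph all of whose faces are bounded by 4-cycles or 6-cycles, with exactly six square faces; $h$ is the number of hexagonal faces. $M(G,6)$ is the number of 6-matchings (sets of 6 pairwise nonadjacent edges) of $G$. A dual-square is a 6-cycle $u_1\cdots u_6u_1$ of $G$ such that $G$ has an edge joining two opposite vertices of it (e.g. $u_2u_5$). For $t\geqslant 0$, $T_t$ is the plane cubic graph with vertices $a,b$, $c_{i,j}$ ($0\leqslant i\leqslant t$, $1\leqslant j\leqslant 6$), 6-cycles $c_{i,1}\cdots c_{i,6}c_{i,1}$, edges $ac_{0,j}$ for odd $j$, $c_{i,j}c_{i+1,j}$ for $0\leqslant i<t$ and $j\equiv i\pmod 2$, and $bc_{t,j}$ for $j\equiv t\pmod 2$ ($t$ layers of three hexagons capped by three squares at each end; $T_0$ is the cube); $\mathcal{T}=\{T_t:t\geqslant1\}$. *)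

(* Defs.v *)
From HB Require Import structures.
From mathcomp Require Import all_boot all_order all_fingroup all_algebra.

Set Implicit Arguments.
Unset Strict Implicit.
Unset Printing Implicit Defensive.

Local Open Scope ring_scope.

Record sgraph := SGraph {
  vertex :> finType;
  adj : rel vertex;
  adj_sym : symmetric adj;
  adj_irrefl : irreflexive adj
}.

Definition edges (G : sgraph) : {set {set G}} :=
  [set [set p.1; p.2] | p in [set p : G * G | adj p.1 p.2]].

Definition graph_iso (G H : sgraph) : Prop :=
  exists2 f : G -> H, bijective f & forall u v, adj (f u) (f v) = adj u v.

Definition num_matchings (G : sgraph) (k : nat) : nat :=
  #|[set M : {set {set G}} | [&& M \subset edges G, trivIset M & #|M| == k]]|.

(* A dart is an edge with one of its two orientations. *)
Definition dart (G : sgraph) : finType := {p : G * G | adj p.1 p.2}.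

Definition tail (G : sgraph) (d : dart G) : G := (val d).1.

Lemma dart_rev_proof (G : sgraph) (d : dart G) :
  adj ((val d).2, (val d).1).1 ((val d).2, (val d).1).2.
Proof. by rewrite adj_sym; exact: (valP d). Qed.

Definition dart_rev (G : sgraph) (d : dart G) : dart G :=
  exist _ ((val d).2, (val d).1) (dart_rev_proof d).

Lemma dart_revK (G : sgraph) : involutive (@dart_rev G).
Proof. by move=> d; apply: val_inj => /=; case: (val d). Qed.

Definition revp (G : sgraph) : {perm dart G} := perm (inv_inj (@dart_revK G)).

(* The face traversed by a dart (u, v) continues with the dart that follows
   (v, u) in the rotation at v; permutation products compose left to right. *)
Definition faces_of (G : sgraph) (rotation : {perm dart G}) : {set {set dart G}} :=
  porbits (revp G * rotation)%g.

(* A connected plane graph, as a simple graph with a rotation system (the cyclic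
   order of the darts leaving each vertex) of genus 0, by Euler's formula. A
   plane graph all of whose faces are bounded by cycles is connected. *)
Record plane_graph := PlaneGraph {
  pgraph :> sgraph;
  rotation : {perm dart pgraph};
  rotation_vertex : forall d, porbit rotation d = [set d' | tail d' == tail d];
  pconnected : forall u v : pgraph, connect (@adj pgraph) u v;
  euler : (#|pgraph| + #|faces_of rotation| = #|edges pgraph| + 2)%N
}.

Definition faces (G : plane_graph) : {set {set dart G}} := faces_of (rotation G).

(* The boundary walk of f visits the tails of the darts of f, in order. *)
Definition bounded_by_cycle (G : plane_graph) (k : nat) (f : {set dart G}) :
  Prop := #|f| = k /\ {in f &, injective (@tail G)}.

Definition num_faces (G : plane_graph) (k : nat) : nat :=
  #|[set f in faces G | #|f| == k]|.

Definition fullerene46 (G : plane_graph) : Prop :=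
  [/\ forall v : G, #|[set w | adj v w]| = 3%N,
      forall f, f \in faces G -> bounded_by_cycle 4 f \/ bounded_by_cycle 6 f
    & num_faces G 4 = 6%N].

(* A closed sequence of vertices indexed by the integers mod 6. *)
Definition is_cycle6 (G : sgraph) (c : {ffun 'I_6 -> G}) : bool :=
  injectiveb c && [forall i, adj (c i) (c (i + 1))].

Definition cycle6_edges (G : sgraph) (c : {ffun 'I_6 -> G}) : {set {set G}} :=
  [set [set c i; c (i + 1)] | i : 'I_6].

(* Cycles are counted as subgraphs, hence identified with their edge sets. *)
Definition dual_squares (G : sgraph) : {set {set {set G}}} :=
  [set cycle6_edges c | c in
    [set c : {ffun 'I_6 -> G} |
      is_cycle6 c && [exists i, adj (c i) (c (i + 3))]]].

Definition cube_adj (x y : {ffun 'I_3 -> bool}) : bool :=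
  #|[set i | x i != y i]| == 1%N.

Lemma cube_adj_sym : symmetric cube_adj.
Proof.
move=> x y; rewrite /cube_adj; congr (_ == _); apply: eq_card => i.
by rewrite !inE eq_sym.
Qed.

Lemma cube_adj_irrefl : irreflexive cube_adj.
Proof.
move=> x; rewrite /cube_adj (_ : [set i | _] = set0) ?cards0 //.
by apply/setP=> i; rewrite !inE eqxx.
Qed.

Definition cube : sgraph := SGraph cube_adj_sym cube_adj_irrefl.

(* inl true is a, inl false is b and inr (i, j) is c_{i,j}, where j is a residue
   mod 6 (so that 0 stands for j = 6, of the same parity). *)
Definition tube_vertex (t : nat) : finType := (bool + 'I_t.+1 * 'I_6)%type.

Definition tube_arc (t : nat) (x y : tube_vertex t) : bool :=
  match x, y with
  | inr (i, j), inr (i', j') =>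
      (i' == i) && (j' == j + 1)
      || [&& i' == i.+1 :> nat, j' == j & odd j == odd i]
  | inl true, inr (i, j) => (i == 0%N :> nat) && odd j
  | inl false, inr (i, j) => (i == t :> nat) && (odd j == odd t)
  | _, _ => false
  end.

Definition tube_adj (t : nat) : rel (tube_vertex t) :=
  fun x y => tube_arc x y || tube_arc y x.

Lemma tube_adj_sym (t : nat) : symmetric (@tube_adj t).
Proof. by move=> x y; rewrite /tube_adj orbC. Qed.

Lemma tube_adj_irrefl (t : nat) : irreflexive (@tube_adj t).
Proof.
move=> [[]|[i j]] //; rewrite /tube_adj /= orbb eqxx /=.
have -> : (i == i.+1 :> nat) = false by rewrite ltn_eqF.
by rewrite orbF; case: j => [[|[|[|[|[|[|j]]]]]] hj].
Qed.

Definition tube (t : nat) : sgraph := SGraph (@tube_adj_sym t) (@tube_adj_irrefl t).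

Definition in_tubes (G : sgraph) : Prop :=
  exists2 t : nat, (1 <= t)%N & graph_iso G (tube t).

(* Main.v *)
Require Import Defs.
From mathcomp Require Import all_boot all_order all_fingroup all_algebra.
From mathcomp Require Import zify ring lra.

Set Implicit Arguments.
Unset Strict Implicit.
Unset Printing Implicit Defensive.

Import Order.TTheory GRing.Theory Num.Theory.

(** The matching generating functions of [G] and [G - v] have as ratio the
    generating function of the closed walks at the root of the path tree of [v]
    (Godsil). Summing over [v] gives Newton identities for the matching numbers,
    so [M(G,6)] only depends on the balls of radius 6 of the path trees. In a
    cubic graph without triangles, pentagons and [K_{2,3}] these are regular
    except for the defects caused by 4-cycles and 6-cycles; hence [M(G,6)] is a
    polynomial in the number of vertices once there are six 4-cycles, plus the
    number of 6-cycles.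

    The short cycles are found by looking at the side to which a cycle turns at
    each of its vertices: the faces along a side follow the cycle between two
    consecutive outgoing edges and have length 4 or 6. Either this closes up
    and the cycle is a face, or a 6-cycle with a chord, or the faces form a belt
    of hexagons ended by a cycle of the same kind. Belts cannot go on forever,
    because the vertices they meet would be closed under adjacency while there
    are squares. This leaves only tubes and the cube, where the belts are
    stopped by three squares around a vertex. *)

(** * Matchings avoiding a set of vertices *)

(** A 6-cycle shows up in the path trees only at the greatest depth that closed walks of length 12
    can feel. It lowers their number by its 12 rooted orientations, and Newton's identity for
    [12 * M(G,6)] turns this into exactly one matching more. A 4-cycle acts at depths 3, 4 and 5,
    where it carries a tail; without $K_{2,3}$ the tails can be counted and the walk numbers stay
    affine in the defects.

    A rotation system gives a cycle no interior, so a cycle that bounds no face cannot be excluded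
    by induction on what it encloses. What is propagated instead, on both sides, is the property of
    lying on a cycle with a given pattern of turns. For alternating turns this must fail somewhere,
    since the rings of tubes have them; it fails only at a cap. Belts regrown from the cap then
    embed a tube or the cube into $G$, and the embedding is onto because $G$ is cubic and connected.
    The 6-cycles of all tubes are counted by one finite table, as six steps see only a bounded
    window. *)

Section Matchings.
Variable G : sgraph.
Implicit Types (X : {set G}) (u v : G) (M : {set {set G}}).

(** Matchings of $G - X$, kept in the type of [G] so that recursions can enlarge [X] without
    building induced subgraphs. *)
Definition matchings_off X k : {set {set {set G}}} :=
  [set M : {set {set G}} | [&& M \subset edges G, trivIset M, #|M| == k & [disjoint cover M & X]]].

Lemma edgesP (e : {set G}) :
  reflect (exists u v, e = [set u; v] /\ adj u v) (e \in edges G).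
Proof.
apply: (iffP imsetP) => [[[u v]]|[u [v [-> uv]]]].
  by rewrite inE /= => uv ->; exists u, v.
by exists (u, v); rewrite ?inE.
Qed.

Lemma adj_neq u v : adj u v -> u != v.
Proof. by apply: contraTneq => ->; rewrite adj_irrefl. Qed.

Lemma edge_in u v : ([set u; v] \in edges G) = adj u v.
Proof.
apply/edgesP/idP => [[x [y [e xy]]]|uv]; last by exists u, v.
have xny := adj_neq xy.
have: x \in [set u; v] by rewrite e !inE eqxx.
have: y \in [set u; v] by rewrite e !inE eqxx orbT.
rewrite !inE => /orP[]/eqP yE /orP[]/eqP xE; move: xy xny;
  by rewrite xE yE ?eqxx // adj_sym.
Qed.

Lemma disjointU1r (T : finType) (A X : {set T}) (v : T) :
  [disjoint A & v |: X] = (v \notin A) && [disjoint A & X].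
Proof.
by rewrite disjoint_sym disjoints_subset subUset sub1set inE -disjoints_subset disjoint_sym.
Qed.

Lemma card_edge (e : {set G}) : e \in edges G -> #|e| = 2.
Proof. by case/edgesP=> u [v [-> uv]]; rewrite cards2 adj_neq. Qed.

Lemma edge_at v (e : {set G}) : e \in edges G -> v \in e ->
  exists2 u, adj v u & e = [set v; u].
Proof.
case/edgesP=> x [y [-> xy]]; rewrite !inE => /orP[]/eqP->; first by exists y.
by exists x; [rewrite adj_sym | rewrite setUC].
Qed.

Lemma matchings_off0 X : #|matchings_off X 0| = 1.
Proof.
rewrite (_ : matchings_off X 0 = [set set0]) ?cards1 //.
apply/setP=> M; rewrite !inE cards_eq0; case: eqP => [->|_]; last by rewrite !andbF.
rewrite sub0set /= /cover big_set0 /=; apply/andP; split; last first.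
  by rewrite disjoints_subset sub0set.
by apply/trivIsetP=> A B; rewrite inE.
Qed.

Lemma cover_matching M k : M \subset edges G -> trivIset M -> #|M| = k ->
  #|cover M| = k.*2.
Proof.
move=> sM /eqP <- <-; rewrite -[in RHS]sum1_card -mul2n big_distrr /=.
by apply: eq_bigr => e eM; rewrite (card_edge (subsetP sM _ eM)).
Qed.

Lemma matchings_off_edge X v u k : v \notin X -> u \notin X -> adj v u ->
  #|[set M in matchings_off X k.+1 | [set v; u] \in M]| =
  #|matchings_off (u |: (v |: X)) k|.
Proof.
move=> vX uX vu; set e := [set v; u].
have inj : {in matchings_off (u |: (v |: X)) k &, injective (fun M => e |: M)}.
  move=> M N; rewrite !inE => /and4P[_ _ _ dM] /and4P[_ _ _ dN] eMN.
  have notin (K : {set {set G}}) : [disjoint cover K & u |: (v |: X)] -> e \notin K.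
    move=> dK; apply/negP => eK; have := disjointFl dK (_ : v \in u |: (v |: X)).
    rewrite !inE eqxx orbT => /(_ isT) /negP; apply.
    by apply/bigcupP; exists e => //; rewrite !inE eqxx.
  by rewrite -(setU1K (notin _ dM)) eMN setU1K ?notin.
rewrite -(card_in_imset inj); apply: eq_card => M; rewrite !inE.
apply/idP/imsetP => [/andP[/and4P[sM tM /eqP cM dM] eM]|[N]].
  exists (M :\ e); last by rewrite setD1K.
  have cE : cover M = e :|: cover (M :\ e) by rewrite -{1}(setD1K eM) /cover bigcup_setU big_set1.
  rewrite !inE; apply/and4P; split.
  - by apply: subset_trans sM; apply: subsetDl.
  - by apply: trivIsetS tM; apply: subsetDl.
  - by move: cM => /eqP; rewrite (cardsD1 e) eM add1n eqSS.
  - have de : [disjoint cover (M :\ e) & e].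
      rewrite disjoint_sym; apply/bigcup_disjointP => f; rewrite !inE => /andP[fe fM].
      by move/trivIsetP: tM; apply=> //; rewrite eq_sym.
    rewrite disjoint_sym; apply/pred0P => x /=; apply/negbTE/negP.
    rewrite !inE => /andP[H xc]; move: (disjointFr de xc); rewrite !inE.
    case: (x =P u) H => [->|_] /=; first by rewrite orbT.
    case: (x =P v) => //= _ xX _.
    by have := disjointFl dM xX; rewrite cE inE xc orbT.
rewrite !inE => /and4P[sN tN /eqP cN dN] ->.
have eN : e \notin N.
  apply/negP => eN; have := disjointFl dN (_ : v \in u |: (v |: X)).
  rewrite !inE eqxx orbT => /(_ isT) /negP; apply.
  by apply/bigcupP; exists e => //; rewrite !inE eqxx.
have cE : cover (e |: N) = e :|: cover N by rewrite /cover bigcup_setU big_set1.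
rewrite setU11 andbT; apply/and4P; split.
- by rewrite subUset sN sub1set edge_in vu.
- apply: (proj1 (trivIsetU1 _ tN _)) => [B BN|].
  + rewrite disjoint_sym; apply/pred0P => x /=; apply/negbTE/negP => /andP[xB xe].
    have xc : x \in cover N by apply/bigcupP; exists B.
    by move: (disjointFr dN xc) xe; rewrite !inE => /norP[/negbTE-> /norP[/negbTE-> _]].
  + by apply/negP => /(subsetP sN)/card_edge; rewrite cards0.
- by rewrite cardsU1 eN cN.
- rewrite cE; apply/pred0P => x /=; apply/negbTE/negP; rewrite !inE.
  move=> /andP[/orP[/orP[]/eqP->|xc] xX]; rewrite ?xX in vX uX => //.
  by have := disjointFr dN xc; rewrite !inE xX !orbT.
Qed.

(** The vertex recurrence of the matching polynomial: [v] is either missed or matched to one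
    neighbour. *)
Lemma matchings_offS X v k : v \notin X ->
  #|matchings_off X k.+1| = (#|matchings_off (v |: X) k.+1| +
    \sum_(u | adj v u && (u \notin v |: X)) #|matchings_off (u |: (v |: X)) k|)%N.
Proof.
move=> vX.
rewrite -(cardsID [set M : {set {set G}} | v \notin cover M] (matchings_off X k.+1)).
congr addn.
  apply: eq_card => M; rewrite !inE -!andbA; do 3!congr andb.
  by rewrite disjointU1r andbC.
transitivity (\sum_(u | adj v u && (u \notin v |: X))
   #|[set M in matchings_off X k.+1 | [set v; u] \in M]|)%N; last first.
  apply: eq_bigr => u; rewrite !inE negb_or => /andP[vu /andP[_ uX]].
  exact: matchings_off_edge.
rewrite -sum1_card.
under [RHS]eq_bigr do rewrite -sum1_card.
(* Double counting: a matching that covers [v] has exactly one edge at [v], so it contributes to a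
   single [u]. *)
rewrite (exchange_big_dep (fun M => M \in matchings_off X k.+1 :\: [set M | v \notin cover M])) /=.
  apply: eq_bigr => M; rewrite !inE negbK => /andP[vM /and4P[sM tM cM dM]].
  case/bigcupP: vM => e eM ve.
  have [u vu eE] := edge_at (subsetP sM _ eM) ve.
  have uX : u \notin X.
    apply/negP => uX; have := disjointFl dM uX => /negP; apply.
    by apply/bigcupP; exists e => //; rewrite eE !inE eqxx orbT.
  rewrite (bigD1 u) /=; last first.
    by rewrite vu !inE negb_or eq_sym adj_neq // uX sM tM cM dM -eE eM.
  rewrite big1 // => w /andP[/andP[/andP[vw _]]]; rewrite !inE => /andP[_ wM] wu.
  have /trivIsetP/(_ e [set v; w] eM wM) := tM.
  case: (e =P [set v; w]) => [|_ /(_ isT)/disjointFr/(_ ve)]; last by rewrite !inE eqxx.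
  move=> ew; have: w \in e by rewrite ew !inE eqxx orbT.
  by rewrite eE !inE (negbTE wu) orbF eq_sym (negbTE (adj_neq vw)).
move=> u M /andP[vu _]; rewrite !inE => /andP[H uM]; rewrite H andbT negbK.
by apply/bigcupP; exists [set v; u] => //; rewrite !inE eqxx.
Qed.

Lemma num_matchingsE k : num_matchings G k = #|matchings_off set0 k|.
Proof.
apply: eq_card => M; rewrite !inE; do 2!congr andb.
by rewrite disjoint_sym disjoints_subset sub0set andbT.
Qed.

(** Counts the pairs of a matching and a vertex that it misses; this is the derivative formula
    $\mu'(G)=\sum_v\mu(G-v)$ of the matching polynomial. *)
Lemma sum_matchings_off1 k :
  (\sum_(v : G) #|matchings_off [set v] k| + k.*2 * num_matchings G k =
   #|G| * num_matchings G k)%N.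
Proof.
have -> : (\sum_(v : G) #|matchings_off [set v] k| =
   \sum_(M in matchings_off set0 k) #|~: cover M|)%N.
  under eq_bigr do rewrite -sum1_card.
  rewrite (exchange_big_dep (fun M => M \in matchings_off set0 k)) /=; last first.
    move=> v M _; rewrite !inE => /and4P[-> -> -> _] /=.
    by rewrite disjoint_sym disjoints_subset sub0set.
  apply: eq_bigr => M; rewrite inE => /and4P[sM tM cM dM].
  rewrite sum1dep_card; apply: eq_card => v; rewrite !inE sM tM cM /=.
  by rewrite disjoint_sym disjoints1.
have E : {in matchings_off set0 k, forall M, (#|~: cover M| + k.*2 = #|G|)%N}.
  move=> M; rewrite inE => /and4P[sM tM /eqP cM _].
  by rewrite -(cover_matching sM tM cM) addnC cardsC.
rewrite num_matchingsE -sum1_card !big_distrr /= -big_split /=.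
by apply: eq_bigr => M /E; rewrite !muln1.
Qed.

End Matchings.

Local Open Scope ring_scope.

(** * Closed walks in path trees *)

Section PathTree.
Variable G : sgraph.
Implicit Types (X : {set G}) (u v : G).

(* Entry [j] counts the closed walks of length [2 j] at the root of the path
   tree of [v] in [G - X], whose nodes are the paths of [G - X] issuing from
   [v]: such a walk first enters the subtree of a child [u] of the root. *)
Fixpoint path_tree_walks n X v : seq int :=
  if n is n'.+1 then
    let s := path_tree_walks n' X v in
    rcons s (\sum_(u | adj v u && (u \notin v |: X))
       \sum_(i < n) (path_tree_walks n' (v |: X) u)`_i * s`_(n' - i)%N)
  else [:: 1].

Definition tree_walks j X v : int := (path_tree_walks j X v)`_j.

Definition child_sum X v (F : G -> int) : int :=
  \sum_(u | adj v u && (u \notin v |: X)) F u.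

Lemma size_path_tree_walks n X v : size (path_tree_walks n X v) = n.+1.
Proof. by elim: n => //= n IHn; rewrite size_rcons IHn. Qed.

Lemma nth_path_tree_walks n j X v : (j <= n)%N ->
  (path_tree_walks n X v)`_j = tree_walks j X v.
Proof.
elim: n => [|n IHn]; first by rewrite leqn0 => /eqP->.
rewrite leq_eqVlt => /orP[/eqP->//|]; rewrite ltnS => jn /=.
by rewrite nth_rcons size_path_tree_walks ltnS jn IHn.
Qed.

Lemma tree_walks0 X v : tree_walks 0 X v = 1. Proof. by []. Qed.

Lemma tree_walksS j X v : tree_walks j.+1 X v =
  \sum_(i < j.+1) child_sum X v (tree_walks i (v |: X)) * tree_walks (j - i)%N X v.
Proof.
rewrite /tree_walks /= nth_rcons size_path_tree_walks ltnn eqxx exchange_big /=.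
apply: eq_bigr => i _; rewrite /child_sum mulr_suml; apply: eq_bigr => u _.
by rewrite !nth_path_tree_walks ?leq_subr // -ltnS.
Qed.

Lemma triangle_sum n (F : nat -> nat -> int) :
  \sum_(i < n) \sum_(l < (n - i)%N) F i l = \sum_(j < n) \sum_(i < j.+1) F i (j - i)%N.
Proof.
elim: n => [|n IHn]; first by rewrite !big_ord0.
rewrite [in RHS]big_ord_recr /= -IHn [in RHS]big_ord_recr /= addrA -big_split /=.
rewrite big_ord_recr /= subSnn big_ord1 subnn; congr (_ + _).
by apply: eq_bigr => i _; rewrite subSn ?big_ord_recr // ltnW.
Qed.

(** With $M_X(x)=\sum_k m_k(G-X)x^k$ and $W_v$ the generating function of the walks, this is
    $M_{X\cup v}(x)=W_v(-x)M_X(x)$. Divided by $M_{X\cup v}$, the vertex recurrence reads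
    $1/W_v(-x)=1+x\sum_u W_u(-x)$, which is the first-return equation [tree_walksS]. *)
Lemma matchings_off_expansion k X v : v \notin X ->
  (#|matchings_off (v |: X) k|%:Z =
   \sum_(j < k.+1) (-1) ^+ j * tree_walks j X v * #|matchings_off X (k - j)%N|%:Z).
Proof.
elim/ltn_ind: k X v => -[|k] IHk X v vX.
  by rewrite big_ord1 !matchings_off0 tree_walks0 !mulr1.
have := matchings_offS k vX; move/(congr1 Posz); rewrite PoszD => E.
rewrite big_ord_recl /= expr0 tree_walks0 !mul1r subn0.
rewrite E.
rewrite -[LHS]addr0 -addrA.
congr (_ + _).
(* Induction is used at [u] off [v |: X], then at [v] off [X]; grouped by [i + l], the outcome
   cancels all terms with [j > 0]. *)
have -> : (\sum_(u | adj v u && (u \notin v |: X))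
     #|matchings_off (u |: (v |: X)) k|)%N%:Z =
  \sum_(i < k.+1) \sum_(l < (k.+1 - i)%N) (-1) ^+ (i + l)%N *
    child_sum X v (tree_walks i (v |: X)) * tree_walks l X v
      * #|matchings_off X (k - (i + l))%N|%:Z.
  rewrite (big_morph Posz PoszD (erefl _)).
  under eq_bigr => u /andP[_ uX] do rewrite IHk //.
  rewrite exchange_big /=; apply: eq_bigr => i _.
  rewrite -mulr_suml IHk ?ltnS ?leq_subr // mulr_sumr subSn -1?ltnS //.
  apply: eq_bigr => l _; rewrite -mulr_sumr exprD subnDA /child_sum; ring.
rewrite (triangle_sum k.+1 (fun i l => (-1) ^+ (i + l)%N *
    child_sum X v (tree_walks i (v |: X)) * tree_walks l X v
      * #|matchings_off X (k - (i + l))%N|%:Z)) -big_split /= big1 // => j _.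
rewrite /bump /= add1n subSS tree_walksS exprS mulr_sumr mulr_suml -big_split /= big1 // => i _.
have -> : (i + (j - i) = j)%N by rewrite subnKC // -ltnS.
ring.
Qed.

(** Newton's identities: the walk sums over all roots are the even power sums of the zeros of the
    matching polynomial. In the sum over [v], the term [j = 0] is $|G|$ times the matching number
    and cancels in [sum_matchings_off1]. *)
Lemma num_matchings_newton k :
  (k.*2 * num_matchings G k)%N%:Z =
  \sum_(j < k) (-1) ^+ j * (\sum_(v : G) tree_walks j.+1 set0 v)
     * (num_matchings G (k - j.+1)%N)%:Z.
Proof.
have /(congr1 Posz) := sum_matchings_off1 G k; rewrite PoszD => E.
have {E} -> : (k.*2 * num_matchings G k)%N%:Z = #|G|%:Z * (num_matchings G k)%:Z -
  (\sum_(v : G) #|matchings_off [set v] k|)%N%:Z by rewrite -PoszM -{}E; ring.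
rewrite (big_morph Posz PoszD (erefl _)).
under eq_bigr => v _ do rewrite -[[set v]]setU0 matchings_off_expansion ?inE // big_ord_recl /=.
rewrite big_split /= (eq_bigr (fun=> (num_matchings G k)%:Z)); last first.
  by move=> v _; rewrite expr0 tree_walks0 !mul1r subn0 num_matchingsE.
rewrite sumr_const -[X in _ - (X + _)]mulr_natl natz opprD addrA subrr add0r.
rewrite exchange_big /= -sumrN; apply: eq_bigr => j _.
rewrite -mulr_suml -mulr_sumr /bump /= add1n exprS num_matchingsE; ring.
Qed.

End PathTree.

(** * Closed walks in nearly regular path trees *)

Section Defects.
Variable G : sgraph.
Implicit Types (X : {set G}) (u v : G).

(* [defect 0] measures by how much the number of children of a node of the path
   tree falls short of its generic value 2, and [defect n] sums these deficits
   over the nodes at depth [n] below. *)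
Fixpoint defect n X v : int :=
  if n is n'.+1 then child_sum X v (defect n' (v |: X))
  else 2 - child_sum X v (fun=> 1).

Arguments defect : simpl never.

Definition is_child X v u := adj v u && (u \notin v |: X).

(** Defects of the children add up to a defect one level deeper, so walk numbers that are affine in
    the defects have child sums that are affine again. *)
Lemma child_sum_affine X v (f F1 F2 F3 : G -> int) (c k1 k2 k3 : int) :
  (forall u, is_child X v u -> f u = c + k1 * F1 u + k2 * F2 u + k3 * F3 u) ->
  child_sum X v f = c * (2 - defect 0 X v) + k1 * child_sum X v F1
    + k2 * child_sum X v F2 + k3 * child_sum X v F3.
Proof.
move=> fE; rewrite /defect /child_sum (eq_bigr _ fE) !big_split /= -!mulr_sumr.
do 3!congr (_ + _); rewrite opprB addrC subrK mulr_sumr.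
by apply: eq_bigr => u _; rewrite mulr1.
Qed.

Lemma defect_sum n X v : child_sum X v (defect n (v |: X)) = defect n.+1 X v.
Proof. by []. Qed.

Lemma tree_walks1 X v : tree_walks 1 X v = 2 - defect 0 X v.
Proof. by rewrite tree_walksS big_ord1 tree_walks0 mulr1 /defect opprB addrC subrK. Qed.

Lemma child_sum_walks0 X v : child_sum X v (tree_walks 0 (v |: X)) = 2 - defect 0 X v.
Proof. by rewrite /defect opprB addrC subrK. Qed.

Lemma child_sum_walks1 X v :
  child_sum X v (tree_walks 1 (v |: X)) = 2 * (2 - defect 0 X v) - defect 1 X v.
Proof.
rewrite (@child_sum_affine _ _ _ (defect 0 (v |: X)) (fun=> 0) (fun=> 0) 2 (-1) 0 0).
  by rewrite defect_sum; ring.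
by move=> u _; rewrite tree_walks1; ring.
Qed.

(** The square of a bit is linear; this removes quadratic terms from the recursion for walks. *)
Definition bit (x : int) := x = 0 \/ x = 1.

(** The constants 8, 40, 224 and 1344 here and below are $2^j$ times Catalan numbers: closed walks
    of length $2j$ at the root of a tree in which every node has two children. *)
Lemma tree_walks2 X v : bit (defect 0 X v) ->
  tree_walks 2 X v = 8 - 5 * defect 0 X v - defect 1 X v.
Proof.
move=> b; rewrite tree_walksS !big_ord_recl big_ord0 /bump /= child_sum_walks0 child_sum_walks1.
rewrite tree_walks0 tree_walks1; move: (defect 1 X v) => B.
by case: b => ->; ring.
Qed.

(** The number in [depth3_like], [depth2_like] and [depth1_like] is the depth in a path tree at
    which the property is meant to hold. A defect at depth 3 is an edge back to the root that closes
    a 4-cycle; a further defect at a child would create a $K_{2,3}$, so products of such defects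
    vanish. *)
Definition depth3_like X v :=
  (defect 0 X v = 0 \/ defect 0 X v = 1 /\ defect 1 X v = 0) /\
  (forall u, is_child X v u -> bit (defect 0 (v |: X) u)).

Lemma child_sum_walks2 X v : (forall u, is_child X v u -> bit (defect 0 (v |: X) u)) ->
  child_sum X v (tree_walks 2 (v |: X)) =
  8 * (2 - defect 0 X v) - 5 * defect 1 X v - defect 2 X v.
Proof.
move=> H; rewrite (@child_sum_affine _ _ _ (defect 0 (v |: X)) (defect 1 (v |: X)) (fun=> 0) 8 (-5) (-1) 0).
  by rewrite !defect_sum; ring.
by move=> u ux; rewrite tree_walks2; [ring | apply: H].
Qed.

Lemma tree_walks3 X v : depth3_like X v ->
  tree_walks 3 X v = 40 - 27 * defect 0 X v - 9 * defect 1 X v - defect 2 X v.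
Proof.
move=> [b H]; rewrite tree_walksS !big_ord_recl big_ord0 /bump /=.
rewrite child_sum_walks0 child_sum_walks1 child_sum_walks2 // tree_walks0 tree_walks1.
rewrite tree_walks2; last by case: b => [|[]]; [left|right].
move: (defect 2 X v) => B2.
by case: b => [-> | [-> ->]]; ring.
Qed.

Definition depth2_like X v :=
  [/\ defect 0 X v = 0, bit (defect 1 X v) &
      forall u, is_child X v u -> depth3_like (v |: X) u].

Lemma depth3_bit X v : depth3_like X v -> bit (defect 0 X v).
Proof. by case=> [[->|[-> _]] _]; [left|right]. Qed.

Lemma child_sum_walks3 X v : (forall u, is_child X v u -> depth3_like (v |: X) u) ->
  child_sum X v (tree_walks 3 (v |: X)) =
  40 * (2 - defect 0 X v) - 27 * defect 1 X v - 9 * defect 2 X v - defect 3 X v.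
Proof.
move=> H; rewrite (@child_sum_affine _ _ _ (defect 0 (v |: X)) (defect 1 (v |: X))
  (defect 2 (v |: X)) 40 (-27) (-9) (-1)).
  by rewrite !defect_sum; ring.
by move=> u ux; rewrite tree_walks3; [ring | apply: H].
Qed.

Lemma depth2_depth3 X v : depth2_like X v -> depth3_like X v.
Proof. by case=> h0 _ h; split=> [|u /h /depth3_bit //]; left. Qed.

Lemma tree_walks4 X v : depth2_like X v ->
  tree_walks 4 X v = 224 - 66 * defect 1 X v - 13 * defect 2 X v - defect 3 X v.
Proof.
move=> d2; have [h0 b H] := d2; have d3 := depth2_depth3 d2.
rewrite tree_walksS !big_ord_recl big_ord0 /bump /= /bump /=.
rewrite child_sum_walks0 child_sum_walks1 child_sum_walks2; last by case: d3.
rewrite child_sum_walks3 // tree_walks0 tree_walks1 tree_walks2; last exact: depth3_bit.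
rewrite tree_walks3 // h0.
move: (defect 2 X v) (defect 3 X v) => B2 B3.
by case: b => ->; ring.
Qed.

Definition depth1_like X v :=
  defect 0 X v = 0 /\ forall u, is_child X v u -> depth2_like (v |: X) u.

Lemma depth1_defect1 X v :
  (forall u, is_child X v u -> defect 0 (v |: X) u = 0) -> defect 1 X v = 0.
Proof. by move=> H; rewrite -defect_sum /child_sum big1. Qed.

Lemma depth1_depth2 X v : depth1_like X v -> depth2_like X v.
Proof.
case=> h0 H; split=> // [|u /H/depth2_depth3 //].
by left; apply: depth1_defect1 => u /H[].
Qed.

Lemma child_sum_walks4 X v : (forall u, is_child X v u -> depth2_like (v |: X) u) ->
  child_sum X v (tree_walks 4 (v |: X)) =
  224 * (2 - defect 0 X v) - 66 * defect 2 X v - 13 * defect 3 X v - defect 4 X v.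
Proof.
move=> H; rewrite (@child_sum_affine _ _ _ (defect 1 (v |: X)) (defect 2 (v |: X))
  (defect 3 (v |: X)) 224 (-66) (-13) (-1)).
  by rewrite !defect_sum; ring.
by move=> u ux; rewrite tree_walks4; [ring | apply: H].
Qed.

Lemma tree_walks5 X v : depth1_like X v ->
  tree_walks 5 X v = 1344 - 122 * defect 2 X v - 17 * defect 3 X v - defect 4 X v.
Proof.
move=> d1; have [h0 H] := d1; have d2 := depth1_depth2 d1; have d3 := depth2_depth3 d2.
have h1 : defect 1 X v = 0 by apply: depth1_defect1 => u /H[].
rewrite tree_walksS !big_ord_recl big_ord0 /bump /= /bump /= /bump /=.
rewrite child_sum_walks0 child_sum_walks1 child_sum_walks2; last by case: d3.
rewrite child_sum_walks3; last by case: d2.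
rewrite child_sum_walks4 // tree_walks0 tree_walks1 tree_walks2; last exact: depth3_bit.
by rewrite tree_walks3 // tree_walks4 // h0 h1; ring.
Qed.

Lemma child_sum_walks5 X v : (forall u, is_child X v u -> depth1_like (v |: X) u) ->
  child_sum X v (tree_walks 5 (v |: X)) =
  1344 * (2 - defect 0 X v) - 122 * defect 3 X v - 17 * defect 4 X v - defect 5 X v.
Proof.
move=> H; rewrite (@child_sum_affine _ _ _ (defect 2 (v |: X)) (defect 3 (v |: X))
  (defect 4 (v |: X)) 1344 (-122) (-17) (-1)).
  by rewrite !defect_sum; ring.
by move=> u ux; rewrite tree_walks5; [ring | apply: H].
Qed.

(* The constants count the closed walks at a vertex of the 3-regular tree; 23823 is
   kept as the product 9 * 2647 because a numeral unfolds to a unary number. *)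
Lemma tree_walks_root X v : defect 0 X v = -1 ->
    (forall u, is_child X v u -> depth1_like (v |: X) u) ->
  [/\ tree_walks 1 X v = 3, tree_walks 2 X v = 15, tree_walks 3 X v = 87 &
  [/\  tree_walks 4 X v = 543 - defect 3 X v,
      tree_walks 5 X v = 3543 - 19 * defect 3 X v - defect 4 X v &
      tree_walks 6 X v = 9 * 2647 - 239 * defect 3 X v - 23 * defect 4 X v - defect 5 X v]].
Proof.
move=> h0 H; have H2 u : is_child X v u -> depth2_like (v |: X) u by move/H/depth1_depth2.
have H3 u : is_child X v u -> depth3_like (v |: X) u by move/H2/depth2_depth3.
have H4 u : is_child X v u -> bit (defect 0 (v |: X) u) by move/H3/depth3_bit.
have h1 : defect 1 X v = 0 by apply: depth1_defect1 => u /H[].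
have h2 : defect 2 X v = 0.
  by rewrite -defect_sum /child_sum big1 // => u /H[_ H1]; apply: depth1_defect1 => w /H1[].
have s0 := child_sum_walks0 X v; have s1 := child_sum_walks1 X v.
have s2 := child_sum_walks2 H4; have s3 := child_sum_walks3 H3.
have s4 := child_sum_walks4 H2; have s5 := child_sum_walks5 H.
rewrite h0 h1 h2 in s0 s1 s2 s3 s4 s5.
have w1 : tree_walks 1 X v = 3 by rewrite tree_walks1 h0.
have w2 : tree_walks 2 X v = 15.
  by rewrite tree_walksS !big_ord_recl big_ord0 /bump /= s0 s1 tree_walks0 w1; ring.
have w3 : tree_walks 3 X v = 87.
  by rewrite tree_walksS !big_ord_recl big_ord0 /bump /= /bump /= s0 s1 s2 tree_walks0 w1 w2; ring.
have w4 : tree_walks 4 X v = 543 - defect 3 X v.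
  rewrite tree_walksS !big_ord_recl big_ord0 /bump /= /bump /=.
  by rewrite s0 s1 s2 s3 tree_walks0 w1 w2 w3; ring.
have w5 : tree_walks 5 X v = 3543 - 19 * defect 3 X v - defect 4 X v.
  rewrite tree_walksS !big_ord_recl big_ord0 /bump /= /bump /= /bump /=.
  by rewrite s0 s1 s2 s3 s4 tree_walks0 w1 w2 w3 w4; ring.
do 2![split=> //].
rewrite tree_walksS !big_ord_recl big_ord0 /bump /= /bump /= /bump /= /bump /=.
by rewrite s0 s1 s2 s3 s4 s5 tree_walks0 w1 w2 w3 w4 w5; ring.
Qed.
End Defects.

(** * Six-matchings of cubic graphs with few short cycles *)

Definition cyc4 (G : sgraph) (a b c d : G) :=
  [&& uniq [:: a; b; c; d], adj a b, adj b c, adj c d & adj d a].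

Definition cyc6 (G : sgraph) (a b c d e f : G) :=
  [&& uniq [:: a; b; c; d; e; f], adj a b, adj b c, adj c d, adj d e, adj e f & adj f a].

Definition rooted4 (G : sgraph) : nat :=
  \sum_(a : G) \sum_b \sum_c \sum_d cyc4 a b c d.

Definition rooted6 (G : sgraph) : nat :=
  \sum_(a : G) \sum_b \sum_c \sum_d \sum_e \sum_f cyc6 a b c d e f.

Ltac split_ands := repeat match goal with
  H : is_true (_ && _) |- _ => let H1 := fresh "K" in let H2 := fresh "K" in
    case/andP: H => H1 H2 end.
Ltac neqs := rewrite /= ?inE ?negb_or ?andbT ?orbF -?andbA; repeat (apply/andP; split);
  first [by [] | by rewrite eq_sym | by rewrite adj_sym
    | by apply: adj_neq | by apply: adj_neq; rewrite adj_sym].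

(** [8 + 2 * H] is the number of vertices. The 48 are the eight rooted orientations of each of six
    squares, as seen by the defects of depths 3 and 4; depth 5 sees them twice, and 12 more for each
    of the [C] cycles of length 6. *)
Lemma newton_solve (F : realFieldType) (H C m1 m2 m3 m4 m5 m6 W1 W2 W3 W4 W5 W6 : F) :
  W1 = 3 * (8 + 2 * H) -> W2 = 15 * (8 + 2 * H) -> W3 = 87 * (8 + 2 * H) ->
  W4 = 543 * (8 + 2 * H) - 48 -> W5 = 3543 * (8 + 2 * H) - 19 * 48 - 48 ->
  W6 = 9 * 2647 * (8 + 2 * H) - 239 * 48 - 23 * 48 - (12 * C + 96) ->
  2 * m1 = W1 -> 4 * m2 = W1 * m1 - W2 -> 6 * m3 = W1 * m2 - W2 * m1 + W3 ->
  8 * m4 = W1 * m3 - W2 * m2 + W3 * m1 - W4 ->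
  10 * m5 = W1 * m4 - W2 * m3 + W3 * m2 - W4 * m1 + W5 ->
  12 * m6 = W1 * m5 - W2 * m4 + W3 * m3 - W4 * m2 + W5 * m1 - W6 ->
  m6 = 81 / 80 * H ^+ 6 - 81 / 80 * H ^+ 5 - 99 / 16 * H ^+ 4
       + 405 / 16 * H ^+ 3 - 1873 / 40 * H ^+ 2 + 397 / 10 * H - 16 + C.
Proof.
move=> w1 w2 w3 w4 w5 w6 e1 e2 e3 e4 e5 e6.
have m1E : m1 = 12 + 3 * H by lra.
have m2E : m2 = 42 + 57 / 2 * H + 9 / 2 * H ^+ 2 by rewrite w1 w2 m1E in e2; lra.
have m3E : m3 = 44 + 65 * H + 63 / 2 * H ^+ 2 + 9 / 2 * H ^+ 3.
  by rewrite w1 w2 w3 m1E m2E in e3; lra.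
have m4E : m4 = 9 + 117 / 4 * H + 273 / 8 * H ^+ 2 + 81 / 4 * H ^+ 3 + 27 / 8 * H ^+ 4.
  by rewrite w1 w2 w3 w4 m1E m2E m3E in e4; lra.
have m5E : m5 = 81 / 40 * H ^+ 5 + 27 / 4 * H ^+ 4 - 9 / 8 * H ^+ 3 + 39 / 4 * H ^+ 2 - 27 / 5 * H.
  by rewrite w1 w2 w3 w4 w5 m1E m2E m3E m4E in e5; lra.
by rewrite w1 w2 w3 w4 w5 w6 m1E m2E m3E m4E m5E in e6; lra.
Qed.

(** * Defects counted by short cycles *)

Section Counting.
Variable G : sgraph.
Implicit Types (X : {set G}) (u v a b c d e f : G).
Hypothesis cubic : forall v, #|[set w | adj v w]| = 3%N.
Hypothesis no3 : forall a b c : G, adj a b -> adj b c -> adj c a = false.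
Hypothesis no5 : forall a b c d e : G, uniq [:: a; b; c; d; e] ->
  adj a b -> adj b c -> adj c d -> adj d e -> adj e a = false.
Hypothesis noK23 : forall x y a b c : G, x != y -> uniq [:: a; b; c] ->
  adj x a -> adj x b -> adj x c -> adj y a -> adj y b -> adj y c -> False.

Definition nbrs_in X v : nat := #|[set u in X | adj v u]|.

Lemma nbrs_in0 v : nbrs_in set0 v = 0%N.
Proof. by rewrite /nbrs_in (_ : [set _ in _ | _] = set0) ?cards0 //; apply/setP=> u; rewrite !inE. Qed.

Lemma nbrs_inU X v a : a \notin X -> nbrs_in (a |: X) v = (adj v a + nbrs_in X v)%N.
Proof.
move=> aX; rewrite /nbrs_in; case va: (adj v a).
  rewrite (_ : [set u in a |: X | adj v u] = a |: [set u in X | adj v u]).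
    by rewrite cardsU1 !inE (negbTE aX).
  by apply/setP=> u; rewrite !inE andb_orl; case: eqP => //= ->; rewrite va.
congr #|pred_of_set _|; apply/setP=> u; rewrite !inE andb_orl.
by case: eqP => //= ->; rewrite va (negbTE aX).
Qed.

(** At a vertex of degree 3 the deficit counts the neighbours already on the path other than the
    parent; the root has no parent and gets -1. *)
Lemma defect0E X v : v \notin X -> defect 0 X v = (nbrs_in X v)%:Z - 1.
Proof.
move=> vX; rewrite /defect /child_sum sumr_const.
have := cardsID X [set w | adj v w]; rewrite cubic => E.
have -> : #|[pred u | adj v u && (u \notin v |: X)]| = #|[set w | adj v w] :\: X|.
  apply: eq_card => u; rewrite !inE; case vu: (adj v u); rewrite ?andbF //=.
  by rewrite negb_or eq_sym adj_neq // andbT.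
have -> : nbrs_in X v = #|[set w | adj v w] :&: X|.
  by apply: eq_card => u; rewrite !inE andbC.
rewrite natz; lia.
Qed.

Lemma adjC a b : adj a b -> adj b a. Proof. by rewrite adj_sym. Qed.

Lemma defect_root v : defect 0 set0 v = -1.
Proof. by rewrite defect0E ?inE // nbrs_in0. Qed.

Lemma defect_depth1 a b : is_child set0 a b -> defect 0 (a |: set0) b = 0.
Proof.
rewrite /is_child => /andP[ab bX].
by rewrite defect0E // nbrs_inU ?inE // nbrs_in0 adjC.
Qed.

Lemma defect_depth2 a b c : is_child set0 a b -> is_child (a |: set0) b c ->
  defect 0 (b |: (a |: set0)) c = 0.
Proof.
rewrite /is_child => /andP[ab bX] /andP[bc cX].
rewrite defect0E // !nbrs_inU ?inE ?nbrs_in0 //; last by move: bX; rewrite !inE.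
by rewrite (adjC bc) (no3 ab bc).
Qed.

Lemma defect_depth3 a b c d : is_child set0 a b -> is_child (a |: set0) b c ->
  is_child (b |: (a |: set0)) c d ->
  defect 0 (c |: (b |: (a |: set0))) d = adj d a.
Proof.
rewrite /is_child => /andP[ab bX] /andP[bc cX] /andP[cd dX].
rewrite defect0E // !nbrs_inU ?inE ?nbrs_in0 //; [|by move: bX; rewrite !inE|by move: cX; rewrite !inE].
by rewrite (adjC cd) (no3 bc cd) /=; case: adj.
Qed.

Lemma defect_depth4 a b c d e : is_child set0 a b -> is_child (a |: set0) b c ->
  is_child (b |: (a |: set0)) c d -> is_child (c |: (b |: (a |: set0))) d e ->
  defect 0 (d |: (c |: (b |: (a |: set0)))) e = adj e b.
Proof.
rewrite /is_child => /andP[ab bX] /andP[bc cX] /andP[cd dX] /andP[de eX].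
rewrite defect0E // !nbrs_inU ?nbrs_in0 ?inE //;
  [|by move: bX; rewrite !inE|by move: cX; rewrite !inE|by move: dX; rewrite !inE].
rewrite (adjC de) (no3 cd de) (@no5 a b c d e) //=; first by case: adj.
rewrite !inE !negb_or in bX cX dX eX; split_ands; neqs.
Qed.

(** Besides the parent, only [c] and [a] can be earlier neighbours of [f]: [d] would close a
    triangle and [b] a pentagon. *)
Lemma defect_depth5 a b c d e f : is_child set0 a b -> is_child (a |: set0) b c ->
  is_child (b |: (a |: set0)) c d -> is_child (c |: (b |: (a |: set0))) d e ->
  is_child (d |: (c |: (b |: (a |: set0)))) e f ->
  defect 0 (e |: (d |: (c |: (b |: (a |: set0))))) f = (adj f c + adj f a)%N.
Proof.
rewrite /is_child => /andP[ab bX] /andP[bc cX] /andP[cd dX] /andP[de eX] /andP[ef fX].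
rewrite defect0E // !nbrs_inU ?nbrs_in0 ?inE //; [|by move: bX; rewrite !inE|by move: cX; rewrite !inE
  |by move: dX; rewrite !inE|by move: eX; rewrite !inE].
rewrite (adjC ef) (no3 de ef) (@no5 b c d e f) //=; first by case: (adj f c); case: adj.
rewrite !inE !negb_or in bX cX dX eX fX; split_ands; neqs.
Qed.

(** Two defective children of [c] would be, with [b], three common neighbours of [a] and [c]. A
    defective [d] with a defective child [e] would make [a], [c], [e] common neighbours of [b] and
    [d]. *)
Lemma depth2_root a b c : is_child set0 a b -> is_child (a |: set0) b c ->
  depth2_like (b |: (a |: set0)) c.
Proof.
move=> ab bc; split.
- exact: defect_depth2.
- rewrite -defect_sum /child_sum (eq_bigr _ (fun d cd => defect_depth3 ab bc cd)).
  rewrite -(big_morph Posz PoszD (erefl _)) /=.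
  rewrite (eq_bigr (fun d => if adj d a then 1 else 0)%N); last by move=> d _; case: adj.
  rewrite -big_mkcondr /= sum1_card; case E: #|_| => [|[|n]]; [by left|by right|].
  have: (1 < #|[pred d | is_child (b |: (a |: set0)) c d && adj d a]|)%N by rewrite E.
  case/card_gt1P => x [y [/andP[/andP[cx xX] xa] /andP[/andP[cy yX] ya] xy]].
  move: ab bc xX yX; rewrite /is_child !inE !negb_or => ? ? ? ?; split_ands.
  by case: (@noK23 a c b x y); rewrite ?[adj a x]adj_sym ?[adj a y]adj_sym ?[adj c b]adj_sym //; neqs.
- move=> d cd; split; last first.
    move=> e de; rewrite defect_depth4 //; case: adj; [by right|by left].
  rewrite (defect_depth3 ab bc cd); case da: (adj d a); [right|by left]; split => //.
  rewrite -defect_sum /child_sum big1 // => e de; rewrite defect_depth4 //.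
  case eb: (adj e b) => //; move: ab bc cd de.
  rewrite /is_child !inE !negb_or => ? ? ? ?; split_ands.
  by case: (@noK23 b d a c e); rewrite ?[adj b a]adj_sym ?[adj b e]adj_sym ?[adj d c]adj_sym //; neqs.
Qed.

Lemma depth1_root a b : is_child set0 a b -> depth1_like (a |: set0) b.
Proof. by move=> ab; split=> [|c bc]; [apply: defect_depth1|apply: depth2_root]. Qed.

Definition sum_defect n := \sum_(v : G) defect n set0 v.

Lemma sum_tree_walks :
  [/\ \sum_(v : G) tree_walks 1 set0 v = 3 * #|G|%:Z,
      \sum_(v : G) tree_walks 2 set0 v = 15 * #|G|%:Z,
      \sum_(v : G) tree_walks 3 set0 v = 87 * #|G|%:Z &
  [/\ \sum_(v : G) tree_walks 4 set0 v = 543 * #|G|%:Z - sum_defect 3,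
      \sum_(v : G) tree_walks 5 set0 v = 3543 * #|G|%:Z - 19 * sum_defect 3 - sum_defect 4 &
      \sum_(v : G) tree_walks 6 set0 v =
        9 * 2647 * #|G|%:Z - 239 * sum_defect 3 - 23 * sum_defect 4 - sum_defect 5]].
Proof.
have H v := tree_walks_root (defect_root v) (@depth1_root v).
have cst (c : int) : \sum_(v : G) c = c * #|G|%:Z by rewrite sumr_const -mulr_natr natz.
rewrite /sum_defect; split; [..|split].
- by rewrite -cst; apply: eq_bigr => v _; case: (H v).
- by rewrite -cst; apply: eq_bigr => v _; case: (H v).
- by rewrite -cst; apply: eq_bigr => v _; case: (H v).
- by rewrite -cst -sumrB; apply: eq_bigr => v _; case: (H v) => ? ? ? [].
- by rewrite -cst mulr_sumr -!sumrB; apply: eq_bigr => v _; case: (H v) => ? ? ? [].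
- by rewrite -cst !mulr_sumr -!sumrB; apply: eq_bigr => v _; case: (H v) => ? ? ? [].
Qed.

(** Turns a sum over children into a sum over all vertices, so that nested child sums become counts
    of tuples. *)
Lemma sum_cond_eq (T : finType) (P : pred T) (F : T -> int) (E : T -> nat) :
  (forall x, P x -> F x = (E x)%:Z) -> (forall x, ~~ P x -> E x = 0%N) ->
  \sum_(x | P x) F x = (\sum_x E x)%N.
Proof.
move=> FE E0; rewrite (eq_bigr _ FE) (big_morph Posz PoszD (erefl _)) /= [RHS](bigID P) /=.
by rewrite [X in _ + X]big1 ?addr0 // => x /E0->.
Qed.

Lemma sum_nat0 (T : finType) (F : T -> nat) :
  (forall x, F x = 0%N) -> (\sum_x F x = 0)%N.
Proof. by move=> F0; rewrite big1. Qed.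

Ltac not_child := let H := fresh "H" in
  rewrite /is_child !inE => H;
  repeat (apply: sum_nat0 => ?); apply/eqP; rewrite eqb0;
  apply: contra H; rewrite /cyc4 /cyc6 /= !inE !negb_or => ?; split_ands; neqs.

Ltac all_children := rewrite /is_child !inE !negb_or; intros; split_ands.

Lemma sum_defect3 : sum_defect 3 = rooted4 G.
Proof.
rewrite /sum_defect /rooted4; apply: sum_cond_eq => // a _.
rewrite -defect_sum; apply: sum_cond_eq => b; last by not_child.
move=> ab; rewrite -defect_sum; apply: sum_cond_eq => c; last by not_child.
move=> bc; rewrite -defect_sum; apply: sum_cond_eq => d; last by not_child.
move=> cd; rewrite defect_depth3 //; congr (Posz (nat_of_bool _)); move: ab bc cd; all_children.
rewrite /cyc4; case: (adj d a); rewrite ?andbF // ?andbT; symmetry; neqs.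
Qed.

(** A path that closes on a vertex after its root leaves its beginning as a tail of the cycle, of
    one edge here and of two in [pend4']. *)
Definition pend4 x a b c d := cyc4 a b c d && adj a x && (x \notin [:: b; c; d]).

Definition pend4' y x a b c d := pend4 x a b c d && adj x y && (y \notin [:: a; b; c; d]).

Ltac not_child' := let H := fresh "H" in
  rewrite /is_child !inE => H;
  repeat (apply: sum_nat0 => ?); apply/eqP; rewrite ?addn_eq0 ?eqb0; 
  try (apply/andP; split);
  apply: contra H; rewrite /pend4' /pend4 /cyc4 /cyc6 /= !inE !negb_or => ?; split_ands; neqs.

Lemma sum_defect4_pend : sum_defect 4 =
  (\sum_(a : G) \sum_b \sum_c \sum_d \sum_e pend4 a b c d e)%N.
Proof.
rewrite /sum_defect; apply: sum_cond_eq => // a _.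
rewrite -defect_sum; apply: sum_cond_eq => b; last by not_child'.
move=> ab; rewrite -defect_sum; apply: sum_cond_eq => c; last by not_child'.
move=> bc; rewrite -defect_sum; apply: sum_cond_eq => d; last by not_child'.
move=> cd; rewrite -defect_sum; apply: sum_cond_eq => e; last by not_child'.
move=> de; rewrite defect_depth4 //; congr (Posz (nat_of_bool _)); move: ab bc cd de; all_children.
rewrite /pend4 /cyc4 (adj_sym b a); case: (adj e b); rewrite ?andbF // ?andbT; symmetry; neqs.
Qed.

Lemma sum_defect5_pend : sum_defect 5 =
  (rooted6 G + \sum_(a : G) \sum_b \sum_c \sum_d \sum_e \sum_f pend4' a b c d e f)%N.
Proof.
have -> : (rooted6 G + \sum_(a : G) \sum_b \sum_c \sum_d \sum_e \sum_f pend4' a b c d e f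
  = \sum_(a : G) \sum_b \sum_c \sum_d \sum_e \sum_f (cyc6 a b c d e f + pend4' a b c d e f))%N.
  rewrite /rooted6 -big_split /=; apply: eq_bigr => a _.
  by do 4![rewrite -big_split /=; apply: eq_bigr => ? _]; rewrite -big_split.
rewrite /sum_defect; apply: sum_cond_eq => // a _.
rewrite -defect_sum; apply: sum_cond_eq => b; last by not_child'.
move=> ab; rewrite -defect_sum; apply: sum_cond_eq => c; last by not_child'.
move=> bc; rewrite -defect_sum; apply: sum_cond_eq => d; last by not_child'.
move=> cd; rewrite -defect_sum; apply: sum_cond_eq => e; last by not_child'.
move=> de; rewrite -defect_sum; apply: sum_cond_eq => f; last by not_child'.
move=> ef; rewrite defect_depth5 // addnC; congr (Posz (nat_of_bool _ + nat_of_bool _)%N);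
  move: ab bc cd de ef; all_children.
  by rewrite /cyc6; case: (adj f a); rewrite ?andbF // ?andbT; symmetry; neqs.
rewrite /pend4' /pend4 /cyc4 (adj_sym c b) (adj_sym b a).
by case: (adj f c); rewrite ?andbF // ?andbT; symmetry; neqs.
Qed.

Lemma swap_sum5 (F : G -> G -> G -> G -> G -> nat) :
  (\sum_a \sum_b \sum_c \sum_d \sum_e F a b c d e =
   \sum_b \sum_c \sum_d \sum_e \sum_a F a b c d e)%N.
Proof.
rewrite exchange_big /=; apply: eq_bigr => b _.
rewrite exchange_big /=; apply: eq_bigr => c _.
rewrite exchange_big /=; apply: eq_bigr => d _.
by rewrite exchange_big.
Qed.

(** The tail is the third edge at [a], which cannot end at [c] without making a triangle. *)
Lemma card_pend4 a b c d : (\sum_x pend4 x a b c d)%N = cyc4 a b c d.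
Proof.
case: (boolP (cyc4 a b c d)) => C; last by rewrite big1 // => x _; rewrite /pend4 (negbTE C).
have := C; rewrite /cyc4 /= !inE !negb_or => ?; split_ands.
have D : #|[set w | adj a w] :&: [set b; d]| = 2.
  have bd : b != d by [].
  suff -> : [set w | adj a w] :&: [set b; d] = [set b; d] by rewrite cards2 bd.
  apply/setIidPr/subsetP => x; rewrite !inE => /orP[]/eqP-> //; by rewrite adj_sym.
have := cardsID [set b; d] [set w | adj a w]; rewrite cubic D => -[] E.
rewrite (eq_bigr (fun x => if x \in [set w | adj a w] :\: [set b; d] then 1 else 0)%N).
  by rewrite -big_mkcond /= sum1_card; case: #|_| E => [|[]].
move=> x _; rewrite /pend4 C /= !inE !negb_or.
case ax: (adj a x); rewrite ?andbF //= andbT.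
case: (x =P c) => [xc|_]; last by case: (x == b); case: (x == d).
have ab : adj a b by []. have bc : adj b c by [].
by have := no3 ab bc; rewrite adj_sym -xc ax.
Qed.

Lemma sum_defect4 : sum_defect 4 = rooted4 G.
Proof.
rewrite sum_defect4_pend swap_sum5; congr Posz.
by rewrite /rooted4; do 4![apply: eq_bigr => ? _]; rewrite card_pend4.
Qed.

(** Both other edges at [x] prolong the tail: an end at [b] or [d] would give a triangle, an end at
    [c] a $K_{2,3}$. *)
Lemma card_pend4' x a b c d : (\sum_y pend4' y x a b c d)%N = (2 * pend4 x a b c d)%N.
Proof.
case: (boolP (pend4 x a b c d)) => C; last by rewrite big1 // => y _; rewrite /pend4' (negbTE C).
have := C; rewrite /pend4 /cyc4 /= !inE !negb_or => ?; split_ands.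
rewrite (eq_bigr (fun y => if y \in [set w | adj x w] :\ a then 1 else 0)%N).
  rewrite -big_mkcond /= sum1_card; have := cardsD1 a [set w | adj x w].
  have ax : adj a x by [].
  by rewrite cubic inE [adj x a]adj_sym ax add1n => -[<-].
move=> y _; rewrite /pend4' C /= !inE !negb_or.
case xy: (adj x y); rewrite ?andbF //= andbT.
have yb : y != b.
  apply: contraTneq xy => ->; rewrite adj_sym; apply/negbT/(@no3 x a) => //; by rewrite adj_sym.
have yd : y != d.
  by apply: contraTneq xy => ->; rewrite adj_sym; apply/negbT/(@no3 x a) => //; rewrite adj_sym.
have yc : y != c.
  apply/eqP => yc; subst y; case: (@noK23 a c x b d) => //; try neqs; by rewrite adj_sym.
by rewrite yb yd yc; case: eqP.
Qed.

Lemma sum_defect5 : sum_defect 5 = (rooted6 G + 2 * rooted4 G)%N.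
Proof.
rewrite sum_defect5_pend; congr (Posz (_ + _)%N).
have -> : (\sum_(a : G) \sum_b \sum_c \sum_d \sum_e \sum_f pend4' a b c d e f =
   \sum_(b : G) \sum_c \sum_d \sum_e \sum_f 2 * pend4 b c d e f)%N.
  rewrite exchange_big /=; apply: eq_bigr => b _.
  rewrite swap_sum5; do 4![apply: eq_bigr => ? _]; exact: card_pend4'.
rewrite swap_sum5 /rooted4 big_distrr /=; apply: eq_bigr => a _.
do 3![rewrite big_distrr /=; apply: eq_bigr => ? _].
by rewrite -card_pend4 big_distrr.
Qed.

Lemma num_matchings6 (h c : nat) : #|G| = (8 + 2 * h)%N -> rooted4 G = 48%N ->
  rooted6 G = (12 * c)%N ->
  (num_matchings G 6)%:R =
          81 / 80 * h%:R ^+ 6 - 81 / 80 * h%:R ^+ 5 - 99 / 16 * h%:R ^+ 4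
          + 405 / 16 * h%:R ^+ 3 - 1873 / 40 * h%:R ^+ 2
          + 397 / 10 * h%:R - 16 + c%:R :> rat.
Proof.
move=> nE r4 r6; have [w1 w2 w3 [w4 w5 w6]] := sum_tree_walks.
have d5 := sum_defect5; rewrite sum_defect3 sum_defect4 in w4 w5 w6.
rewrite d5 r4 r6 nE in w1 w2 w3 w4 w5 w6.
have m0 : num_matchings G 0 = 1%N by rewrite num_matchingsE matchings_off0.
pose H : rat := h%:R; pose C : rat := c%:R.
pose m k : rat := (num_matchings G k)%:R.
pose W k : rat := (\sum_(v : G) tree_walks k set0 v)%:~R.
have N k : m k *+ k.*2 = \sum_(j < k) (-1) ^+ j * W j.+1 * m (k - j.+1)%N.
  have := congr1 (intr : int -> rat) (num_matchings_newton G k).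
  rewrite PoszM intrM -!pmulrn mulrC mulr_natr => ->.
  by rewrite rmorph_sum; apply: eq_bigr => j _; rewrite /= !rmorphM /= rmorphXn /= rmorphN1.
have W1 : W 1%N = 3 * (8 + 2 * H) by rewrite /W w1 !(rmorphB, rmorphM, rmorph_nat) -?pmulrn ?natrD ?natrM; ring.
have W2 : W 2%N = 15 * (8 + 2 * H) by rewrite /W w2 !(rmorphB, rmorphM, rmorph_nat) -?pmulrn ?natrD ?natrM; ring.
have W3 : W 3%N = 87 * (8 + 2 * H) by rewrite /W w3 !(rmorphB, rmorphM, rmorph_nat) -?pmulrn ?natrD ?natrM; ring.
have W4 : W 4%N = 543 * (8 + 2 * H) - 48.
  by rewrite /W w4 !(rmorphB, rmorphM, rmorph_nat) -?pmulrn ?natrD ?natrM; ring.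
have W5 : W 5%N = 3543 * (8 + 2 * H) - 19 * 48 - 48.
  by rewrite /W w5 !(rmorphB, rmorphM, rmorph_nat) -?pmulrn ?natrD ?natrM; ring.
have W6 : W 6%N = 9 * 2647 * (8 + 2 * H) - 239 * 48 - 23 * 48 - (12 * C + 96).
  by rewrite /W w6 !(rmorphB, rmorphM, rmorph_nat) -?pmulrn ?natrD ?natrM; ring.
have M0 : m 0%N = 1 by rewrite /m m0.
have N' k : k.*2%:R * m k = \sum_(j < k) (-1) ^+ j * W j.+1 * m (k - j.+1)%N.
  by rewrite -N mulr_natl.
apply: (newton_solve W1 W2 W3 W4 W5 W6 (m1 := m 1%N) (m2 := m 2%N) (m3 := m 3%N)
  (m4 := m 4%N) (m5 := m 5%N));
  [ apply: etrans (N' 1%N) _ | apply: etrans (N' 2%N) _ | apply: etrans (N' 3%N) _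
  | apply: etrans (N' 4%N) _ | apply: etrans (N' 5%N) _ | apply: etrans (N' 6%N) _ ];
  rewrite !big_ord_recl big_ord0 /bump /= M0; ring.
Qed.
End Counting.

Local Close Scope ring_scope.

(** * Turns along short cycles *)

(* [T u v w] records the side on which the path [u v w] turns; a closed walk
   bounds a face when all its turns agree. *)
Definition square_face (G : sgraph) (T : G -> G -> G -> bool) s (u v w x : G) :=
  [&& cyc4 u v w x, T u v w == s, T v w x == s, T w x u == s & T x u v == s].

Definition hexagon_face (G : sgraph) (T : G -> G -> G -> bool) s (u v w x y z : G) :=
  [&& cyc6 u v w x y z, T u v w == s, T v w x == s, T w x y == s, T x y z == s,
      T y z u == s & T z u v == s].

(** The rotation system seen through its corners instead of its darts. This puts the two sides of a
    cycle on the same footing: negating [s] exchanges them. *)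
Record turning (G : sgraph) (T : G -> G -> G -> bool) : Prop := Turning {
  turning_cubic : forall v : G, #|[set w | adj v w]| = 3;
  turning_sym : forall u v w : G, adj v u -> adj v w -> u != w -> T w v u = ~~ T u v w;
  turning_cyc : forall v a b c : G, adj v a -> adj v b -> adj v c ->
    a != b -> b != c -> a != c -> T b v c = T a v b;
  turning_face : forall u v w : G, adj u v -> adj v w -> u != w ->
    (exists x, square_face T (T u v w) u v w x) \/
    (exists x y z, hexagon_face T (T u v w) u v w x y z);
  turning_square : exists s u v w x, square_face T s u v w x;
  turning_connected : forall u v : G, connect (@adj G) u v }.

Ltac sides := first [assumption | by rewrite adj_sym | by rewrite eq_sym
  | by apply: adj_neq | by apply: adj_neq; rewrite adj_sym].

Ltac open_ hyp_ := let H' := fresh "K" in have H' := hyp_; clear hyp_;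
  rewrite /square_face /hexagon_face /cyc4 /cyc6 /= ?inE ?negb_or in H'; split_ands;
  repeat match goal with
  | K : is_true (_ == _) |- _ => move/eqP in K
  | K : is_true true |- _ => clear K end.

(** * Faces along a path *)

Section Local.
Variables (G : sgraph) (T : G -> G -> G -> bool).
Hypothesis tT : turning T.
Implicit Types (a b c d e f p q u v w x y z : G) (s t : bool).
Local Notation Sq := (square_face T).
Local Notation Hx := (hexagon_face T).

(** At a vertex of degree 3 one turn determines those of all corners; this and the next four lemmas
    are the cases that [tsolve] tries. *)
Lemma turn_rev p v q s : T q v p = s -> adj v p -> adj v q -> p != q -> T p v q = ~~ s.
Proof. by move=> <- vp vq pq; rewrite (turning_sym tT) // eq_sym. Qed.

Lemma turn_pred x p v q s : T x v p = s -> adj v x -> adj v p -> adj v q ->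
  x != p -> p != q -> x != q -> T p v q = s.
Proof. by move=> <- *; rewrite (@turning_cyc _ _ tT v x p q). Qed.

Lemma turn_succ x p v q s : T q v x = s -> adj v x -> adj v p -> adj v q ->
  x != p -> p != q -> x != q -> T p v q = s.
Proof. by move=> <- *; rewrite -(@turning_cyc _ _ tT v p q x) //; sides. Qed.

Lemma turn_l x p v q s : T p v x = s -> adj v x -> adj v p -> adj v q ->
  x != p -> p != q -> x != q -> T p v q = ~~ s.
Proof.
move=> H *; apply: turn_rev => //.
by apply: (turn_succ H) => //; rewrite eq_sym.
Qed.

Lemma turn_r x p v q s : T x v q = s -> adj v x -> adj v p -> adj v q ->
  x != p -> p != q -> x != q -> T p v q = ~~ s.
Proof.
move=> H *; apply: turn_rev => //.
by apply: (turn_pred H) => //; rewrite eq_sym.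
Qed.

Lemma turn_inj u v w x : adj v u -> adj v w -> adj v x -> u != w -> u != x ->
  T u v w = T u v x -> w = x.
Proof.
move=> vu vw vx uw ux E; apply/eqP; apply: contraTT isT => wx.
have := turn_l (erefl (T u v x)) vx vu vw; rewrite E eq_sym ux uw (eq_sym x) wx.
by move=> /(_ isT isT isT); case: (T u v x).
Qed.

Lemma third v a b : adj v a -> adj v b -> a != b ->
  exists x, [/\ adj v x, x != a & x != b].
Proof.
move=> va vb ab; have := cardsID [set a; b] [set w | adj v w].
rewrite (turning_cubic tT) (_ : _ :&: _ = [set a; b]).
  rewrite cards2 ab => -[] E; have: 0 < #|[set w | adj v w] :\: [set a; b]| by move: E; lia.
  by case/card_gt0P => x; rewrite !inE negb_or => /andP[/andP[? ?] ?]; exists x.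
by apply/setIidPr/subsetP => x; rewrite !inE => /orP[]/eqP->.
Qed.

Lemma nbr3 v a b c x : adj v a -> adj v b -> adj v c -> a != b -> b != c -> a != c ->
  adj v x -> [\/ x = a, x = b | x = c].
Proof.
move=> va vb vc ab bc ac vx.
case: (x =P a) => [->|/eqP xa]; first by constructor 1.
case: (x =P b) => [->|/eqP xb]; first by constructor 2.
case: (x =P c) => [->|/eqP xc]; first by constructor 3.
have := turning_cubic tT v; have : uniq [:: a; b; c; x] by rewrite /= !inE !negb_or ab bc ac !(eq_sym _ x) xa xb xc.
move=> u4 c3; have := uniq_leq_size u4 (s2 := enum [set w | adj v w]).
rewrite -cardE c3 => H; exfalso; suff: 4 <= 3 by [].
by apply: H => y; rewrite mem_enum !inE => /or4P[]/eqP->.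
Qed.

Ltac tfin := rewrite ?negbK; reflexivity.
Ltac tsolve := rewrite ?negbK; match goal with
 | H : T ?p ?v ?q = _ |- T ?p ?v ?q = _ => rewrite H; tfin
 | H : T ?q ?v ?p = _ |- T ?p ?v ?q = _ => rewrite (turn_rev H); [ tfin | sides ..]
 | H : T ?x ?v ?p = _ |- T ?p ?v ?q = _ => rewrite (turn_pred H (q := q)); [ tfin | sides ..]
 | H : T ?q ?v ?x = _ |- T ?p ?v ?q = _ => rewrite (turn_succ H (p := p)); [ tfin | sides ..]
 | H : T ?p ?v ?x = _ |- T ?p ?v ?q = _ => rewrite (turn_l H (q := q)); [ tfin | sides ..]
 | H : T ?x ?v ?q = _ |- T ?p ?v ?q = _ => rewrite (turn_r H (p := p)); [ tfin | sides ..]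
 end.

Lemma bool_clash (x s : bool) : x = s -> x = ~~ s -> False.
Proof. by move=> ->; case: s. Qed.

Ltac tclash p v q s := exfalso; apply: (@bool_clash (T p v q) s); tsolve.

(** Equal consecutive turns follow the face of the first corner. In the longer versions the path may
    have gone around a square, hence the equalities between its vertices. *)
Lemma face_path4 s u v w x : adj u v -> adj v w -> adj w x -> u != w -> v != x ->
  T u v w = s -> T v w x = s -> Sq s u v w x \/ exists y z, Hx s u v w x y z.
Proof.
move=> uv vw wx uw vx t1 t2.
have [[x' S]|[x' [y [z H]]]] := turning_face tT uv vw uw; rewrite t1 in S || rewrite t1 in H.
- left; suff -> : x = x' by [].
  by open_ S; apply: (@turn_inj v w) => //; try sides; rewrite t2.
- right; exists y, z; suff -> : x = x' by [].
  by open_ H; apply: (@turn_inj v w) => //; try sides; rewrite t2.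
Qed.

Lemma face_path5 s u v w x y : adj u v -> adj v w -> adj w x -> adj x y ->
  u != w -> v != x -> w != y -> T u v w = s -> T v w x = s -> T w x y = s ->
  (y = u /\ Sq s u v w x) \/ exists z, Hx s u v w x y z.
Proof.
move=> uv vw wx xy uw vx wy t1 t2 t3.
have [S|[y' [z H]]] := face_path4 uv vw wx uw vx t1 t2.
- left; split=> //; have S' := S; open_ S'; apply: (@turn_inj w x) => //; try sides.
  by rewrite t3.
- right; exists z; suff -> : y = y' by [].
  by open_ H; apply: (@turn_inj w x) => //; try sides; rewrite t3.
Qed.

Lemma face_path6 s u v w x y z : adj u v -> adj v w -> adj w x -> adj x y -> adj y z ->
  u != w -> v != x -> w != y -> x != z ->
  T u v w = s -> T v w x = s -> T w x y = s -> T x y z = s ->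
  [/\ y = u, z = v & Sq s u v w x] \/ Hx s u v w x y z.
Proof.
move=> uv vw wx xy yz uw vx wy xz t1 t2 t3 t4.
have [[yu S]|[z' H]] := face_path5 uv vw wx xy uw vx wy t1 t2 t3.
- left; subst y; split=> //; open_ S; apply: (@turn_inj x u) => //; try sides.
  by rewrite t4.
- right; suff -> : z = z' by [].
  by open_ H; apply: (@turn_inj x y) => //; try sides; rewrite t4.
Qed.

Lemma face_path7 s u v w x y z a : adj u v -> adj v w -> adj w x -> adj x y -> adj y z ->
  adj z a -> u != w -> v != x -> w != y -> x != z -> y != a ->
  T u v w = s -> T v w x = s -> T w x y = s -> T x y z = s -> T y z a = s ->
  [/\ y = u, z = v, a = w & Sq s u v w x] \/ a = u /\ Hx s u v w x y z.
Proof.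
move=> uv vw wx xy yz za uw vx wy xz ya t1 t2 t3 t4 t5.
have [[yu zv S]|H] := face_path6 uv vw wx xy yz uw vx wy xz t1 t2 t3 t4.
- left; subst y z; split=> //; open_ S; apply: (@turn_inj u v) => //; try sides.
  by rewrite t5.
- right; split=> //; have H' := H; open_ H'; apply: (@turn_inj y z) => //; try sides.
  by rewrite t5.
Qed.

Lemma square_hexagon_clash s s' u v w x p q r : Sq s u v w x -> ~ Hx s' u v w p q r.
Proof.
move=> S H; open_ S; open_ H; have ss : s = s' by congruence. subst s'.
have xp : x = p by apply: (@turn_inj v w) => //; try sides; congruence.
subst p; have uq : u = q by apply: (@turn_inj w x) => //; try sides; congruence.
by subst q; match goal with K : is_true (u != u) |- _ => rewrite eqxx in K end.
Qed.

(** Around an odd cycle two consecutive turns agree; the walk around the triangle would then follow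
    a face and return to its start too early. *)
Lemma no_triangle a b c : adj a b -> adj b c -> adj c a = false.
Proof.
have aux x y z : adj x y -> adj y z -> adj z x -> T x y z <> T y z x.
  move=> xy yz zx E.
  have [||S|[p [q H]]] := face_path4 xy yz zx _ _ (erefl _) (esym E); try sides.
    by open_ S; match goal with K : is_true (x != x) |- _ => rewrite eqxx in K end.
  by open_ H; match goal with K : is_true (x != x) |- _ => rewrite eqxx in K end.
move=> ab bc; apply/negP => ca.
have := aux _ _ _ ab bc ca; have := aux _ _ _ bc ca ab; have := aux _ _ _ ca ab bc.
by case: (T a b c); case: (T b c a); case: (T c a b).
Qed.

Ltac dup := exfalso; match goal with K : is_true (?x != ?x) |- _ => by rewrite eqxx in K end.
Ltac fsolve := first [sides | tsolve].
Ltac fp4 F s u v w x := have F : Sq s u v w x \/ exists y z, Hx s u v w x y z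
  by apply: face_path4; fsolve.
Ltac fp5 F s u v w x y := have F : (y = u /\ Sq s u v w x) \/ exists z, Hx s u v w x y z
  by apply: face_path5; fsolve.
Ltac fp6 F s u v w x y z := have F : [/\ y = u, z = v & Sq s u v w x] \/ Hx s u v w x y z
  by apply: face_path6; fsolve.
Ltac fp7 F s u v w x y z a :=
  have F : [/\ y = u, z = v, a = w & Sq s u v w x] \/ a = u /\ Hx s u v w x y z
  by apply: face_path7; fsolve.
Ltac get_third x v a b Hv Ha Hb :=
  have [x [Hv Ha Hb]] : exists x, [/\ adj v x, x != a & x != b] by apply: third; sides.

Lemma cyc4_rot a b c d : cyc4 a b c d -> cyc4 b c d a.
Proof. by move=> C; rewrite /cyc4; open_ C; neqs. Qed.

Lemma three_turns_square s a b c d : cyc4 a b c d ->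
  T a b c = s -> T b c d = s -> T c d a = s -> Sq s a b c d.
Proof.
move=> C t1 t2 t3; have C' := C; open_ C'.
fp5 F s a b c d a; case: F => [[_ //]|[z F]].
by open_ F; dup.
Qed.

(** * Four-cycles bound faces *)

Definition sq_corner p u q := exists s x, Sq s p u q x.

Definition hex_corner p u q := exists s x y z, Hx s p u q x y z.

Lemma hex_corner_rev p u q : hex_corner p u q -> hex_corner q u p.
Proof.
move=> [s [x [y [z S]]]]; exists (~~ s), z, y, x; have S' := S; open_ S'.
rewrite /hexagon_face; repeat (apply/andP; split); try (apply/eqP; tsolve); neqs.
Qed.

Lemma sq_hex_corner p u q : sq_corner p u q -> ~ hex_corner p u q.
Proof. move=> [s [x S]] [s' [y [z [r H]]]]; exact: square_hexagon_clash S H. Qed.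

Lemma hexagon_corners s u v w x y z : Hx s u v w x y z ->
  [/\ hex_corner u v w, hex_corner v w x & hex_corner w x y] /\
  [/\ hex_corner x y z, hex_corner y z u & hex_corner z u v].
Proof.
move=> H; open_ H.
split; split; rewrite /hex_corner;
 [exists s, x, y, z | exists s, y, z, u | exists s, z, u, v | exists s, u, v, w
 | exists s, v, w, x | exists s, w, x, y];
 rewrite /hexagon_face /cyc6; repeat (apply/andP; split); try (by apply/eqP); neqs.
Qed.

Definition hex_vertex (X : G -> Prop) u := exists a b c,
  [/\ adj u a, adj u b, adj u c & [/\ a != b, b != c & a != c]] /\
  [/\ X a, X b, X c & [/\ hex_corner a u b, hex_corner b u c & hex_corner a u c]].

(* A set of vertices closed under adjacency is everything, but some face is a square. *)
Lemma hexagonal_contra (X : G -> Prop) u : X u -> (forall v, X v -> hex_vertex X v) -> False.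
Proof.
move=> Xu XH.
have X1 v w : X v -> adj v w -> X w.
  move=> /XH[a [b [c [[va vb vc [ab bc ac]] [Xa Xb Xc _]]]]] vw.
  by case: (nbr3 va vb vc ab bc ac vw) => ->.
have Xall v : X v.
  have /connectP[p] := turning_connected tT u v.
  elim: p u Xu => [|y p IHp] x Xx /=; first by move=> _ ->.
  by case/andP=> xy py; apply: IHp (X1 _ _ Xx xy) py.
have [s [p [v [q [x S]]]]] := turning_square tT.
have S0 : sq_corner p v q by exists s, x.
have [a [b [c [[va vb vc [ab bc ac]] [_ _ _ [h1 h2 h3]]]]]] := XH _ (Xall v).
have S' := S; open_ S'; have vp : adj v p by sides. have vq : adj v q by sides.
have h1' := hex_corner_rev h1; have h2' := hex_corner_rev h2; have h3' := hex_corner_rev h3.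
have pq : p != q by [].
case: (nbr3 va vb vc ab bc ac vp) => pE; case: (nbr3 va vb vc ab bc ac vq) => qE; subst p q;
  solve [by rewrite eqxx in pq | exact: (sq_hex_corner S0)].
Qed.

(** Three equal turns already make a face, which forces the fourth; hence a 4-cycle that bounds no
    face has exactly two turns to each side. *)
Definition bad4 u := exists a b c, cyc4 u a b c /\
  (T c u a + T u a b + T a b c + T b c u = 2).

(** The edges leaving at [u] and [b] are on one side, where the hexagons [w u a b w2 z] and
    [w u c b w2 z'] follow the cycle. Their outer paths form the next bad cycle [w z w2 z']. *)
Lemma bad4_alternating t u a b c : cyc4 u a b c -> T c u a = t -> T u a b = ~~ t ->
  T a b c = t -> T b c u = ~~ t ->
  exists w, [/\ adj u w, w != a, w != c & [/\ bad4 w, hex_corner a u w, hex_corner w u c & hex_corner u a b]].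
Proof.
move=> C t0 t1 t2 t3; open_ C.
get_third w u a c uw wa wc.
get_third w2 b a c bw w2a w2c.
exists w.
have p1 : T w u a = ~~ t by tsolve.
have p2 : T a b w2 = ~~ t by tsolve.
have q1 : T w u c = t by tsolve.
have q2 : T u c b = t by tsolve.
have q3 : T c b w2 = t by tsolve.
fp5 F1 (~~ t) w u a b w2.
fp5 F2 t w u c b w2.
case: F1 => [[E1 S1]|[z H1]]; case: F2 => [[E2 S2]|[z' H2]].
- by open_ S1; open_ S2; tclash b w u t.
- by open_ H2; subst w2; dup.
- by open_ H1; subst w2; dup.
split=> //; split; last 3 first.
- by apply: hex_corner_rev; case: (hexagon_corners H1) => [[]].
- by case: (hexagon_corners H2) => [[]].
- by case: (hexagon_corners H1) => [[]].
open_ H1; open_ H2.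
have zz : z != z' by apply/eqP => E; subst z'; tclash z w u t.
exists z, w2, z'; split; first by rewrite /cyc4; neqs.
have r0 : T z' w z = ~~ t by tsolve.
have r1 : T w z w2 = t by tsolve.
have r2 : T z w2 z' = ~~ t by tsolve.
have r3 : T w2 z' w = t by tsolve.
by rewrite r0 r1 r2 r3; case: (t).
Qed.

(** The edges leaving at [u] and [a] are on one side. The long face there is a hexagon, so their
    ends [w] and [w1] are adjacent; the short one is a hexagon [w u a w1 y z], whose outer vertices
    form the next bad cycle [w w1 y z]. *)
Lemma bad4_paired t u a b c : cyc4 u a b c -> T c u a = t -> T u a b = t ->
  T a b c = ~~ t -> T b c u = ~~ t ->
  exists w, [/\ adj u w, w != a, w != c & [/\ bad4 w, hex_corner a u w, hex_corner w u c & hex_corner a b c]].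
Proof.
move=> C t0 t1 t2 t3; open_ C.
get_third w u a c uw wa wc.
get_third w1 a u b aw w1u w1b.
exists w.
have p1 : T w u a = ~~ t by tsolve.
have p2 : T u a w1 = ~~ t by tsolve.
have q1 : T w1 a b = ~~ t by tsolve.
have q4 : T c u w = ~~ t by tsolve.
fp6 F2 (~~ t) w1 a b c u w.
case: F2 => [[E _ _]|H2]; first by subst u; rewrite eqxx in w1u.
have w1w : adj w1 w by have H2' := H2; open_ H2'; sides.
have uw1 : u != w1 by rewrite eq_sym.
have ww1 : w != w1 by sides.
fp4 F1 (~~ t) w u a w1.
case: F1 => [S1|[y [z H1]]].
  by open_ S1; open_ H2; tclash u w w1 t.
split=> //; split.
- open_ H1; open_ H2.
  exists w1, y, z; split; first by rewrite /cyc4; neqs.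
  have r0 : T z w w1 = t by tsolve.
  have r1 : T w w1 y = t by tsolve.
  have r2 : T w1 y z = ~~ t by tsolve.
  have r3 : T y z w = ~~ t by tsolve.
  by rewrite r0 r1 r2 r3; case: (t).
- by apply: hex_corner_rev; case: (hexagon_corners H1) => [[]].
- by apply: hex_corner_rev; case: (hexagon_corners H2) => _ [].
- by case: (hexagon_corners H2) => [[]].
Qed.

Lemma bad4_rot u a b c : cyc4 u a b c -> (T c u a + T u a b + T a b c + T b c u = 2) ->
  [/\ bad4 a, bad4 b & bad4 c].
Proof.
move=> C E; split.
- exists b, c, u; split; first exact: cyc4_rot.
  by rewrite -E; lia.
- exists c, u, a; split; first by do 2!apply: cyc4_rot.
  by rewrite -E; lia.
- exists u, a, b; split; first by do 3!apply: cyc4_rot.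
  by rewrite -E; lia.
Qed.

(** At a vertex of a bad cycle, the two corners beside the leaving edge lie in the belt on its side
    and the third corner in the belt on the other side, so all are hexagonal. *)
Lemma not_bad4 u : ~ bad4 u.
Proof.
move=> Bu; apply: (hexagonal_contra Bu) => {u Bu} v [a [b [c [C E]]]].
have [Ba _ Bc] := bad4_rot C E.
have C1 := cyc4_rot C; have C2 := cyc4_rot C1; have C3 := cyc4_rot C2.
have C' := C; open_ C'.
have fin w : [/\ adj v w, w != a, w != c & [/\ bad4 w, hex_corner a v w & hex_corner w v c]] ->
  hex_corner a v c -> hex_vertex bad4 v.
  move=> [? ? ? [? ? ?]] ?; exists a, w, c; split; split=> //; first [sides | split; sides].
have alt t : T c v a = t -> T v a b = ~~ t -> T a b c = t -> T b c v = ~~ t ->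
    hex_vertex bad4 v.
  move=> t0 t1 t2 t3; have [w [? ? ? [? ? ? _]]] := bad4_alternating C t0 t1 t2 t3.
  apply: (fin w); first by split.
  have [||||w' [_ _ _ [_ _ _ h]]] := @bad4_alternating (~~ t) c v a b C3 => //; rewrite ?negbK //.
  exact: hex_corner_rev.
have pr t x y z : cyc4 v x y z -> T z v x = t -> T v x y = t -> T x y z = ~~ t -> T y z v = ~~ t ->
    exists2 w, [/\ adj v w, w != x, w != z & [/\ bad4 w, hex_corner x v w & hex_corner w v z]] & hex_corner x v z.
  move=> D t0 t1 t2 t3; have [w [? ? ? [? ? ? _]]] := bad4_paired D t0 t1 t2 t3.
  exists w => //.
  have [|||||w' [_ _ _ [_ _ _ h]]] := @bad4_paired (~~ t) y z v x => //; rewrite ?negbK //.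
    by do 2!apply: cyc4_rot.
  exact: hex_corner_rev.
move: E; case t0: (T c v a); case t1: (T v a b); case t2: (T a b c); case t3: (T b c v) => // _.
- by have [w W h] := pr true a b c C t0 t1 t2 t3; apply: fin W h.
- exact: (alt true).
- have [|||||w [? ? ? [? ? ?]] h] := pr false c b a; [by rewrite /cyc4; neqs | tsolve ..|].
  apply: (fin w); last exact: hex_corner_rev.
  by split=> //; split=> //; apply: hex_corner_rev.
- have [|||||w [? ? ? [? ? ?]] h] := pr true c b a; [by rewrite /cyc4; neqs | tsolve ..|].
  apply: (fin w); last exact: hex_corner_rev.
  by split=> //; split=> //; apply: hex_corner_rev.
- exact: (alt false).
- by have [w W h] := pr false a b c C t0 t1 t2 t3; apply: fin W h.
Qed.

Lemma cyc4_face a b c d : cyc4 a b c d -> exists s, Sq s a b c d.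
Proof.
move=> C; have C1 := cyc4_rot C; have C2 := cyc4_rot C1; have C3 := cyc4_rot C2.
have nb : ~ (T d a b + T a b c + T b c d + T c d a = 2).
  by move=> E; apply: (@not_bad4 a); exists b, c, d.
case t0: (T d a b); case t1: (T a b c); case t2: (T b c d); case t3: (T c d a);
  try (by case: nb; rewrite t0 t1 t2 t3);
  try (by exists true; apply: three_turns_square); try (by exists false; apply: three_turns_square).
all: exfalso; first [have S := three_turns_square C1 t2 t3 t0
  | have S := three_turns_square C2 t3 t0 t1 | have S := three_turns_square C3 t0 t1 t2];
  by open_ S; congruence.
Qed.

(** A cyclic word of five turns has an even number of runs; so it has three equal consecutive turns,
    or is a rotation of [s s ~s s ~s]. *)
Lemma no_pentagon a b c d e : uniq [:: a; b; c; d; e] ->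
  adj a b -> adj b c -> adj c d -> adj d e -> adj e a = false.
Proof.
(* The face along the run is a hexagon whose sixth vertex forms a triangle with the edge from [v] to
   [p]. *)
have run3 (p q r u v : G) : uniq [:: p; q; r; u; v] -> adj p q -> adj q r -> adj r u ->
    adj u v -> adj v p -> T p q r = T q r u -> T q r u = T r u v -> False.
  move=> U pq qr ru uv vp t1 t2; open_ U.
  have e1 : T q r u = T p q r by []. have e2 : T r u v = T p q r by congruence.
  have F := @face_path5 (T p q r) p q r u v pq qr ru uv ltac:(sides) ltac:(sides) ltac:(sides) (erefl _) e1 e2.
  case: F => [[E _]|[z H]]; first by subst v; dup.
  open_ H; have : adj v z by []. have : adj z p by [].
  by move=> zp vz; move: (no_triangle vz zp); rewrite adj_sym vp.
(* The edges leaving at [r] and [v] are on one side. The longer face between them makes their ends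
   adjacent, and the shorter one then yields a triangle. *)
have pat s (p q r u v : G) : uniq [:: p; q; r; u; v] -> adj p q -> adj q r -> adj r u ->
    adj u v -> adj v p -> T v p q = s -> T p q r = s -> T q r u = ~~ s -> T r u v = s ->
    T u v p = ~~ s -> False.
  move=> U pq qr ru uv vp t0 t1 t2 t3 t4; open_ U.
  get_third w2 r q u rw w2q w2u. get_third w4 v u p vw w4u w4p.
  have g1 : T w4 v p = s by tsolve.
  have g2 : T q r w2 = s by tsolve.
  have g3 : T w2 r u = s by tsolve.
  have g4 : T u v w4 = s by tsolve.
  have rv : adj r v = false by rewrite adj_sym; exact: (no_triangle ru uv).
  fp6 F s w4 v p q r w2; case: F => [[E _ _]|H].
    by subst w4; rewrite adj_sym rv in vw.
  have ww : adj w2 w4 by open_ H.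
  fp5 F s w2 r u v w4; case: F => [[E _]|[z H']].
    by subst w4; rewrite adj_irrefl in ww.
  open_ H'; have a1 : adj w4 z by []. have a2 : adj z w2 by [].
  by move: (no_triangle a1 a2); rewrite ww.
move=> U ab bc cd de; apply/negP => ea.
have rotU (p q r u v : G) : uniq [:: p; q; r; u; v] -> uniq [:: q; r; u; v; p].
  by move=> K; rewrite -(rot_uniq 1) in K.
have U1 := rotU _ _ _ _ _ U; have U2 := rotU _ _ _ _ _ U1.
have U3 := rotU _ _ _ _ _ U2; have U4 := rotU _ _ _ _ _ U3.
have r0 := run3 _ _ _ _ _ U ab bc cd de ea; have r1 := run3 _ _ _ _ _ U1 bc cd de ea ab.
have r2 := run3 _ _ _ _ _ U2 cd de ea ab bc; have r3 := run3 _ _ _ _ _ U3 de ea ab bc cd.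
have r4 := run3 _ _ _ _ _ U4 ea ab bc cd de.
have p0 s := pat s _ _ _ _ _ U ab bc cd de ea; have p1 s := pat s _ _ _ _ _ U1 bc cd de ea ab.
have p2 s := pat s _ _ _ _ _ U2 cd de ea ab bc; have p3 s := pat s _ _ _ _ _ U3 de ea ab bc cd.
have p4 s := pat s _ _ _ _ _ U4 ea ab bc cd de.
case t0: (T e a b); case t1: (T a b c); case t2: (T b c d); case t3: (T c d e); case t4: (T d e a);
 rewrite ?t0 ?t1 ?t2 ?t3 ?t4 in r0 r1 r2 r3 r4 p0 p1 p2 p3 p4;
 first [exact: r0 | exact: r1 | exact: r2 | exact: r3 | exact: r4
  | exact: (p0 true) | exact: (p0 false) | exact: (p1 true) | exact: (p1 false)
  | exact: (p2 true) | exact: (p2 false) | exact: (p3 true) | exact: (p3 false)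
  | exact: (p4 true) | exact: (p4 false)].
Qed.

(** The 4-cycles [a x b y] and [b x c y] would be faces; the rotation at [x] puts them on the same
    side, but they traverse [x b y] in opposite directions. *)
Lemma no_K23 x y a b c : x != y -> uniq [:: a; b; c] ->
  adj x a -> adj x b -> adj x c -> adj y a -> adj y b -> adj y c -> False.
Proof.
move=> xy U xa xb xc ya yb yc; open_ U.
have C (p q : G) : p != q -> adj x p -> adj x q -> adj y p -> adj y q -> cyc4 p x q y.
  by move=> *; rewrite /cyc4; neqs.
have [s1 S1] := cyc4_face (C a b ltac:(sides) xa xb ya yb).
have [s2 S2] := cyc4_face (C b c ltac:(sides) xb xc yb yc).
open_ S1; open_ S2.
have e : T b x c = T a x b by apply: (turning_cyc tT); sides.
have e2 : T y b x = ~~ T x b y by apply: (turning_sym tT); sides.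
by apply: (@bool_clash s2 s1); congruence.
Qed.

(** * Six-cycles by their pattern of turns *)

Lemma cyc6_rot a b c d e f : cyc6 a b c d e f -> cyc6 b c d e f a.
Proof. by move=> C; rewrite /cyc6; open_ C; neqs. Qed.

Lemma four_turns_hexagon s a b c d e f : cyc6 a b c d e f ->
  T a b c = s -> T b c d = s -> T c d e = s -> T d e f = s -> Hx s a b c d e f.
Proof.
move=> C t1 t2 t3 t4; open_ C.
by fp6 F s a b c d e f; case: F => // -[E _ _]; subst e; dup.
Qed.

(** The face along the run contains the edges leaving at [c] and [a], so these share their end [w0];
    the 4-cycle [w0 a b c] then cannot be a face. *)
Lemma no_run3 s a b c d e f : cyc6 a b c d e f -> T b c d = ~~ s -> T c d e = s ->
  T d e f = s -> T e f a = s -> T f a b = ~~ s -> False.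
Proof.
move=> C t2 t3 t4 t5 t0; open_ C.
get_third w0 a f b aw w0f w0b. get_third w2 c b d cw w2b w2d.
have g1 : T w2 c d = s by tsolve.
have g2 : T f a w0 = s by tsolve.
fp7 F s w2 c d e f a w0; case: F => [[E1 E2 _ _]|[E H]]; first by subst a; dup.
subst w2; have D : cyc4 w0 a b c by rewrite /cyc4; open_ H; neqs.
have [s' S] := cyc4_face D; open_ S; open_ H.
have g3 : T w0 a b = s by tsolve.
have ss : s' = s by congruence. subst s'.
by tclash a w0 c s.
Qed.

(** Two faces follow the cycle between the edges leaving at [a] and [d]. If both were hexagons they
    would traverse [d w3 w0] in opposite directions with the same turn, so one is a square and
    closes along a chord. *)
Lemma opposite_chord s a b c d e f : cyc6 a b c d e f -> T f a b = ~~ s -> T a b c = s ->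
  T b c d = s -> T c d e = ~~ s -> T d e f = s -> T e f a = s -> adj a d.
Proof.
move=> C t0 t1 t2 t3 t4 t5; open_ C.
get_third w0 a f b aw w0f w0b. get_third w3 d c e dw w3c w3e.
have g1 : T w0 a b = s by tsolve.
have g2 : T c d w3 = s by tsolve.
have g3 : T w3 d e = s by tsolve.
have g4 : T f a w0 = s by tsolve.
fp6 F s w0 a b c d w3; case: F => [[-> _ _]//|H].
fp6 F s w3 d e f a w0; case: F => [[-> _ _]|H']; first by rewrite adj_sym.
by open_ H; open_ H'; tclash d w3 w0 s.
Qed.

(* The edges leaving the cycle on one side start at vertices [a], [b], [d], with
   gaps 1, 2, 3, so that successive belts would wind like a helical nanotube. *)
Definition chiral_ring s a b c d e f :=
  [&& cyc6 a b c d e f, T f a b == ~~ s, T a b c == ~~ s, T b c d == s, T c d e == ~~ s,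
      T d e f == s, T e f a == s, ~~ adj a d & ~~ adj c f].

Lemma chiral_ring_rev s a b c d e f : chiral_ring s a b c d e f -> chiral_ring s f e d c b a.
Proof.
case/and5P=> C /eqP t0 /eqP t1 /eqP t2 /and5P[/eqP t3 /eqP t4 /eqP t5 n1 n2]; open_ C.
rewrite /chiral_ring (adj_sym f) (adj_sym d); repeat (apply/andP; split) => //;
  try (by apply/eqP; tsolve); neqs.
Qed.

(** A square over the gap 3 would need a chord, and a square over the gap 2 or 1 would leave a
    4-cycle that is no face. The outer boundary of the three hexagons is again a ring with gaps 1,
    2, 3, started at [q]. *)
Lemma chiral_ring_next s v0 v1 v2 v3 v4 v5 : chiral_ring s v0 v1 v2 v3 v4 v5 ->
  exists w0 w1 w3 p q z, [/\ Hx s w3 v3 v4 v5 v0 w0, Hx s w0 v0 v1 w1 p q,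
    Hx s w1 v1 v2 v3 w3 z & chiral_ring s q p w1 z w3 w0].
Proof.
case/and5P=> C /eqP t0 /eqP t1 /eqP t2 /and5P[/eqP t3 /eqP t4 /eqP t5 n1 n2]; open_ C.
get_third w0 v0 v5 v1 aw0 w05 w01. get_third w1 v1 v0 v2 aw1 w10 w12.
get_third w3 v3 v2 v4 aw3 w32 w34.
have g1 : T w3 v3 v4 = s by tsolve.
have g2 : T v5 v0 w0 = s by tsolve.
have g3 : T w0 v0 v1 = s by tsolve.
have g4 : T v0 v1 w1 = s by tsolve.
have g5 : T w1 v1 v2 = s by tsolve.
have g6 : T v2 v3 w3 = s by tsolve.
fp6 F s w3 v3 v4 v5 v0 w0; case: F => [[E _ _]|H3].
  by subst w3; rewrite adj_sym aw3 in n1.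
have a30 : adj w3 w0 by have H3' := H3; open_ H3'; sides.
fp5 F s w1 v1 v2 v3 w3; case: F => [[E S]|[z H2]].
  subst w3; exfalso.
  have D : cyc4 w0 v0 v1 w1 by rewrite /cyc4; open_ S; open_ H3; neqs.
  have [s' Q] := cyc4_face D; open_ Q; open_ H3.
  have ss : s' = s by congruence. subst s'.
  by tclash w1 w0 v0 s.
have H2' := H2; open_ H2'.
fp4 F s w0 v0 v1 w1; case: F => [S|[p [q H1]]].
  exfalso; have S' := S; open_ S'; have H3' := H3; open_ H3'.
  have zw0 : z != w0.
    by apply/eqP => E; subst z; tclash v3 w3 w0 s.
  have D : cyc4 w3 w0 w1 z by rewrite /cyc4; neqs.
  have [s' Q] := cyc4_face D; open_ Q.
  have k1 : T w3 w0 w1 = s by tsolve.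
  have k2 : T w1 z w3 = ~~ s by tsolve.
  by apply: (@bool_clash s' s); congruence.
exists w0, w1, w3, p, q, z; split=> //.
open_ H1; open_ H3.
have qw3 : q != w3 by apply/eqP => E; subst q; tclash v0 w0 w3 s.
have zw0 : z != w0.
  apply/eqP => E; subst z.
  have := nbr3 (v := w0) (a := v0) (b := w3) (c := q) (x := w1).
  case; try sides; move=> E; subst; dup.
have pw3 : p != w3.
  apply/eqP => E; subst p.
  have a1 : adj w1 w3 by sides. have a2 : adj w3 z by sides. have a3 : adj z w1 by sides.
  by have := no_triangle a1 a2; rewrite a3.
have pz : p != z by apply/eqP => E; subst p; tclash v1 w1 z s.
have zq : z != q.
  apply/eqP => E; subst z.
  have a1 : adj w0 w3 by sides. have a2 : adj w3 q by sides. have a3 : adj q w0 by sides.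
  by have := no_triangle a1 a2; rewrite a3.
have k0 : T w3 w0 q = s by tsolve.
have k1 : T w0 q p = ~~ s by tsolve.
have k2 : T q p w1 = ~~ s by tsolve.
have k3 : T p w1 z = s by tsolve.
have k4 : T w1 z w3 = ~~ s by tsolve.
have k5 : T z w3 w0 = s by tsolve.
have nqz : ~~ adj q z.
  apply/negP => qz.
  have D : cyc4 q p w1 z by rewrite /cyc4; neqs.
  have [s' Q] := cyc4_face D; open_ Q.
  by apply: (@bool_clash s' s); congruence.
have nw : ~~ adj w1 w0.
  apply/negP => ww; have := nbr3 (v := w0) (a := v0) (b := w3) (c := q) (x := w1).
  case; try sides; move=> E; subst; dup.
rewrite /chiral_ring nqz nw; repeat (apply/andP; split) => //; try (by apply/eqP); neqs.
Qed.

Ltac corners H := let p := fresh "p" in have p := hexagon_corners H;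
  case: p => [[? ? ?] [? ? ?]].

Ltac in6 R := by eexists _, _, _, _, _, _, _; split; [exact: R | rewrite !inE eqxx ?orbT].

Ltac corner := first [assumption | apply: hex_corner_rev; assumption].

Lemma no_chiral_ring s v0 v1 v2 v3 v4 v5 : ~ chiral_ring s v0 v1 v2 v3 v4 v5.
Proof.
pose X u := exists s v0 v1 v2 v3 v4 v5,
  chiral_ring s v0 v1 v2 v3 v4 v5 /\ u \in [:: v0; v1; v2; v3; v4; v5].
move=> R; have Xv : X v0 by in6 R.
apply: (hexagonal_contra Xv) => {R Xv s v0 v1 v2 v3 v4 v5} u [s [v0 [v1 [v2 [v3 [v4 [v5 [R]]]]]]]].
have R' := chiral_ring_rev R.
have [w0 [w1 [w3 [p [q [z [H3 H1 H2 N]]]]]]] := chiral_ring_next R.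
have [y0 [y1 [y3 [p' [q' [z' [R3 R1 R2 N']]]]]]] := chiral_ring_next R'.
corners H1; corners H2; corners H3; corners R1; corners R2; corners R3.
have [Xw0 Xw1 Xw3] : [/\ X w0, X w1 & X w3] by split; in6 N.
have [Xy0 Xy1 Xy3] : [/\ X y0, X y1 & X y3] by split; in6 N'.
have [X0 X1 X2] : [/\ X v0, X v1 & X v2] by split; in6 R.
have [X3 X4 X5] : [/\ X v3, X v4 & X v5] by split; in6 R.
move=> {N N' R R'}; open_ H1; open_ H2; open_ H3; open_ R1; open_ R2; open_ R3.
rewrite !inE => /orP[|/orP[|/orP[|/or3P[]]]] /eqP->;
  [exists v5, v1, w0 | exists v0, v2, w1 | exists v1, v3, y3 | exists v2, v4, w3
  | exists v3, v5, y1 | exists v4, v0, y0];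
  (split; (split; [first [sides | assumption] .. | split; first [sides | corner]])).
Qed.

(** On each side the leaving edges start at every other vertex, as on the rings of a tube. *)
Definition achiral_ring s a b c d e f :=
  [&& cyc6 a b c d e f, T f a b == ~~ s, T a b c == s, T b c d == ~~ s, T c d e == s,
      T d e f == ~~ s & T e f a == s].

Lemma achiral_ring_rev s a b c d e f : achiral_ring s a b c d e f -> achiral_ring s f e d c b a.
Proof.
case/and5P=> C /eqP t0 /eqP t1 /eqP t2 /and3P[/eqP t3 /eqP t4 /eqP t5]; open_ C.
rewrite /achiral_ring; repeat (apply/andP; split) => //; try (by apply/eqP; tsolve); neqs.
Qed.

Lemma achiral_ring_next s v0 v1 v2 v3 v4 v5 : achiral_ring s v0 v1 v2 v3 v4 v5 ->
  (exists w, [/\ Sq s w v0 v1 v2, Sq s w v2 v3 v4 & Sq s w v4 v5 v0]) \/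
  exists w0 x1 w2 x3 w4 x5, [/\ Hx s w0 v0 v1 v2 w2 x1, Hx s w2 v2 v3 v4 w4 x3,
    Hx s w4 v4 v5 v0 w0 x5 & achiral_ring s x1 w2 x3 w4 x5 w0].
Proof.
case/and5P=> C /eqP t0 /eqP t1 /eqP t2 /and3P[/eqP t3 /eqP t4 /eqP t5]; open_ C.
get_third w0 v0 v5 v1 aw0 w05 w01. get_third w2 v2 v1 v3 aw2 w21 w23.
get_third w4 v4 v3 v5 aw4 w43 w45.
have g1 : T w0 v0 v1 = s by tsolve.
have g2 : T v1 v2 w2 = s by tsolve.
have g3 : T w2 v2 v3 = s by tsolve.
have g4 : T v3 v4 w4 = s by tsolve.
have g5 : T w4 v4 v5 = s by tsolve.
have g6 : T v5 v0 w0 = s by tsolve.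
(* One square merges two leaving edges into [w]. The two other faces would be hexagons through the
   third edge at [w], which then turn alike along [e z x] and along [x z e]. *)
have mixed a b c d e f w x y z : Sq s w a b c -> Hx s w c d e z x -> Hx s z e f a w y -> False.
  move=> S H H'; open_ S; open_ H; open_ H'.
  have xa : x != a by apply/eqP => E; subst x; tclash a w c s.
  have k : T a w x = s by tsolve.
  have E : x = y by apply: (@turn_inj a w) => //; first [sides | congruence].
  by subst y; tclash x z e s.
fp5 F0 s w0 v0 v1 v2 w2; fp5 F2 s w2 v2 v3 v4 w4; fp5 F4 s w4 v4 v5 v0 w0.
case: F0 => [[E0 S0]|[x1 H0]]; case: F2 => [[E2 S2]|[x3 H2]]; case: F4 => [[E4 S4]|[x5 H4]].
- by left; exists w0; subst w2 w4.
- by subst w2 w4; open_ H4; dup.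
- by subst w2; subst w0; open_ H2; dup.
- by exfalso; subst w2; exact: mixed S0 H2 H4.
- by subst w4; subst w2; open_ H0; dup.
- by exfalso; subst w4; exact: mixed S2 H4 H0.
- by exfalso; subst w0; exact: mixed S4 H0 H2.
right; exists w0, x1, w2, x3, w4, x5; split=> //; open_ H0; open_ H2; open_ H4.
have x13 : x1 != x3 by apply/eqP => E; subst x3; tclash v2 w2 x1 s.
have x35 : x3 != x5 by apply/eqP => E; subst x5; tclash v4 w4 x3 s.
have x51 : x5 != x1 by apply/eqP => E; subst x5; tclash v0 w0 x1 s.
have tri a b c : adj a b -> adj b c -> adj a c -> False.
  by move=> ab bc ac; have := no_triangle ab bc; rewrite adj_sym ac.
have x1w4 : x1 != w4 by apply/eqP => E; subst x1; apply: (tri w4 w0 x5); sides.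
have x3w0 : x3 != w0 by apply/eqP => E; subst x3; apply: (tri w0 w2 x1); sides.
have x5w2 : x5 != w2 by apply/eqP => E; subst x5; apply: (tri w0 w2 x1); sides.
have k0 : T x5 w0 x1 = s by tsolve.
have k1 : T w0 x1 w2 = ~~ s by tsolve.
have k2 : T x1 w2 x3 = s by tsolve.
have k3 : T w2 x3 w4 = ~~ s by tsolve.
have k4 : T x3 w4 x5 = s by tsolve.
have k5 : T w4 x5 w0 = ~~ s by tsolve.
rewrite /achiral_ring; repeat (apply/andP; split) => //; try (by apply/eqP); neqs.
Qed.

Definition capped := exists s w v0 v1 v2 v3 v4 v5, achiral_ring s v0 v1 v2 v3 v4 v5 /\
  [/\ Sq s w v0 v1 v2, Sq s w v2 v3 v4 & Sq s w v4 v5 v0].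

Lemma achiral_ring_capped s v0 v1 v2 v3 v4 v5 : achiral_ring s v0 v1 v2 v3 v4 v5 ->
  ~ capped -> False.
Proof.
pose X u := exists s v0 v1 v2 v3 v4 v5,
  achiral_ring s v0 v1 v2 v3 v4 v5 /\ u \in [:: v0; v1; v2; v3; v4; v5].
move=> R ncap; have Xv : X v0 by in6 R.
apply: (hexagonal_contra Xv) => {R Xv s v0 v1 v2 v3 v4 v5} u [s [v0 [v1 [v2 [v3 [v4 [v5 [R]]]]]]]].
have R' := achiral_ring_rev R.
have [[w S]|] := achiral_ring_next R; first by case: ncap; exists s, w, v0, v1, v2, v3, v4, v5.
move=> [w0 [x1 [w2 [x3 [w4 [x5 [H0 H2 H4 N]]]]]]].
have [[w S]|] := achiral_ring_next R'; first by case: ncap; exists s, w, v5, v4, v3, v2, v1, v0.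
move=> [y0 [z1 [y2 [z3 [y4 [z5 [R0 R2 R4 N']]]]]]].
corners H0; corners H2; corners H4; corners R0; corners R2; corners R4.
have [Xw0 Xw2 Xw4] : [/\ X w0, X w2 & X w4] by split; in6 N.
have [Xy0 Xy2 Xy4] : [/\ X y0, X y2 & X y4] by split; in6 N'.
have [X0 X1 X2] : [/\ X v0, X v1 & X v2] by split; in6 R.
have [X3 X4 X5] : [/\ X v3, X v4 & X v5] by split; in6 R.
move=> {N N' R R'}; open_ H0; open_ H2; open_ H4; open_ R0; open_ R2; open_ R4.
rewrite !inE => /orP[|/orP[|/orP[|/or3P[]]]] /eqP->;
  [exists v5, v1, w0 | exists v0, v2, y4 | exists v1, v3, w2 | exists v2, v4, y2
  | exists v3, v5, w4 | exists v4, v0, y0];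
  (split; (split; [first [sides | assumption] .. | split; first [sides | corner]])).
Qed.

(** A chord would give a square face with the same corners at [b] and [c], so both faces would
    continue alike after [d]. *)
Lemma hexagon_no_chord s a b c d e f : Hx s a b c d e f -> adj a d = false.
Proof.
move=> H; apply/negP => ad; open_ H.
have D : cyc4 a b c d by rewrite /cyc4; neqs.
have [s' Q] := cyc4_face D; open_ Q.
have E : a = e by apply: (@turn_inj c d); first [sides | congruence].
by subst e; dup.
Qed.

(** The runs of a cyclic word of six turns have lengths 6, 5+1 or 4+2 (a hexagon, or a
    contradiction), 3+3 or 3+1+1+1 ([no_run3]), 2+1+2+1 (a chord), 2+2+1+1 (a chiral ring), or all 1
    (an achiral ring). *)
Lemma cyc6_face a b c d e f : ~ capped -> cyc6 a b c d e f ->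
  ~~ adj a d -> ~~ adj b e -> ~~ adj c f -> exists s, Hx s a b c d e f.
Proof.
move=> ncap C0 n0 n1 n2.
have C1 := cyc6_rot C0; have C2 := cyc6_rot C1; have C3 := cyc6_rot C2.
have C4 := cyc6_rot C3; have C5 := cyc6_rot C4.
have n0' : ~~ adj d a by rewrite adj_sym.
have n1' : ~~ adj e b by rewrite adj_sym.
have n2' : ~~ adj f c by rewrite adj_sym.
have chir s p q r u v w : cyc6 p q r u v w -> ~~ adj p u -> ~~ adj r w ->
    T w p q = ~~ s -> T p q r = ~~ s -> T q r u = s -> T r u v = ~~ s -> T u v w = s ->
    T v w p = s -> False.
  move=> C h h' t0 t1 t2 t3 t4 t5; apply: (@no_chiral_ring s p q r u v w).
  by rewrite /chiral_ring C h h' t0 t1 t2 t3 t4 t5 !eqxx.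
have achir s p q r u v w : cyc6 p q r u v w ->
    T w p q = ~~ s -> T p q r = s -> T q r u = ~~ s -> T r u v = s -> T u v w = ~~ s ->
    T v w p = s -> False.
  move=> C t0 t1 t2 t3 t4 t5; apply: (@achiral_ring_capped s p q r u v w) => //.
  by rewrite /achiral_ring C t0 t1 t2 t3 t4 t5 !eqxx.
have chord s p q r u v w : cyc6 p q r u v w -> ~~ adj p u ->
    T w p q = ~~ s -> T p q r = s -> T q r u = s -> T r u v = ~~ s -> T u v w = s ->
    T v w p = s -> False.
  by move=> C nc *; case/negP: nc; apply: (opposite_chord (s := s) C).
have run4 s p q r u v w : cyc6 p q r u v w -> T p q r = s -> T q r u = s -> T r u v = s ->
    T u v w = s -> T v w p = ~~ s -> False.
  move=> C t1 t2 t3 t4 t5; have H := four_turns_hexagon C t1 t2 t3 t4; open_ H.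
  by apply: (@bool_clash (T v w p) s).
case t0: (T f a b); case t1: (T a b c); case t2: (T b c d); case t3: (T c d e);
  case t4: (T d e f); case t5: (T e f a);
  solve [ by exists true; apply: four_turns_hexagon
  | by exists false; apply: four_turns_hexagon
  | exfalso;
    let go C nc nc' :=
      solve [ apply: (run4 true) C _ _ _ _ _; assumption
            | apply: (run4 false) C _ _ _ _ _; assumption
            | apply: (@no_run3 true) C _ _ _ _ _; assumption
            | apply: (@no_run3 false) C _ _ _ _ _; assumption
            | apply: (chord true) C nc _ _ _ _ _ _; assumption
            | apply: (chord false) C nc _ _ _ _ _ _; assumption
            | apply: (chir true) C nc nc' _ _ _ _ _ _; assumption
            | apply: (chir false) C nc nc' _ _ _ _ _ _; assumption
            | apply: (achir true) C _ _ _ _ _ _; assumption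
            | apply: (achir false) C _ _ _ _ _ _; assumption ] in
    first [ go C0 n0 n2 | go C1 n1 n0' | go C2 n2 n1' | go C3 n0' n2' | go C4 n1' n0 | go C5 n2' n1 ] ].
Qed.

End Local.

(** * Layers around a cap *)

Definition o60 : 'I_6 := @Ordinal 6 0 isT.
Definition o61 : 'I_6 := @Ordinal 6 1 isT.
Definition o62 : 'I_6 := @Ordinal 6 2 isT.
Definition o63 : 'I_6 := @Ordinal 6 3 isT.
Definition o64 : 'I_6 := @Ordinal 6 4 isT.
Definition o65 : 'I_6 := @Ordinal 6 5 isT.

Lemma ord6P (P : 'I_6 -> Prop) :
  P o60 -> P o61 -> P o62 -> P o63 -> P o64 -> P o65 -> forall k, P k.
Proof.
move=> p0 p1 p2 p3 p4 p5 [[|[|[|[|[|[|k]]]]]] hk] //.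
- by rewrite (_ : Ordinal hk = o60) //; apply: val_inj.
- by rewrite (_ : Ordinal hk = o61) //; apply: val_inj.
- by rewrite (_ : Ordinal hk = o62) //; apply: val_inj.
- by rewrite (_ : Ordinal hk = o63) //; apply: val_inj.
- by rewrite (_ : Ordinal hk = o64) //; apply: val_inj.
- by rewrite (_ : Ordinal hk = o65) //; apply: val_inj.
Qed.

Lemma ord6S : ((o60 + 1 = o61)%R * (o61 + 1 = o62)%R * (o62 + 1 = o63)%R
  * (o63 + 1 = o64)%R * (o64 + 1 = o65)%R * (o65 + 1 = o60)%R)%type.
Proof. by do !split; apply: val_inj. Qed.

Lemma ord6N : ((o60 - 1 = o65)%R * (o61 - 1 = o60)%R * (o62 - 1 = o61)%R
  * (o63 - 1 = o62)%R * (o64 - 1 = o63)%R * (o65 - 1 = o64)%R)%type.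
Proof. by do !split; apply: val_inj. Qed.

Definition row6 (A : Type) (v0 v1 v2 v3 v4 v5 : A) (k : 'I_6) : A :=
  nth v0 [:: v0; v1; v2; v3; v4; v5] k.

Lemma row6_inj (A : eqType) (v0 v1 v2 v3 v4 v5 : A) :
  uniq [:: v0; v1; v2; v3; v4; v5] -> injective (row6 v0 v1 v2 v3 v4 v5).
Proof. by move=> U k l /eqP; rewrite /row6 nth_uniq ?ltn_ord // => /eqP/val_inj. Qed.

Ltac nq E := exfalso; match type of E with ?x = ?y => match goal with
  | K : is_true (x != y) |- _ => by rewrite E eqxx in K
  | K : is_true (y != x) |- _ => by rewrite E eqxx in K end end.

Section Layers.
Variables (G : sgraph) (T : G -> G -> G -> bool).
Hypothesis tT : turning T.
Implicit Types (a x y : G) (t i : nat) (j k : 'I_6) (d : nat -> 'I_6 -> G).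
Local Notation Sq := (square_face T).
Local Notation Hx := (hexagon_face T).

Definition layer_vertex t a d x := x = a \/ exists i k, i <= t /\ x = d i k.

(* [d i k] stands for the vertex [c_{i, k + i}] of the tube, so that on every
   ring it is the positions [k] of even parity that are joined to the next ring. *)
Record layered t a d : Prop := Layered {
  layered_cap : forall k, odd k -> adj a (d 0 k);
  layered_ring : forall i k, i <= t -> adj (d i k) (d i (k + 1)%R);
  layered_link : forall i k, i < t -> ~~ odd k -> adj (d i k) (d i.+1 (k - 1)%R);
  layered_inj : forall i i' k k', i <= t -> i' <= t -> d i k = d i' k' -> i = i' /\ k = k';
  layered_a : forall i k, i <= t -> a <> d i k;
  layered_turn : exists s, achiral_ring T s (d t o60) (d t o61) (d t o62) (d t o63) (d t o64) (d t o65);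
  layered_inner : forall x y, layer_vertex t a d x -> adj x y ->
    layer_vertex t a d y \/ exists2 k : 'I_6, ~~ odd k & x = d t k;
  layered_outer : forall k y, ~~ odd k -> adj (d t k) y -> layer_vertex t a d y ->
    y = d t (k + 1)%R \/ y = d t (k - 1)%R }.

Lemma layered_step t a d : layered t a d ->
  (exists b, ~ layer_vertex t a d b /\ forall k, ~~ odd k -> adj b (d t k)) \/
  exists d', layered t.+1 a d'.
Proof.
case=> Lcap Lring Llink Linj La [s R] Lin Lout.
have [v0 e0] : exists v, v = d t o60 by eexists.
have [v1 e1] : exists v, v = d t o61 by eexists.
have [v2 e2] : exists v, v = d t o62 by eexists.
have [v3 e3] : exists v, v = d t o63 by eexists.
have [v4 e4] : exists v, v = d t o64 by eexists.
have [v5 e5] : exists v, v = d t o65 by eexists.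
rewrite -e0 -e1 -e2 -e3 -e4 -e5 in R.
have tri x y z : adj x y -> adj y z -> adj x z -> False.
  by move=> xy yz xz; have := no_triangle tT xy yz; rewrite adj_sym xz.
have O0 : layer_vertex t a d v0 by right; exists t, o60.
have O1 : layer_vertex t a d v1 by right; exists t, o61.
have O2 : layer_vertex t a d v2 by right; exists t, o62.
have O3 : layer_vertex t a d v3 by right; exists t, o63.
have O4 : layer_vertex t a d v4 by right; exists t, o64.
have O5 : layer_vertex t a d v5 by right; exists t, o65.
have K0 y : adj v0 y -> layer_vertex t a d y -> y = v1 \/ y = v5.
  by rewrite e0 => h1 h2; have := Lout o60 y isT h1 h2; rewrite ord6S ord6N -e1 -e5.
have K2 y : adj v2 y -> layer_vertex t a d y -> y = v3 \/ y = v1.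
  by rewrite e2 => h1 h2; have := Lout o62 y isT h1 h2; rewrite ord6S ord6N -e1 -e3.
have K4 y : adj v4 y -> layer_vertex t a d y -> y = v5 \/ y = v3.
  by rewrite e4 => h1 h2; have := Lout o64 y isT h1 h2; rewrite ord6S ord6N -e3 -e5.
have Kin x y : layer_vertex t a d x -> adj x y ->
    [\/ layer_vertex t a d y, x = v0, x = v2 | x = v4].
  move=> Ox xy; case: (Lin x y Ox xy) => [?|[k]]; first by constructor.
  by elim/ord6P: k => // _ ->; [constructor 2 | constructor 3 | constructor 4].
case: (achiral_ring_next tT R) => [[w [S0 S2 S4]]|].
  left; exists w; open_ S0; open_ S2; open_ S4; split.
    by move=> Ow; have [E|E] := K0 w ltac:(sides) Ow; nq E.
  by elim/ord6P => // _; rewrite -?e0 -?e2 -?e4; sides.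
move=> [w0 [x1 [w2 [x3 [w4 [x5 [H0 H2 H4 N]]]]]]]; right.
have N' := N; case/andP: N' => N' _; open_ H0; open_ H2; open_ H4; open_ N'.
have nw0 : ~ layer_vertex t a d w0.
  by move=> Ow; have [E|E] := K0 w0 ltac:(sides) Ow; nq E.
have nw2 : ~ layer_vertex t a d w2.
  by move=> Ow; have [E|E] := K2 w2 ltac:(sides) Ow; nq E.
have nw4 : ~ layer_vertex t a d w4.
  by move=> Ow; have [E|E] := K4 w4 ltac:(sides) Ow; nq E.
have [M0 M2 M4] : [/\ forall y, adj v0 y -> [\/ y = v1, y = v5 | y = w0],
  forall y, adj v2 y -> [\/ y = v3, y = v1 | y = w2] &
  forall y, adj v4 y -> [\/ y = v5, y = v3 | y = w4]].
  by case/andP: R => R _; open_ R; split=> y h; apply: (nbr3 tT (v := _)) h; sides.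
(* An inner vertex with a neighbour outside is [v0], [v2] or [v4]. The first two are other vertices
   of the hexagon of [x1], and the outside neighbour of [v4] is [w4], not [w0]. *)
have nx1 : ~ layer_vertex t a d x1.
  move=> Ox; have [//|E|E|E] := Kin x1 w0 Ox ltac:(sides); [nq E | nq E | ].
  have : adj v4 w0 by rewrite -E; sides.
  by case/M4 => E'; [apply: nw0; rewrite E'.. | nq E'].
have nx3 : ~ layer_vertex t a d x3.
  move=> Ox; have [//|E|E|E] := Kin x3 w2 Ox ltac:(sides); [ | nq E | nq E].
  have : adj v0 w2 by rewrite -E; sides.
  by case/M0 => E'; [apply: nw2; rewrite E'.. | nq E'].
have nx5 : ~ layer_vertex t a d x5.
  move=> Ox; have [//|E|E|E] := Kin x5 w4 Ox ltac:(sides); [nq E | | nq E].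
  have : adj v2 w4 by rewrite -E; sides.
  by case/M2 => E'; [apply: nw4; rewrite E'.. | nq E'].
(* Listing the ring from [x1] puts [w2], [w4], [w0] at positions 1, 3, 5, one below the positions 2,
   4, 0 (mod 6) that they are linked to. *)
pose r := row6 x1 w2 x3 w4 x5 w0.
pose d' i := if i <= t then d i else r.
have d'E i : i <= t -> d' i = d i by rewrite /d' => ->.
have d't : d' t.+1 = r by rewrite /d' ltnn.
have O'l x : layer_vertex t a d x -> layer_vertex t.+1 a d' x.
  by case=> [->|[i [k [it ->]]]]; [left | right; exists i, k; rewrite d'E // ltnW].
have O'r k : layer_vertex t.+1 a d' (r k) by right; exists t.+1, k; rewrite d't.
have O'P x : layer_vertex t.+1 a d' x -> layer_vertex t a d x \/ exists k, x = r k.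
  case=> [->|[i [k [it ->]]]]; first by left; left.
  move: it; rewrite leq_eqVlt ltnS => /orP[/eqP->|it]; first by right; exists k; rewrite d't.
  by left; right; exists i, k; rewrite d'E.
have nr k : ~ layer_vertex t a d (r k) by elim/ord6P: k.
have rU : uniq [:: x1; w2; x3; w4; x5; w0] by neqs.
have rI := row6_inj rU.
exists d'; split.
- by move=> k ok; rewrite d'E //; apply: Lcap.
- move=> i k; rewrite leq_eqVlt ltnS => /orP[/eqP->|it]; last by rewrite d'E //; apply: Lring.
  by rewrite d't; elim/ord6P: k; rewrite ord6S /r /row6 /=; sides.
- move=> i k; rewrite ltnS leq_eqVlt => /orP[/eqP->|it] ek; last first.
    by rewrite !d'E // 1?ltnW //; apply: Llink.
  by rewrite d't d'E //; move: ek; elim/ord6P: k => // _; rewrite ord6N -?e0 -?e2 -?e4 /r /row6 /=; sides.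
- move=> i i' k k'; rewrite leq_eqVlt ltnS => /orP[/eqP->|it];
    rewrite leq_eqVlt ltnS => /orP[/eqP->|it'].
  + by rewrite d't => /rI.
  + rewrite d't d'E // => E; case: (nr k); rewrite -/(r k) E; right; by exists i', k'.
  + rewrite d't d'E // => E; case: (nr k'); rewrite -/(r k') -E; right; by exists i, k.
  + by rewrite !d'E //; apply: Linj.
- move=> i k; rewrite leq_eqVlt ltnS => /orP[/eqP->|it]; last by rewrite d'E //; apply: La.
  by rewrite d't => E; case: (nr k); left.
- by exists s; rewrite d't.
- move=> x y /O'P[Ox|[k ->]] xy.
    left; case: (Kin x y Ox xy) => [|E|E|E]; first exact: O'l.
    + move: xy; rewrite E => /M0[]->; [exact: O'l..|exact: (O'r o65)].
    + move: xy; rewrite E => /M2[]->; [exact: O'l..|exact: (O'r o61)].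
    + move: xy; rewrite E => /M4[]->; [exact: O'l..|exact: (O'r o63)].
  move: xy; rewrite -d't; elim/ord6P: k; rewrite d't /=; try (by right; eexists; last reflexivity);
    rewrite {1}/r /row6 /= => xy; left.
  + have [] := nbr3 tT (v := w2) (a := v2) (b := x1) (c := x3) (x := y); try sides; move=> ->.
    * exact: O'l. * exact: (O'r o60). * exact: (O'r o62).
  + have [] := nbr3 tT (v := w4) (a := v4) (b := x3) (c := x5) (x := y); try sides; move=> ->.
    * exact: O'l. * exact: (O'r o62). * exact: (O'r o64).
  + have [] := nbr3 tT (v := w0) (a := v0) (b := x5) (c := x1) (x := y); try sides; move=> ->.
    * exact: O'l. * exact: (O'r o64). * exact: (O'r o60).
- have fromold k y : ~~ odd k -> adj (r k) y -> ~ layer_vertex t a d y.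
    move=> ek ky Oy; have yk : adj y (r k) by rewrite adj_sym.
    case: (Kin _ _ Oy yk) => [|E|E|E]; first exact: nr.
    + move: yk; rewrite E => /M0[]E'; [by case: (nr k); rewrite E'.. |].
      by have /rI E'' : r k = r o65 by []; rewrite E'' in ek.
    + move: yk; rewrite E => /M2[]E'; [by case: (nr k); rewrite E'.. |].
      by have /rI E'' : r k = r o61 by []; rewrite E'' in ek.
    + move: yk; rewrite E => /M4[]E'; [by case: (nr k); rewrite E'.. |].
      by have /rI E'' : r k = r o63 by []; rewrite E'' in ek.
  have W0 y : adj w0 y -> [\/ y = v0, y = x1 | y = x5].
    by move=> h; apply: (nbr3 tT (v := w0)) h; sides.
  have W2 y : adj w2 y -> [\/ y = v2, y = x1 | y = x3].
    by move=> h; apply: (nbr3 tT (v := w2)) h; sides.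
  have W4 y : adj w4 y -> [\/ y = v4, y = x3 | y = x5].
    by move=> h; apply: (nbr3 tT (v := w4)) h; sides.
  move=> k y ek; rewrite d't => ky /O'P[Oy|[k' yE]]; first by case: (fromold k y).
  move: ek ky; rewrite {}yE; elim/ord6P: k => //= _; elim/ord6P: k'; rewrite ?ord6S ?ord6N /r /row6 /= => h;
    try (by left); try (by right); exfalso;
    try (by rewrite adj_irrefl in h).
  + by apply: (tri x1 w2 x3); sides.
  + by move: h; rewrite adj_sym => /W4[E|E|E]; [apply: nx1; rewrite E | nq E | nq E].
  + by apply: (tri x1 w0 x5); sides.
  + by apply: (tri x3 w2 x1); sides.
  + by apply: (tri x3 w4 x5); sides.
  + by move: h; rewrite adj_sym => /W0[E|E|E]; [apply: nx3; rewrite E | nq E | nq E].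
  + by apply: (tri x5 w0 x1); sides.
  + by move: h; rewrite adj_sym => /W2[E|E|E]; [apply: nx5; rewrite E | nq E | nq E].
  + by apply: (tri x5 w4 x3); sides.
Qed.

Lemma layered_init : capped T -> exists a d, layered 0 a d.
Proof.
move=> [s [a [v0 [v1 [v2 [v3 [v4 [v5 [R [S0 S2 S4]]]]]]]]]].
have R' := achiral_ring_rev tT R; case/andP: R => R _; open_ S0; open_ S2; open_ S4; open_ R.
have tri x y z : adj x y -> adj y z -> adj x z -> False.
  by move=> xy yz xz; have := no_triangle tT xy yz; rewrite adj_sym xz.
(* The ring is reversed so that it grows away from the cap: [a] is joined to the odd positions, and
   the even ones still have a free edge. *)
pose r := row6 v5 v4 v3 v2 v1 v0.
have rI : injective r by apply: row6_inj; neqs.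
have OP x : layer_vertex 0 a (fun=> r) x -> x = a \/ exists k, x = r k.
  by case=> [|[i [k [_ ->]]]]; [left | right; exists k].
have Or k : layer_vertex 0 a (fun=> r) (r k) by right; exists 0, k.
have ar k : a <> r k by move=> E; elim/ord6P: k E; rewrite /r /row6 /= => E; nq E.
have Na y : adj a y -> [\/ y = v0, y = v2 | y = v4] by move=> h; apply: (nbr3 tT (v := a)) h; sides.
have N0 y : adj v0 y -> [\/ y = v1, y = v5 | y = a] by move=> h; apply: (nbr3 tT (v := v0)) h; sides.
have N2 y : adj v2 y -> [\/ y = v1, y = v3 | y = a] by move=> h; apply: (nbr3 tT (v := v2)) h; sides.
have N4 y : adj v4 y -> [\/ y = v3, y = v5 | y = a] by move=> h; apply: (nbr3 tT (v := v4)) h; sides.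
exists a, (fun=> r); split=> //.
- by elim/ord6P => // _; rewrite /r /row6 /=; sides.
- by move=> i k _; elim/ord6P: k; rewrite ord6S /r /row6 /=; sides.
- by move=> i i' k k'; rewrite !leqn0 => /eqP-> /eqP-> /rI.
- by exists s.
- move=> x y /OP[->|[k ->]] xy.
    by left; case/Na: xy => ->; [exact: (Or o65) | exact: (Or o63) | exact: (Or o61)].
  elim/ord6P: k xy => xy; try (by right; eexists; last reflexivity); left; move: xy; rewrite /r /row6 /=.
  + by case/N4 => ->; [exact: (Or o62) | exact: (Or o60) | left].
  + by case/N2 => ->; [exact: (Or o64) | exact: (Or o62) | left].
  + by case/N0 => ->; [exact: (Or o64) | exact: (Or o60) | left].
- move=> k y ek h /OP[yE|[k' yE]].
    exfalso; have {}h : adj a (r k) by rewrite adj_sym -yE.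
    by case/Na: h => E; [have /rI E' : r k = r o65 by [] | have /rI E' : r k = r o63 by []
      | have /rI E' : r k = r o61 by []]; rewrite E' in ek.
  move: ek h; rewrite {}yE; elim/ord6P: k => //= _; elim/ord6P: k'; rewrite ?ord6S ?ord6N /r /row6 /= => h;
    try (by left); try (by right); exfalso;
    try (by rewrite adj_irrefl in h).
  + by apply: (tri v5 v4 v3); sides.
  + by move: h; rewrite adj_sym => /N2[E|E|E]; nq E.
  + by apply: (tri v5 v0 v1); sides.
  + by apply: (tri v3 v4 v5); sides.
  + by apply: (tri v3 v2 v1); sides.
  + by move: h; rewrite adj_sym => /N0[E|E|E]; nq E.
  + by apply: (tri v1 v0 v5); sides.
  + by move: h; rewrite adj_sym => /N4[E|E|E]; nq E.
  + by apply: (tri v1 v2 v3); sides.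
Qed.

(** Bounds the number of layers, so that adding them terminates in [layered_closed]. *)
Lemma layered_card t a d : layered t a d -> t < #|G|.
Proof.
move=> L; pose f (p : 'I_t.+1 * 'I_6) := d p.1 p.2.
have fI : injective f.
  move=> [i k] [i' k'] /(layered_inj L (leq_ord i) (leq_ord i')) [/= E ->].
  by rewrite (val_inj E).
have := leq_card f fI; rewrite card_prod !card_ord; lia.
Qed.

Lemma layered_closed : capped T -> exists t a d b, layered t a d /\
  (~ layer_vertex t a d b /\ forall k, ~~ odd k -> adj b (d t k)).
Proof.
move=> /layered_init[a [d L]].
have: exists n t d, #|G| <= t + n /\ layered t a d by exists #|G|, 0, d.
move=> {d L} [n]; elim: n => [|n IHn] [t [d [le L]]].
  by have := layered_card L; rewrite addn0 in le; rewrite ltnNge le.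
have [[b B]|[d' L']] := layered_step L; first by exists t, a, d, b.
by apply: IHn; exists t.+1, d'; rewrite addSnnS.
Qed.
End Layers.

(** * Identification of tubes and of the cube *)

Lemma card_ge3 (A : finType) (P : {set A}) x y z :
  uniq [:: x; y; z] -> x \in P -> y \in P -> z \in P -> 3 <= #|P|.
Proof.
move=> U xP yP zP; rewrite cardE; apply: (uniq_leq_size (s1 := [:: x; y; z])) => // u.
by rewrite mem_enum !inE => /or3P[]/eqP->.
Qed.

(** Degree 3 leaves no further edge at the image, which is therefore closed under adjacency and, by
    connectedness, everything. *)
Lemma cubic_embedding_iso (G H : sgraph) (f : H -> G) (x0 : H) :
  (forall v : G, #|[set w | adj v w]| = 3) -> (forall u v : G, connect (@adj G) u v) ->
  (forall v : H, 3 <= #|[set w | adj v w]|) -> injective f ->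
  (forall u v, adj u v -> adj (f u) (f v)) -> graph_iso G H.
Proof.
move=> cubG conG cubH fI fH.
have nbr u : f @: [set w | adj u w] = [set w | adj (f u) w].
  apply/eqP; rewrite eqEcard card_imset // cubG cubH andbT.
  by apply/subsetP => _ /imsetP[w + ->]; rewrite !inE => /fH.
have fR u v : adj (f u) (f v) = adj u v.
  apply/idP/idP => [h|/fH //]; have : f v \in f @: [set w | adj u w] by rewrite nbr inE.
  by case/imsetP => w + /fI->; rewrite inE.
have surj y : exists x, y = f x.
  have /connectP[p] := conG (f x0) y.
  elim: p x0 => [|z p IHp] x /=; first by move=> _ ->; exists x.
  case/andP=> xz pz yE; have : z \in f @: [set w | adj x w] by rewrite nbr inE.
  by case/imsetP => w _ zE; apply: (IHp w); rewrite -zE.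
have [g fK gK] : bijective f.
  apply: inj_card_bij => //; rewrite -cardsT -[leqRHS]cardsT.
  apply: leq_trans (leq_imset_card f _); apply: subset_leq_card; apply/subsetP => y _.
  by have [x ->] := surj y; apply: imset_f.
by exists g; [exists f | move=> u v; rewrite -[in RHS](gK u) -[in RHS](gK v) fR].
Qed.

Lemma odd_shift (i : nat) (j : 'I_6) : odd (j - i%:R)%R = odd j (+) odd i.
Proof.
have odd1 (k : 'I_6) : odd (k - 1)%R = ~~ odd k by elim/ord6P: k; rewrite ord6N.
elim: i => [|i IHi]; first by rewrite subr0 addbF.
by rewrite -[in LHS]natr1 opprD addrA odd1 IHi /= addbN.
Qed.

Lemma tube_degree t (v : tube t) : 3 <= #|[set w | adj v w]|.
Proof.
case: v => [[]|[i j]].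
- by apply: (@card_ge3 _ _ (inr (ord0, o61)) (inr (ord0, o63)) (inr (ord0, o65))); rewrite ?inE.
- have [e|/negbTE e] := boolP (odd t).
    by apply: (@card_ge3 _ _ (inr (ord_max, o61)) (inr (ord_max, o63)) (inr (ord_max, o65)));
      rewrite /= ?inE /= /tube_adj /= ?eqxx ?e // /eq_op /= /eq_op /= ?eqxx.
  by apply: (@card_ge3 _ _ (inr (ord_max, o60)) (inr (ord_max, o62)) (inr (ord_max, o64)));
      rewrite /= ?inE /= /tube_adj /= ?eqxx ?e // /eq_op /= /eq_op /= ?eqxx.
have e1 : inr (i, j + 1)%R \in [set w | @adj (tube t) (inr (i, j)) w].
  by rewrite inE /= /tube_adj /= !eqxx.
have e2 : inr (i, j - 1)%R \in [set w | @adj (tube t) (inr (i, j)) w].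
  by rewrite inE /= /tube_adj /= subrK !eqxx orbT.
have [x xN x12] : exists2 x, x \in [set w | @adj (tube t) (inr (i, j)) w] &
    (forall k, x = inr (i, k) -> False).
  have [e|e] := boolP (odd j == odd i).
    have := leq_ord i; rewrite leq_eqVlt => /orP[/eqP iE|lt].
      by exists (inl false) => //; rewrite inE /= /tube_adj /=; move: e; rewrite iE eqxx.
    have h : i.+1 < t.+1 by [].
    exists (inr (Ordinal h, j)); first by rewrite inE /= /tube_adj /= !eqxx e !orbT.
    by move=> k [/(congr1 val)] /= E; lia.
  case: i e {e1 e2} => [[|i] hi] /= e.
    by exists (inl true) => //; rewrite inE /= /tube_adj /=; move: e; case: odd.
  have h : i < t.+1 by apply: ltnW.
  exists (inr (Ordinal h, j)); first by rewrite inE /= /tube_adj /= !eqxx; move: e; case: (odd j); case: (odd i); rewrite ?orbT.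
  by move=> k [] E; lia.
apply: card_ge3 e1 e2 xN; rewrite /= !inE negb_or andbT -andbA.
apply/and3P; split; apply/eqP.
- have ne (k : 'I_6) : (k + 1)%R != (k - 1)%R by elim/ord6P: k; rewrite ord6S ord6N.
  move=> E; case/eqP: (ne j).
  exact: (congr1 (fun y : tube_vertex t => if y is inr p then p.2 else j) E).
- by move/esym/x12.
- by move/esym/x12.
Qed.

Section TubeFromLayers.
Variables (G : sgraph) (T : G -> G -> G -> bool).
Hypothesis tT : turning T.

Lemma layered_tube t a d b : layered T t a d -> ~ layer_vertex t a d b ->
  (forall k : 'I_6, ~~ odd k -> adj b (d t k)) -> graph_iso G (tube t).
Proof.
move=> L nb bd.
pose f (x : tube t) : G := match x with
  | inl true => a | inl false => b | inr (i, j) => d i (j - (i : nat)%:R)%R end.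
have ab : a <> b by move=> E; apply: nb; left.
have db (i : 'I_t.+1) k : b <> d i k.
  by move=> E; apply: nb; right; exists i, k; rewrite leq_ord.
apply: (cubic_embedding_iso (f := f) (inl true)).
- exact: turning_cubic tT.
- exact: turning_connected tT.
- exact: tube_degree.
- move=> [[]|[i j]] [[]|[i' j']] //= E.
  + by case: (layered_a L (leq_ord i') E).
  + by case: (ab (esym E)).
  + by case: (db i' _ E).
  + by case: (layered_a L (leq_ord i) (esym E)).
  + by case: (db i _ (esym E)).
  + have [E1 E2] := layered_inj L (leq_ord i) (leq_ord i') E.
    by move: E2; rewrite (val_inj E1) => /addIr->.
- have arc x y : tube_arc x y -> adj (f x) (f y).
    case: x => [[]|[i j]]; case: y => [[]|[i' j']] //=.
    + by case/andP=> /eqP-> oj; rewrite subr0; apply: (layered_cap L).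
    + case/andP=> /eqP-> /eqP oj; apply: bd; by rewrite odd_shift oj addbb.
    + case/orP=> [/andP[/eqP-> /eqP->]|/and3P[/eqP i'E /eqP-> /eqP oj]].
        by rewrite addrAC; apply: (layered_ring L); exact: leq_ord.
      rewrite i'E -natr1 opprD addrA; apply: (layered_link L).
        by rewrite -i'E leq_ord.
      by rewrite odd_shift oj addbb.
  move=> u v /orP[/arc //|/arc]; by rewrite adj_sym.
Qed.
End TubeFromLayers.

Lemma tube0_cube : graph_iso (tube 0) cube.
Proof.
pose F x y z : cube := [ffun k : 'I_3 => nth false [:: x; y; z] k].
have FE x y z x' y' z' : cube_adj (F x y z) (F x' y' z') =
    ((x != x') + (y != y') + (z != z') == 1)%N.
  rewrite /cube_adj -sum1dep_card big_mkcond /= !big_ord_recl big_ord0 /= !ffunE /=.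
  by case: x x' y y' z z' => [] [] [] [] [] [].
have FI x y z x' y' z' : F x y z = F x' y' z' -> (x, y, z) = (x', y', z').
  move=> E; have e k := congr1 (fun g : {ffun 'I_3 -> bool} => g k) E.
  have := e ord0; have := e (inord 1); have := e (inord 2).
  by rewrite !ffunE /= !inordK //= => -> -> ->.
(* The ends are antipodal corners and the ring is the hexagon of the other six: one coordinate is
   true at odd positions, two at even ones. *)
pose h (x : tube 0) : cube := match x with
  | inl true => F false false false
  | inl false => F true true true
  | inr (_, j) => nth (F true false true) [:: F true false true; F true false false;
      F true true false; F false true false; F false true true; F false false true] j end.
have ind (P : tube 0 -> Prop) : P (inl true) -> P (inl false) ->
    (forall j, P (inr (ord0, j))) -> forall x, P x.
  by move=> p q r [[]|[i j]] //; rewrite ord1.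
have hI : injective h.
  elim/ind => [||j]; elim/ind => [||j'] //; rewrite /h; try elim/ord6P: j; try elim/ord6P: j';
    by [| move=> /FI [] | move=> /= /FI []].
exists h.
  apply: inj_card_bij => //.
  by rewrite card_ffun card_sum card_prod !card_ord card_bool.
elim/ind => [||j]; elim/ind => [||j'] //; rewrite /h; try elim/ord6P: j; try elim/ord6P: j';
  by rewrite /= FE.
Qed.

Lemma graph_iso_trans (G H K : sgraph) : graph_iso G H -> graph_iso H K -> graph_iso G K.
Proof.
move=> [f fB fE] [g gB gE]; exists (g \o f); first exact: bij_comp.
by move=> u v; rewrite /= gE fE.
Qed.

Lemma capped_tube (G : sgraph) (T : G -> G -> G -> bool) : turning T -> capped T ->
  graph_iso G cube \/ in_tubes G.
Proof.
move=> tT /(layered_closed tT)[t [a [d [b [L [nb bd]]]]]].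
have I := layered_tube tT L nb bd.
case: t I {L nb bd} => [|t] I; first by left; apply: graph_iso_trans I tube0_cube.
by right; exists t.+1.
Qed.

(** * Darts and faces *)

Lemma sum_pair (A B : finType) (F : A * B -> nat) : \sum_p F p = \sum_a \sum_b F (a, b).
Proof. by rewrite pair_bigA; apply: eq_bigr => -[]. Qed.

Lemma card_sum_bool (A : finType) (P : pred A) : #|[set x | P x]| = \sum_x P x.
Proof. by rewrite -sum1dep_card big_mkcond; apply: eq_bigr => x _; case: (P x). Qed.

Lemma sum4_card (A : finType) (P : A -> A -> A -> A -> bool) :
  \sum_a \sum_b \sum_c \sum_d P a b c d =
  #|[set p : A * (A * (A * A)) | P p.1 p.2.1 p.2.2.1 p.2.2.2]|.
Proof.
by rewrite card_sum_bool; do 3![rewrite sum_pair /=; apply: eq_bigr => ? _].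
Qed.

Lemma sum6_card (A : finType) (P : A -> A -> A -> A -> A -> A -> bool) :
  \sum_a \sum_b \sum_c \sum_d \sum_e \sum_f P a b c d e f =
  #|[set p : A * (A * (A * (A * (A * A)))) |
      P p.1 p.2.1 p.2.2.1 p.2.2.2.1 p.2.2.2.2.1 p.2.2.2.2.2]|.
Proof.
by rewrite card_sum_bool; do 5![rewrite sum_pair /=; apply: eq_bigr => ? _].
Qed.

Definition chorded_cyc6 (G : sgraph) (a b c d e f : G) :=
  cyc6 a b c d e f && [|| adj a d, adj b e | adj c f].

Section Map.
Variable G : plane_graph.
Hypothesis cubic : forall v : G, #|[set w | adj v w]| = 3.
Implicit Types (d e : dart G) (u v w x y z : G).

Local Notation rot := (rotation G).
Definition fnext : {perm dart G} := (revp G * rot)%g.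
Definition head d : G := (val d).2.

(** True when the face traversed by the dart from [u] to [v] goes on to [w]. *)
Definition turn u v w : bool :=
  [exists d : dart G, (val d == (v, u)) && (val (rot d) == (v, w))].

Lemma dartE d : val d = (tail d, head d). Proof. by rewrite /tail /head; case: (val d). Qed.

Lemma dart_inj d e : tail d = tail e -> head d = head e -> d = e.
Proof. by move=> h1 h2; apply: val_inj; rewrite !dartE h1 h2. Qed.

Lemma dart_adj d : adj (tail d) (head d). Proof. exact: (valP d). Qed.

Lemma ex_dart u v : adj u v -> exists2 d, tail d = u & head d = v.
Proof. by move=> uv; exists (exist _ (u, v) uv : dart G). Qed.

Lemma tail_rot d : tail (rot d) = tail d.
Proof. by have := mem_porbit rot 1 d; rewrite expg1 rotation_vertex inE => /eqP. Qed.

Lemma card_darts_at v : #|[set d : dart G | tail d == v]| = 3.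
Proof.
rewrite -(cubic v) -(card_in_imset (f := head) (D := [set d : dart G | tail d == v])).
  apply: eq_card => w; rewrite inE; apply/imsetP/idP.
    by case=> d; rewrite inE => /eqP<- ->; apply: dart_adj.
  by case/ex_dart=> d <- <-; exists d; rewrite ?inE.
by move=> d e; rewrite !inE => /eqP h1 /eqP h2; apply: dart_inj; rewrite h1.
Qed.

Lemma card_porbit_rot d : #|porbit rot d| = 3.
Proof. by rewrite rotation_vertex card_darts_at. Qed.

Lemma rot3 d : [/\ rot (rot (rot d)) = d, rot d != d & rot (rot d) != d].
Proof.
have := iter_porbit rot d; have := uniq_traject_porbit rot d; rewrite card_porbit_rot /= !inE.
rewrite negb_or => /andP[/andP[h1 h2] _] h3.
by split=> //; rewrite eq_sym.
Qed.

Lemma rot_cases d e : tail e = tail d -> [\/ e = d, e = rot d | e = rot (rot d)].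
Proof.
move=> te; have : e \in porbit rot d by rewrite rotation_vertex inE te.
rewrite porbit_traject card_porbit_rot /= !inE => /or3P[]/eqP->;
  by [constructor 1 | constructor 2 | constructor 3].
Qed.

Lemma turnE d e : tail d = tail e -> turn (head d) (tail d) (head e) = (rot d == e).
Proof.
move=> te; apply/existsP/eqP => [[d' /andP[/eqP h1 /eqP h2]]|E].
  have -> : d = d' by apply: dart_inj; rewrite ?/tail ?/head h1.
  by apply: dart_inj; rewrite -?te /tail /head h2.
by exists d; rewrite E !dartE !eqxx /= te eqxx.
Qed.

Lemma turn_anti u v w : adj v u -> adj v w -> u != w -> turn w v u = ~~ turn u v w.
Proof.
case/ex_dart=> d <- <- /ex_dart[e te <-] de.
have tde : tail d = tail e by [].
rewrite -{1}te !turnE //; have ne : e != d by apply: contraNneq de => ->.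
have [r3 r1 r2] := rot3 d.
case: (rot_cases te) => E; first by rewrite E eqxx in ne.
  by rewrite -E eqxx /= E (negbTE r2).
by rewrite E r3 eqxx; apply/esym; rewrite -E eq_sym; have [_ + _] := rot3 (rot d); rewrite -E => ->.
Qed.

Lemma turn_cyclic v u w x : adj v u -> adj v w -> adj v x -> u != w -> w != x -> u != x ->
  turn w v x = turn u v w.
Proof.
case/ex_dart=> d td <- /ex_dart[e te <-] /ex_dart[f tf <-] de ef df.
have ne1 : e <> d by move=> E; rewrite E eqxx in de.
have ne2 : f <> e by move=> E; rewrite E eqxx in ef.
have ne3 : f <> d by move=> E; rewrite E eqxx in df.
rewrite -{1}te -td turnE ?turnE ?td ?te ?tf //.
have [r3 r1 r2] := rot3 d.
case: (@rot_cases d e) => [|//|Ee|Ee]; first by rewrite te td.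
  case: (@rot_cases d f) => [|//|Ef|Ef]; first by rewrite tf td.
    by case: ne2; rewrite Ee Ef.
  by rewrite Ee Ef !eqxx.
case: (@rot_cases d f) => [|//|Ef|Ef]; first by rewrite tf td.
  rewrite Ee Ef r3; rewrite (negbTE (_ : d != rot d)) 1?eq_sym //.
  by apply/esym/negbTE; have [_ + _] := rot3 (rot d); rewrite eq_sym.
by case: ne2; rewrite Ee Ef.
Qed.

Lemma fnextE d : fnext d = rot (dart_rev d).
Proof. by rewrite permM permE. Qed.

Lemma tail_fnext d : tail (fnext d) = head d.
Proof. by rewrite fnextE tail_rot. Qed.

Lemma turn_fnext d : turn (tail d) (head d) (head (fnext d)).
Proof.
have h : tail (dart_rev d) = tail (fnext d) by rewrite tail_fnext.
by have := turnE h; rewrite fnextE eqxx.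
Qed.

Lemma fnext_turn d e : head d = tail e -> tail d != head e ->
  turn (tail d) (head d) (head e) -> fnext d = e.
Proof.
move=> de ne h; have h' : tail (dart_rev d) = tail e by [].
by rewrite fnextE; apply/eqP; rewrite -(turnE h').
Qed.

Hypothesis faces46 : forall f, f \in faces G -> bounded_by_cycle 4 f \/ bounded_by_cycle 6 f.

Lemma face_porbit d : porbit fnext d \in faces G.
Proof. exact: imset_f. Qed.

Lemma face_size d : #|porbit fnext d| = 4 \/ #|porbit fnext d| = 6.
Proof. by case: (faces46 (face_porbit d)) => [[]|[]]; [left|right]. Qed.

Lemma tail_face_uniq d : uniq (map (@tail G) (traject fnext d #|porbit fnext d|)).
Proof.
rewrite map_inj_in_uniq ?uniq_traject_porbit // => x y.
rewrite -!porbit_traject => hx hy.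
by case: (faces46 (face_porbit d)) => [[_]|[_]]; apply.
Qed.

Lemma iter_fnext d : iter #|porbit fnext d| fnext d = d.
Proof. exact: iter_porbit. Qed.

Lemma square_of_dart d : #|porbit fnext d| = 4 ->
  square_face turn true (tail d) (tail (fnext d)) (tail (fnext (fnext d)))
    (tail (fnext (fnext (fnext d)))).
Proof.
move=> c4; have := tail_face_uniq d; have := iter_fnext d; rewrite c4 /= => E U.
have st e : adj (tail e) (tail (fnext e)) by rewrite tail_fnext dart_adj.
have tt e : turn (tail e) (tail (fnext e)) (tail (fnext (fnext e))).
  by rewrite [tail (fnext e)]tail_fnext [tail (fnext (fnext _))]tail_fnext turn_fnext.
have a3 := st (fnext (fnext (fnext d))); rewrite E in a3.
have t2 := tt (fnext (fnext d)); rewrite E in t2.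
have t3 := tt (fnext (fnext (fnext d))); rewrite E in t3.
have t0 := tt d; have t1 := tt (fnext d).
have s0 := st d; have s1 := st (fnext d); have s2 := st (fnext (fnext d)).
rewrite /square_face /cyc4 t0 t1 t2 t3 s0 s1 s2 a3 !andbT; exact: U.
Qed.

Lemma hexagon_of_dart d : #|porbit fnext d| = 6 ->
  hexagon_face turn true (tail d) (tail (fnext d)) (tail (fnext (fnext d)))
    (tail (fnext (fnext (fnext d)))) (tail (fnext (fnext (fnext (fnext d)))))
    (tail (fnext (fnext (fnext (fnext (fnext d)))))).
Proof.
move=> c6; have := tail_face_uniq d; have := iter_fnext d; rewrite c6 /= => E U.
have st e : adj (tail e) (tail (fnext e)) by rewrite tail_fnext dart_adj.
have tt e : turn (tail e) (tail (fnext e)) (tail (fnext (fnext e))).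
  by rewrite [tail (fnext e)]tail_fnext [tail (fnext (fnext _))]tail_fnext turn_fnext.
have a5 := st (fnext (fnext (fnext (fnext (fnext d))))); rewrite E in a5.
have t4 := tt (fnext (fnext (fnext (fnext d)))); rewrite E in t4.
have t5 := tt (fnext (fnext (fnext (fnext (fnext d))))); rewrite E in t5.
have t0 := tt d; have t1 := tt (fnext d); have t2 := tt (fnext (fnext d)).
have t3 := tt (fnext (fnext (fnext d))).
have s0 := st d; have s1 := st (fnext d); have s2 := st (fnext (fnext d)).
have s3 := st (fnext (fnext (fnext d))); have s4 := st (fnext (fnext (fnext (fnext d)))).
rewrite /hexagon_face /cyc6 t0 t1 t2 t3 t4 t5 s0 s1 s2 s3 s4 a5 !andbT; exact: U.
Qed.

Lemma square_face_rev s u v w x : square_face turn s u v w x -> square_face turn (~~ s) x w v u.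
Proof.
move=> S; open_ S; rewrite /square_face /cyc4; repeat (apply/andP; split);
  try (rewrite turn_anti; [by apply/eqP; congr (~~ _) | sides ..]); neqs.
Qed.

Lemma hexagon_face_rev s u v w x y z :
  hexagon_face turn s u v w x y z -> hexagon_face turn (~~ s) z y x w v u.
Proof.
move=> S; open_ S; rewrite /hexagon_face /cyc6; repeat (apply/andP; split);
  try (rewrite turn_anti; [by apply/eqP; congr (~~ _) | sides ..]); neqs.
Qed.

Lemma square_face_rot s u v w x : square_face turn s u v w x -> square_face turn s v w x u.
Proof.
move=> S; open_ S; rewrite /square_face /cyc4; repeat (apply/andP; split);
  try (by apply/eqP); neqs.
Qed.

Lemma hexagon_face_rot s u v w x y z :
  hexagon_face turn s u v w x y z -> hexagon_face turn s v w x y z u.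
Proof.
move=> S; open_ S; rewrite /hexagon_face /cyc6; repeat (apply/andP; split);
  try (by apply/eqP); neqs.
Qed.

Lemma corner_face u v w : adj u v -> adj v w -> u != w ->
  (exists x, square_face turn (turn u v w) u v w x) \/
  (exists x y z, hexagon_face turn (turn u v w) u v w x y z).
Proof.
have pos a b c : adj a b -> adj b c -> a != c -> turn a b c ->
    (exists x, square_face turn true a b c x) \/
    (exists x y z, hexagon_face turn true a b c x y z).
  case/ex_dart=> d <- <- /ex_dart[e te <-] ne t.
  have E : fnext d = e by apply: fnext_turn.
  have hE : head e = tail (fnext (fnext d)) by rewrite tail_fnext E.
  case: (face_size d) => [/square_of_dart S|/hexagon_of_dart H]; rewrite hE -[head d]tail_fnext.
    by left; eexists; exact: S.
  by right; do 3!eexists; exact: H.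
move=> uv vw uw; case t: (turn u v w); first exact: pos.
(* A corner that turns to the other side follows a face when walked backwards; that face is then
   reversed. *)
have t' : turn w v u by rewrite turn_anti ?t //; sides.
have [||||[x S]|[x [y [z H]]]] := @pos w v u; try sides.
  left; exists x; exact: square_face_rot (square_face_rev S).
right; exists z, y, x.
by do 3!apply: hexagon_face_rot; exact: hexagon_face_rev H.
Qed.

Hypothesis six_squares : num_faces G 4 = 6.

Lemma turn_turning : turning turn.
Proof.
split.
- exact: cubic.
- exact: turn_anti.
- by move=> v a b c *; apply: turn_cyclic.
- exact: corner_face.
- have : 0 < num_faces G 4 by rewrite six_squares.
  case/card_gt0P => f; rewrite inE => /andP[/imsetP[d _ ->] /eqP c4].
  by do 5!eexists; exact: square_of_dart c4.
- exact: pconnected.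
Qed.

Lemma dart_of_square d e f g : square_face turn true (tail d) (tail e) (tail f) (tail g) ->
  head d = tail e -> head e = tail f -> head f = tail g -> head g = tail d ->
  [/\ fnext d = e, fnext e = f, fnext f = g & #|porbit fnext d| = 4].
Proof.
move=> S h1 h2 h3 h4; open_ S.
have E1 : fnext d = e by apply: fnext_turn; rewrite ?h1 ?h2.
have E2 : fnext e = f by apply: fnext_turn; rewrite ?h2 ?h3.
have E3 : fnext f = g by apply: fnext_turn; rewrite ?h3 ?h4 //; sides.
have E4 : fnext g = d by apply: fnext_turn; rewrite ?h4 ?h1 //; sides.
split=> //; case: (face_size d) => // c6.
have := tail_face_uniq d; rewrite c6 /= E1 E2 E3 E4 !inE eqxx.
by rewrite !orbT.
Qed.

Lemma dart_of_hexagon d e f g i j :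
  hexagon_face turn true (tail d) (tail e) (tail f) (tail g) (tail i) (tail j) ->
  head d = tail e -> head e = tail f -> head f = tail g -> head g = tail i ->
  head i = tail j -> head j = tail d ->
  [/\ fnext d = e, fnext e = f, fnext f = g & [/\ fnext g = i, fnext i = j & #|porbit fnext d| = 6]].
Proof.
move=> S h1 h2 h3 h4 h5 h6; open_ S.
have E1 : fnext d = e by apply: fnext_turn; rewrite ?h1 ?h2.
have E2 : fnext e = f by apply: fnext_turn; rewrite ?h2 ?h3.
have E3 : fnext f = g by apply: fnext_turn; rewrite ?h3 ?h4 //; sides.
have E4 : fnext g = i by apply: fnext_turn; rewrite ?h4 ?h5 //; sides.
have E5 : fnext i = j by apply: fnext_turn; rewrite ?h5 ?h6 //; sides.
do 2!split=> //; case: (face_size d) => // c4.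
have := iter_fnext d; rewrite c4 /= E1 E2 E3 E4 => id.
by exfalso; match goal with K : is_true (tail d != tail i) |- _ => by rewrite id eqxx in K end.
Qed.

Lemma card_face_darts k : #|[set d | #|porbit fnext d| == k]| = (k * num_faces G k)%N.
Proof.
rewrite -sum1dep_card (partition_big (porbit fnext) (mem (faces G))) /=; last first.
  by move=> d _; apply: face_porbit.
rewrite (bigID (fun f : {set dart G} => #|f| == k)) /= [X in (_ + X)%N]big1 ?addn0; last first.
  by move=> f /andP[_ /negbTE nk]; rewrite big1 // => d /andP[h /eqP E]; rewrite E nk in h.
rewrite (eq_bigr (fun=> k)).
  by rewrite sum_nat_const mulnC /num_faces; congr (_ * _)%N; apply: eq_card => f; rewrite !inE.
move=> f /andP[/imsetP[e _ ->] /eqP ck].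
rewrite sum1dep_card -[RHS]ck; apply: eq_card => d.
rewrite inE eq_porbit_mem; case dE: (d \in _); rewrite ?andbF // andbT.
by move: dE; rewrite -eq_porbit_mem => /eqP->; rewrite ck eqxx.
Qed.

Lemma card_darts : #|dart G| = (3 * #|G|)%N.
Proof.
rewrite -sum1_card (partition_big (@tail G) xpredT) //=.
rewrite (eq_bigr (fun=> 3)) ?sum_nat_const ?card_ord 1?mulnC //.
by move=> v _; rewrite sum1dep_card card_darts_at.
Qed.

(** Darts counted by tails and by faces: $3|V|=4\cdot 6+6h$. *)
Lemma card_vertices : #|G| = (8 + 2 * num_faces G 6)%N.
Proof.
have := card_darts; rewrite -cardsT.
rewrite (_ : [set: dart G] = [set d | #|porbit fnext d| == 4] :|: [set d | #|porbit fnext d| == 6]).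
  rewrite cardsU (_ : _ :&: _ = set0) ?cards0 ?subn0.
    rewrite !card_face_darts six_squares; lia.
  by apply/setP => d; rewrite !inE; case: eqP => // ->.
by apply/setP => d; rewrite !inE; case: (face_size d) => ->.
Qed.

(** For [true], rooted square faces are the darts on squares, four on each of six; reversal settles
    [false]. *)
Lemma num_square_rooted s :
  \sum_(a : G) \sum_b \sum_c \sum_d square_face turn s a b c d = 24.
Proof.
have T : \sum_(a : G) \sum_b \sum_c \sum_d square_face turn true a b c d = 24.
  rewrite sum4_card -[RHS]/(4 * 6)%N -six_squares -card_face_darts.
  pose g d := (tail d, (tail (fnext d), (tail (fnext (fnext d)), tail (fnext (fnext (fnext d)))))).
  have gI : injective g.
    by move=> d e [h1 h2 _ _]; apply: dart_inj => //; rewrite -!tail_fnext.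
  rewrite -(card_imset _ gI); apply: eq_card => -[a [b [c d]]]; rewrite inE /=.
  apply/idP/imsetP => [S|[e]]; last first.
    by rewrite inE => /eqP/square_of_dart S [-> -> -> ->].
  have S' := S; open_ S'.
  have [d0 t0 h0] : exists2 x, tail x = a & head x = b by apply: ex_dart.
  have [d1 t1 h1] : exists2 x, tail x = b & head x = c by apply: ex_dart.
  have [d2 t2 h2] : exists2 x, tail x = c & head x = d by apply: ex_dart.
  have [d3 t3 h3] : exists2 x, tail x = d & head x = a by apply: ex_dart.
  have [|||||E1 E2 E3 E4] := @dart_of_square d0 d1 d2 d3; rewrite ?t0 ?t1 ?t2 ?t3 //.
  by exists d0; rewrite ?inE ?E4 // /g E1 E2 E3 t0 t1 t2 t3.
case: s => //; rewrite -{}T !sum4_card.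
pose r (p : G * (G * (G * G))) := (p.2.2.2, (p.2.2.1, (p.2.1, p.1))).
have rI : injective r by move=> [a [b [c d]]] [a' [b' [c' d']]] [-> -> -> ->].
rewrite -(card_imset _ rI); apply: eq_card => -[a [b [c d]]]; rewrite inE /=.
apply/imsetP/idP => [[[a' [b' [c' d']]]]|S].
  by rewrite inE /= => S [-> -> -> ->]; exact: square_face_rev S.
by exists (d, (c, (b, a))); rewrite ?inE //=; exact: square_face_rev S.
Qed.

Lemma num_hexagon_rooted s :
  \sum_(a : G) \sum_b \sum_c \sum_d \sum_e \sum_f hexagon_face turn s a b c d e f =
  (6 * num_faces G 6)%N.
Proof.
have T : \sum_(a : G) \sum_b \sum_c \sum_d \sum_e \sum_f hexagon_face turn true a b c d e f
    = (6 * num_faces G 6)%N.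
  rewrite sum6_card -card_face_darts.
  pose g d := (tail d, (tail (fnext d), (tail (fnext (fnext d)), (tail (fnext (fnext (fnext d))),
    (tail (fnext (fnext (fnext (fnext d)))), tail (fnext (fnext (fnext (fnext (fnext d)))))))))).
  have gI : injective g.
    by move=> d e [h1 h2 _ _ _ _]; apply: dart_inj => //; rewrite -!tail_fnext.
  rewrite -(card_imset _ gI); apply: eq_card => -[a [b [c [d [e f]]]]]; rewrite inE /=.
  apply/idP/imsetP => [S|[d0]]; last first.
    by rewrite inE => /eqP/hexagon_of_dart S [-> -> -> -> -> ->].
  have S' := S; open_ S'.
  have [d0 t0 h0] : exists2 x, tail x = a & head x = b by apply: ex_dart.
  have [d1 t1 h1] : exists2 x, tail x = b & head x = c by apply: ex_dart.
  have [d2 t2 h2] : exists2 x, tail x = c & head x = d by apply: ex_dart.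
  have [d3 t3 h3] : exists2 x, tail x = d & head x = e by apply: ex_dart.
  have [d4 t4 h4] : exists2 x, tail x = e & head x = f by apply: ex_dart.
  have [d5 t5 h5] : exists2 x, tail x = f & head x = a by apply: ex_dart.
  have [|||||||E1 E2 E3 [E4 E5 E6]] := @dart_of_hexagon d0 d1 d2 d3 d4 d5;
    rewrite ?t0 ?t1 ?t2 ?t3 ?t4 ?t5 //.
  by exists d0; rewrite ?inE ?E6 // /g E1 E2 E3 E4 E5 t0 t1 t2 t3 t4 t5.
case: s => //; rewrite -{}T !sum6_card.
pose r (p : G * (G * (G * (G * (G * G))))) :=
  (p.2.2.2.2.2, (p.2.2.2.2.1, (p.2.2.2.1, (p.2.2.1, (p.2.1, p.1))))).
have rI : injective r.
  by move=> [a [b [c [d [e f]]]]] [a' [b' [c' [d' [e' f']]]]] [-> -> -> -> -> ->].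
rewrite -(card_imset _ rI); apply: eq_card => -[a [b [c [d [e f]]]]]; rewrite inE /=.
apply/imsetP/idP => [[[a' [b' [c' [d' [e' f']]]]]]|S].
  by rewrite inE /= => S [-> -> -> -> -> ->]; exact: hexagon_face_rev S.
by exists (f, (e, (d, (c, (b, a))))); rewrite ?inE //=; exact: hexagon_face_rev S.
Qed.

Lemma rooted4_squares : rooted4 G = 48.
Proof.
rewrite /rooted4 -[RHS]/(24 + 24)%N -{1}(num_square_rooted true) -(num_square_rooted false).
rewrite -big_split /=; apply: eq_bigr => a _; rewrite -big_split /=; apply: eq_bigr => b _.
rewrite -big_split /=; apply: eq_bigr => c _; rewrite -big_split /=; apply: eq_bigr => d _.
have [C|C] := boolP (cyc4 a b c d); last by rewrite /square_face (negbTE C).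
have [s S] := cyc4_face turn_turning C.
have nS s' : square_face turn s' a b c d -> s = s'.
  by move=> S'; open_ S; open_ S'; congruence.
case: s S nS => S nS; rewrite S.
  by case h: (square_face turn false a b c d) => //; have := nS _ h.
by case h: (square_face turn true a b c d) => //; have := nS _ h.
Qed.

(** A chordless 6-cycle is a face on exactly one side, and no face has a chord, so the two terms do
    not overlap. *)
Lemma rooted6_split : ~ capped turn -> rooted6 G = (12 * num_faces G 6 +
  \sum_(a : G) \sum_b \sum_c \sum_d \sum_e \sum_f chorded_cyc6 a b c d e f)%N.
Proof.
move=> ncap; have -> : (12 * num_faces G 6 = 6 * num_faces G 6 + 6 * num_faces G 6)%N by lia.
rewrite -{1}(num_hexagon_rooted true) -(num_hexagon_rooted false) /rooted6.
rewrite -!big_split /=; apply: eq_bigr => a _; rewrite -!big_split /=; apply: eq_bigr => b _.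
rewrite -!big_split /=; apply: eq_bigr => c _; rewrite -!big_split /=; apply: eq_bigr => d _.
rewrite -!big_split /=; apply: eq_bigr => e _; rewrite -!big_split /=; apply: eq_bigr => z _.
rewrite /chorded_cyc6; have [C|C] := boolP (cyc6 a b c d e z); last by rewrite /hexagon_face (negbTE C).
have tT := turn_turning.
have nH s s' : hexagon_face turn s a b c d e z -> hexagon_face turn s' a b c d e z -> s = s'.
  by move=> S S'; open_ S; open_ S'; congruence.
have nc s : hexagon_face turn s a b c d e z -> [|| adj a d, adj b e | adj c z] = false.
  move=> H; rewrite (hexagon_no_chord tT H) (hexagon_no_chord tT (hexagon_face_rot H)).
  by rewrite (hexagon_no_chord tT (hexagon_face_rot (hexagon_face_rot H))).
have [ch|] := boolP [|| adj a d, adj b e | adj c z].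
  rewrite /=; case h: (hexagon_face turn true _ _ _ _ _ _); first by rewrite (nc _ h) in ch.
  by case h': (hexagon_face turn false _ _ _ _ _ _); first by rewrite (nc _ h') in ch.
rewrite !negb_or => /and3P[n0 n1 n2].
have [s H] := cyc6_face tT ncap C n0 n1 n2.
case: s H => H; rewrite H.
  by case h: (hexagon_face turn false _ _ _ _ _ _) => //; have := nH _ _ H h.
by case h: (hexagon_face turn true _ _ _ _ _ _) => //; have := nH _ _ H h.
Qed.
End Map.

(** * Six-cycles with a chord *)

Section DualSquares.
Variable G : sgraph.
Implicit Types (c : {ffun 'I_6 -> G}) (i j r : 'I_6).

Lemma sum6_ffun (P : G -> G -> G -> G -> G -> G -> bool) :
  \sum_a \sum_b \sum_c \sum_d \sum_e \sum_f P a b c d e f =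
  #|[set c : {ffun 'I_6 -> G} | P (c o60) (c o61) (c o62) (c o63) (c o64) (c o65)]|.
Proof.
rewrite sum6_card.
pose h c := (c o60, (c o61, (c o62, (c o63, (c o64, c o65))))).
have hI : injective h by move=> c c' [e0 e1 e2 e3 e4 e5]; apply/ffunP; elim/ord6P.
rewrite -(card_imset _ hI); apply: eq_card => -[a [b [c [d [e f]]]]]; rewrite inE /=.
apply/idP/imsetP => [S|[c0]]; last by rewrite inE => S [-> -> -> -> -> ->].
by exists [ffun k => row6 a b c d e f k]; rewrite ?inE /h !ffunE.
Qed.

Lemma is_cycle6E c : is_cycle6 c = cyc6 (c o60) (c o61) (c o62) (c o63) (c o64) (c o65).
Proof.
rewrite /is_cycle6 /cyc6 /injectiveb /dinjectiveb; congr andb.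
  rewrite (_ : enum 'I_6 = [:: o60; o61; o62; o63; o64; o65]) //.
  by apply: (inj_map val_inj); rewrite val_enum_ord.
apply/forallP/idP => [H|/and5P[h0 h1 h2 h3 /andP[h4 h5]]].
  have := (H o60, H o61, H o62, H o63, H o64, H o65); rewrite !ord6S.
  by move=> [[[[[-> ->] ->] ->] ->] ->].
by elim/ord6P; rewrite ord6S.
Qed.

Lemma ord6D3 : ((o60 + 3 = o63)%R * (o61 + 3 = o64)%R * (o62 + 3 = o65)%R
  * (o63 + 3 = o60)%R * (o64 + 3 = o61)%R * (o65 + 3 = o62)%R)%type.
Proof. by do !split; apply: val_inj. Qed.

Definition chorded : {set {ffun 'I_6 -> G}} :=
  [set c | is_cycle6 c && [exists i, adj (c i) (c (i + 3)%R)]].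

Lemma num_chorded : \sum_(a : G) \sum_b \sum_c \sum_d \sum_e \sum_f chorded_cyc6 a b c d e f
  = #|chorded|.
Proof.
rewrite sum6_ffun; apply: eq_card => c; rewrite !inE /chorded_cyc6 is_cycle6E; congr andb.
apply/or3P/existsP => [|[i]].
  by case=> h; [exists o60 | exists o61 | exists o62]; rewrite ord6D3.
by elim/ord6P: i; rewrite ord6D3 => h; [constructor 1 | constructor 2 | constructor 3
 | constructor 1 | constructor 2 | constructor 3]; rewrite // adj_sym.
Qed.

Lemma cycle6P c : reflect (injective c /\ forall i, adj (c i) (c (i + 1)%R)) (is_cycle6 c).
Proof. by apply: (iffP andP) => -[/injectiveP cI /forallP ca]. Qed.

(** The 12 parametrisations of one cycle: a start, and a direction given by the boolean. *)
Definition dihedral c (p : 'I_6 * bool) : {ffun 'I_6 -> G} :=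
  [ffun i => c (if p.2 then p.1 + i else p.1 - i)%R].

Lemma dihedral_cycle c p : is_cycle6 c -> is_cycle6 (dihedral c p).
Proof.
case/cycle6P=> cI ca; case: p => r b; apply/cycle6P; split.
  by move=> i j; rewrite !ffunE => /cI /=; case: b => /addrI // /oppr_inj.
move=> i; rewrite !ffunE /=; case: b; first by rewrite addrA.
by rewrite opprD addrA adj_sym; have := ca (r - i - 1)%R; rewrite subrK.
Qed.

Lemma dihedral_chorded c p : c \in chorded -> dihedral c p \in chorded.
Proof.
rewrite !inE => /andP[cc /existsP[i h]]; rewrite dihedral_cycle //=; apply/existsP.
case: p => r b; exists (if b then i - r else r - i)%R; rewrite !ffunE /=.
(* Opposite vertices stay opposite under reflection because 3 and -3 agree mod 6. *)
have e3 : (3 = - 3 :> 'I_6)%R by apply: val_inj.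
case: b.
  have -> : (r + (i - r) = i)%R by ring.
  by have -> : (r + (i - r + 3) = i + 3)%R by ring.
have -> : (r - (r - i) = i)%R by ring.
by have -> : (r - (r - i + 3) = i + 3)%R by rewrite {2}e3; ring.
Qed.

Lemma dihedral_edges c p : cycle6_edges (dihedral c p) = cycle6_edges c.
Proof.
case: p => r b; apply/setP => e; apply/imsetP/imsetP => -[i _ ->].
  case: b; rewrite !ffunE /=; first by exists (r + i)%R; rewrite ?addrA.
  exists (r - i - 1)%R => //; rewrite setUC.
  have -> : (r - (i + 1) = r - i - 1)%R by ring.
  by have -> : (r - i - 1 + 1 = r - i)%R by ring.
case: b.
  exists (i - r)%R => //; rewrite !ffunE /=.
  have -> : (r + (i - r) = i)%R by ring.
  by have -> : (r + (i - r + 1) = i + 1)%R by ring.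
exists (r - i - 1)%R => //; rewrite !ffunE /= setUC.
have -> : (r - (r - i - 1 + 1) = i)%R by ring.
by have -> : (r - (r - i - 1) = i + 1)%R by ring.
Qed.

Lemma dihedral_inj c : is_cycle6 c -> injective (dihedral c).
Proof.
case/cycle6P=> cI ca [r b] [r' b'] E.
have e i : (if b then r + i else r - i)%R = (if b' then r' + i else r' - i)%R.
  by apply: cI; have := congr1 (fun f : {ffun 'I_6 -> G} => f i) E; rewrite !ffunE.
have r0 : r = r' by have := e 0%R; case: (b); case: (b'); rewrite ?addr0 ?subr0.
subst r'; congr pair; have := e 1%R.
by case: b b' {E e} => [] [] // /addrI/(congr1 val).
Qed.

Lemma edge_of_cycle6 c i y : is_cycle6 c -> [set c i; y] \in cycle6_edges c ->
  y = c (i + 1)%R \/ y = c (i - 1)%R.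
Proof.
case/cycle6P=> cI ca /imsetP[j _ E].
have cy : c i != y.
  apply/eqP => iy; have := cards2 (c j) (c (j + 1)%R); rewrite -E iy setUid cards1.
  by rewrite (adj_neq (ca j)).
have : c i \in [set c j; c (j + 1)%R] by rewrite -E !inE eqxx.
have : y \in [set c j; c (j + 1)%R] by rewrite -E !inE eqxx orbT.
rewrite !inE => /orP[]/eqP yE /orP[]/eqP h.
- by rewrite h yE eqxx in cy.
- by right; rewrite yE (cI _ _ h) addrK.
- by left; rewrite yE (cI _ _ h).
- by rewrite h yE eqxx in cy.
Qed.

Lemma same_edges_dihedral c c' : is_cycle6 c -> is_cycle6 c' ->
  cycle6_edges c' = cycle6_edges c -> exists p, c' = dihedral c p.
Proof.
move=> cc cc' E; have [cI ca] := cycle6P _ cc; have [cI' ca'] := cycle6P _ cc'.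
have edge i : [set c' i; c' (i + 1)%R] \in cycle6_edges c by rewrite -E; apply: imset_f.
have [r r0] : exists r, c' 0%R = c r.
  have /imsetP[j _ Ej] := edge 0%R.
  have : c' 0%R \in [set c j; c (j + 1)%R] by rewrite -Ej !inE eqxx.
  by rewrite !inE => /orP[]/eqP->; eexists.
have next i j : c' i = c j -> c' (i + 1)%R = c (j + 1)%R \/ c' (i + 1)%R = c (j - 1)%R.
  by move=> h; apply: edge_of_cycle6 => //; rewrite -h.
have ne2 i : c' (i + 1 + 1)%R <> c' i.
  by move/cI' => /eqP; rewrite -addrA -subr_eq0 addrAC subrr add0r => /eqP/(congr1 val).
(* The cycle [c'] never returns to the vertex it has just left, so it keeps the direction of its
   first step. *)
have steps (b : bool) : c' 1%R = c (if b then r + 1 else r - 1)%R ->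
    forall n : nat, c' (n%:R)%R = c (if b then r + n%:R else r - n%:R)%R /\
       c' (n.+1%:R)%R = c (if b then r + n.+1%:R else r - n.+1%:R)%R.
  move=> h1; elim=> [|n [h h']]; first by case: b h1; rewrite ?addr0 ?subr0.
  split=> //; have := next _ _ h'; rewrite !natr1 => -[] h''; rewrite h''.
    case: b {h1} h h' h'' => h h' h''; first by rewrite -[in RHS]natr1 addrA.
    by case: (ne2 (n%:R)%R); rewrite !natr1 h'' h -natr1; congr (c _); ring.
  case: b {h1} h h' h'' => h h' h''; last by rewrite -[in RHS]natr1 opprD addrA.
  by case: (ne2 (n%:R)%R); rewrite !natr1 h'' h -natr1; congr (c _); ring.
have [b h1] : exists b : bool, c' 1%R = c (if b then r + 1 else r - 1)%R.
  by have := next _ _ r0; rewrite add0r => -[] h; [exists true | exists false].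
exists (r, b); apply/ffunP => i; rewrite ffunE /=.
have [+ _] := steps b h1 i; by rewrite natr_Zp.
Qed.

(** The fibres of [cycle6_edges] are dihedral orbits, of 12 elements each. *)
Lemma card_chorded : #|chorded| = (12 * #|dual_squares G|)%N.
Proof.
rewrite -sum1_card (partition_big_imset (@cycle6_edges G)) /=.
rewrite -[X in _ = (_ * X)%N]sum1_card big_distrr /=; apply: eq_bigr => e /imsetP[c cch ->].
have cc : is_cycle6 c by move: cch; rewrite inE => /andP[].
rewrite sum1dep_card muln1.
transitivity #|dihedral c @: [set: 'I_6 * bool]|; last first.
  by rewrite (card_imset _ (dihedral_inj cc)) cardsT card_prod card_ord card_bool.
apply: eq_card => c'; rewrite inE; apply/andP/imsetP => [[c'ch /eqP E]|[p _ ->]].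
  have cc' : is_cycle6 c' by move: c'ch; rewrite inE => /andP[].
  by have [p ->] := same_edges_dihedral cc cc' E; exists p.
by rewrite dihedral_chorded // dihedral_edges.
Qed.
End DualSquares.

(** * Six-cycles of tubes *)

(* Vertices of a tube seen from level [i0]: the two ends, and [(o, j)] for the
   vertex [c_{i0 + o - 6, j}]. Walks of length 6 from level [i0] only meet
   offsets between 0 and 12; [lo] and [hi] are the offsets of the first and of
   the last ring, when they are in that range, and [par] is the parity of [i0]. *)
Definition code : eqType := (bool + nat * nat)%type.

Section Codes.
Variables (lo hi : option nat) (par : bool).

Definition code_nbrs (x : code) : seq code :=
  match x with
  | inl true => if lo is Some o then [:: inr (o, 1); inr (o, 3); inr (o, 5)] else [::]
  | inl false => if hi is Some o then
      if par (+) odd o then [:: inr (o, 1); inr (o, 3); inr (o, 5)]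
      else [:: inr (o, 0); inr (o, 2); inr (o, 4)] else [::]
  | inr (o, j) => [:: inr (o, if j == 5 then 0 else j.+1); inr (o, if j == 0 then 5 else j.-1);
      if odd j == par (+) odd o then (if hi == Some o then inl false else inr (o.+1, j))
      else (if lo == Some o then inl true else inr (o.-1, j))]
  end.

(** [p] is the path so far, latest vertex first, so [last x p] is its root; counted are the
    extensions by [n] vertices that close up there. *)
Fixpoint code_walks n (p : seq code) (x : code) : nat :=
  if n is n'.+1 then
    sumn [seq if y \in x :: p then 0 else code_walks n' (x :: p) y | y <- code_nbrs x]
  else last x p \in code_nbrs x.

Lemma code_walks0 p x : code_walks 0 p x = (last x p \in code_nbrs x). Proof. by []. Qed.

Lemma code_walksS n p x : code_walks n.+1 p x =
  sumn [seq if y \in x :: p then 0 else code_walks n (x :: p) y | y <- code_nbrs x].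
Proof. by []. Qed.
End Codes.
Arguments code_walks : simpl never.
Arguments code_nbrs : simpl never.

(** [None] stands for an end out of reach. Excluded are a single ring and a parity that does not fit
    the offset of the first ring. With two orientations each, an inner ring vertex is on three
    hexagons and its ring, a vertex of an end ring on five 6-cycles, an end on three dual
    squares. *)
Definition code_table : bool :=
  let offs := [:: None; Some 0; Some 1; Some 2; Some 3; Some 4; Some 5; Some 6] in
  let up o := omap (fun k => 12 - k) o in
  all (fun l => all (fun u => all (fun p =>
    [|| (l == Some 6) && (u == Some 6), (if l is Some k then p != odd k else false) |
    [&& all (fun j => code_walks l (up u) p 5 [::] (inr (6, j)) ==
        if (l == Some 6) || (u == Some 6) then 10 else 8) [:: 0; 1; 2; 3; 4; 5],
    (l == Some 6) ==> (code_walks l (up u) p 5 [::] (inl true) == 6) &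
    (u == Some 6) ==> (code_walks l (up u) p 5 [::] (inl false) == 6)]])
   [:: true; false]) offs) offs.

Lemma code_tableT : code_table.
Proof. by vm_compute. Qed.

Lemma sum_cond_eq_nat (T : finType) (P : pred T) (F E : T -> nat) :
  (forall x, P x -> F x = E x) -> (forall x, ~~ P x -> E x = 0) ->
  \sum_(x | P x) F x = \sum_x E x.
Proof.
move=> FE E0; rewrite (eq_bigr _ FE) [RHS](bigID P) /=.
by rewrite [X in _ + X]big1 ?addn0 // => x /E0->.
Qed.

(** * Transfer of walks between tubes and codes *)

Section GraphWalks.
Variable G : sgraph.
Implicit Types (x y a b c d e f : G) (p : seq G).

Fixpoint cycle_walks n p x : nat :=
  if n is n'.+1 then \sum_(y | adj x y && (y \notin x :: p)) cycle_walks n' (x :: p) y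
  else adj x (last x p).

Lemma cycle_walks0 p x : cycle_walks 0 p x = adj x (last x p). Proof. by []. Qed.

Lemma cycle_walksS n p x : cycle_walks n.+1 p x =
  \sum_(y | adj x y && (y \notin x :: p)) cycle_walks n (x :: p) y.
Proof. by []. Qed.

Ltac not_step := let H := fresh "H" in
  rewrite !inE => H; repeat (rewrite big1 //; intros); apply/eqP; rewrite eqb0;
  apply: contra H; rewrite /cyc6 /= !inE !negb_or => ?; split_ands; neqs.

Lemma cycle_walks5 a :
  cycle_walks 5 [::] a = \sum_b \sum_c \sum_d \sum_e \sum_f cyc6 a b c d e f.
Proof.
rewrite /=; apply: sum_cond_eq_nat => b; last by not_step.
move=> ab; apply: sum_cond_eq_nat => c; last by not_step.
move=> bc; apply: sum_cond_eq_nat => d; last by not_step.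
move=> cd; apply: sum_cond_eq_nat => e; last by not_step.
move=> de; apply: sum_cond_eq_nat => f; last by not_step.
move=> ef; congr nat_of_bool; move: ab bc cd de ef; rewrite !inE !negb_or => *; split_ands.
by rewrite /cyc6; case: (adj f a); rewrite ?andbF // ?andbT; symmetry; neqs.
Qed.
End GraphWalks.

Section Transfer.
Variable t : nat.
Hypothesis cubic : forall v : tube t, #|[set w | adj v w]| = 3.
Variable i0 : nat.
Hypothesis i0t : i0 <= t.

Definition lo0 := if i0 <= 6 then Some (6 - i0) else None.
Definition hi0 := if t - i0 <= 6 then Some (6 + (t - i0)) else None.

Local Notation nbc := (code_nbrs lo0 hi0 (odd i0)).

Definition decode (x : code) : tube t :=
  match x with
  | inl b => inl b
  | inr (o, j) => inr (inord (i0 + o - 6), inord j)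
  end.

(** Codes of actual vertices within [k] levels of [i0]. An end counts as being on the level of the
    ring next to it, so that walks can start there too. *)
Definition in_window k (x : code) : bool :=
  match x with
  | inl true => i0 <= k
  | inl false => t - i0 <= k
  | inr (o, j) => [&& 6 <= o + k, o <= 6 + k, 6 <= i0 + o, i0 + o - 6 <= t & j < 6]
  end.

Lemma in_windowS k l x : k <= l -> in_window k x -> in_window l x.
Proof. by case: x => [[]|[o j]] /=; lia. Qed.

Lemma decode_inj k : {in in_window k &, injective decode}.
Proof.
move=> [b|[o j]] [b'|[o' j']] //; rewrite !unfold_in /=; first by move=> _ _ [->].
move=> h h' [/(congr1 val) /= + /(congr1 val) /=]; rewrite !inordK; [|lia..].
by move=> e1 e2; congr (inr (_, _)); lia.
Qed.

Lemma inord_next j : j < 6 -> inord (if j == 5 then 0 else j.+1) = (inord j + 1)%R :> 'I_6.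
Proof. by case: j => [|[|[|[|[|[|]]]]]] // _; apply: val_inj; rewrite /= !inordK. Qed.

Lemma inord_prev j : j < 6 -> inord (if j == 0 then 5 else j.-1) = (inord j - 1)%R :> 'I_6.
Proof. by case: j => [|[|[|[|[|[|]]]]]] // _; apply: val_inj; rewrite /= !inordK. Qed.

Lemma code_nbrs_window k x : k < 6 -> in_window k x -> {subset nbc x <= in_window k.+1}.
Proof.
move=> k6; case: x => [[]|[o j]] /= h y; rewrite /code_nbrs /lo0 /hi0.
- have -> : i0 <= 6 by lia.
  by rewrite !inE => /or3P[]/eqP->; rewrite unfold_in /=; lia.
- have -> : t - i0 <= 6 by lia.
  by case: ifP => _; rewrite !inE => /or3P[]/eqP->; rewrite unfold_in /=; lia.
rewrite !inE => /or3P[]/eqP->; rewrite unfold_in.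
- by rewrite /=; case: ifP; lia.
- by rewrite /=; case: ifP; lia.
- have o1 : (if t - i0 <= 6 then Some (6 + (t - i0)) else None) == Some o -> o = 6 + (t - i0).
    by case: ifP => // _ /eqP[].
  have o2 : (if i0 <= 6 then Some (6 - i0) else None) == Some o -> o = 6 - i0.
    by case: ifP => // _ /eqP[].
  case: ifP => _.
    case: ifP => [/o1 E|/negbT h'] /=; first by lia.
    have : t - i0 <= 6 -> 6 + (t - i0) != o.
      by move=> h1; move: h'; rewrite h1; apply: contra => /eqP->.
    by move: h; lia.
  case: ifP => [/o2 E|/negbT h'] /=; first by lia.
  have : i0 <= 6 -> 6 - i0 != o.
    by move=> h1; move: h'; rewrite h1; apply: contra => /eqP->.
  by move: h; lia.
Qed.

Lemma code_nbrs_uniq k x : k < 6 -> in_window k x -> uniq (nbc x) /\ size (nbc x) = 3.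
Proof.
have rowU (o : nat) (l : seq nat) : uniq l -> uniq [seq (inr (o, j) : code) | j <- l].
  by move=> lU; rewrite map_inj_uniq // => ? ? [].
move=> k6; case: x => [[]|[o j]] /= h; rewrite /code_nbrs /lo0 /hi0.
- have -> : i0 <= 6 by lia.
  by split=> //; apply: (rowU _ [:: 1; 3; 5]).
- have -> : t - i0 <= 6 by lia.
  by case: ifP => _; split=> //; [apply: (rowU _ [:: 1; 3; 5]) | apply: (rowU _ [:: 0; 2; 4])].
split=> //; rewrite /= !inE andbT negb_or.
have j6 : j < 6 by lia.
have fsts := congr1 (fun x : code => if x is inr q then q.1 else 0).
have snds := congr1 (fun x : code => if x is inr q then q.2 else 0).
rewrite -andbA; apply/and3P; split; apply/eqP.
- by move=> []; case: j j6 {h} => [|[|[|[|[|[|]]]]]].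
- by move=> E; have := fsts _ _ E; have := snds _ _ E; clear E; do ?[case: ifP => ?] => /=; lia.
- by move=> E; have := fsts _ _ E; have := snds _ _ E; clear E; do ?[case: ifP => ?] => /=; lia.
Qed.

Lemma code_nbrs_adj k x y : k < 6 -> in_window k x -> y \in nbc x -> adj (decode x) (decode y).
Proof.
move=> k6; case: x => [[]|[o j]] h; rewrite /code_nbrs /lo0 /hi0.
- have -> : i0 <= 6 by move: h => /=; lia.
  have e : i0 + (6 - i0) - 6 = 0 by move: h => /=; lia.
  by rewrite !inE => /or3P[]/eqP->; rewrite /= /tube_adj /= e !inordK.
- have -> : t - i0 <= 6 by move: h => /=; lia.
  have e : i0 + (6 + (t - i0)) - 6 = t by lia.
  have op : odd i0 (+) odd (6 + (t - i0)) = odd t by rewrite -oddD addnCA subnKC // oddD.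
  rewrite op; case: ifP => ot; rewrite !inE => /or3P[]/eqP->;
    by rewrite /= /tube_adj /= e !inordK // ot eqxx.
have /and5P[h1 h2 h3 h4 j6] := h.
have lt : i0 + o - 6 < t.+1 by [].
have ol : odd (i0 + o - 6) = odd i0 (+) odd o by rewrite oddB // oddD addbF.
rewrite !inE => /or3P[]/eqP->.
- by rewrite /= /tube_adj /= inord_next // !eqxx.
- by rewrite /= /tube_adj /= inord_prev // subrK !eqxx orbT.
case: ifP => /eqP oj.
  have o1 : (if t - i0 <= 6 then Some (6 + (t - i0)) else None) == Some o -> o = 6 + (t - i0).
    by case: ifP => // _ /eqP[].
  case: ifP => [/o1 E|/negbT h'].
    have e : i0 + o - 6 = t by clear -E i0t; lia.
    by rewrite /= /tube_adj /= !inordK // oj -ol e !eqxx.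
  have ne : i0 + o - 6 != t.
    apply: contraNneq h' => e; have -> : t - i0 <= 6 by clear -e h2 k6 h3; lia.
    by apply/eqP; congr Some; clear -e h3 i0t; lia.
  have e : i0 + o.+1 - 6 = (i0 + o - 6).+1 by clear -h3; lia.
  have lt' : (i0 + o - 6).+1 < t.+1 by clear -ne lt; lia.
  by rewrite /= /tube_adj /= e !inordK // oj ol !eqxx !orbT.
have o2 : (if i0 <= 6 then Some (6 - i0) else None) == Some o -> i0 <= 6 /\ o = 6 - i0.
  by case: ifP => // ? /eqP[].
case: ifP => [/o2[E' E]|/negbT h'].
  have e : i0 + o - 6 = 0 by clear -E E' h3; lia.
  rewrite /= /tube_adj /= !inordK // e eqxx /=; move: oj; rewrite -ol e.
  by case: (odd j).
have ne : i0 + o - 6 != 0.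
  apply: contraNneq h' => e; have -> : i0 <= 6 by clear -e h1 h3 k6; lia.
  by apply/eqP; congr Some; clear -e h3; lia.
have e : (i0 + o.-1 - 6).+1 = i0 + o - 6 by clear -ne h1 h3 k6; lia.
have lt' : i0 + o.-1 - 6 < t.+1 by clear -e lt; lia.
rewrite /= /tube_adj /= !inordK // e !eqxx; move: oj; rewrite -ol -e /=.
by case: (odd j); case: (odd _); rewrite ?orbT.
Qed.

(** The three codes decode to distinct neighbours, and in a cubic graph there are no others. *)
Lemma adj_decode k x w : k < 6 -> in_window k x ->
  adj (decode x) w = (w \in map decode (nbc x)).
Proof.
move=> k6 h; have [U S] := code_nbrs_uniq k6 h.
have U' : uniq (map decode (nbc x)).
  rewrite map_inj_in_uniq // => y z /(code_nbrs_window k6 h) hy /(code_nbrs_window k6 h) hz.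
  exact: (@decode_inj k.+1).
have sub : {subset map decode (nbc x) <= enum [set w | adj (decode x) w]}.
  by move=> _ /mapP[y yx ->]; rewrite mem_enum inE; exact: (code_nbrs_adj k6 h yx).
have [|_ E] := uniq_min_size U' sub; first by rewrite -cardE cubic size_map S.
by rewrite E mem_enum inE.
Qed.

(** With [n] steps left at most [5 - n] have been made, so the walk is still in the window where
    [decode] is injective and respects adjacency. *)
Lemma code_walksE n p x : n < 6 -> in_window (5 - n) x -> {subset p <= in_window (5 - n)} ->
  cycle_walks n (map decode p) (decode x) = code_walks lo0 hi0 (odd i0) n p x.
Proof.
elim: n p x => [|n IHn] p x n6 hx hp.
  have hl : in_window 6 (last x p).
    apply: (@in_windowS 5) => //; case/lastP: p hp => //= p y hp; rewrite last_rcons.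
    by apply: hp; rewrite mem_rcons inE eqxx.
  rewrite cycle_walks0 code_walks0 last_map (@adj_decode 5) //; congr nat_of_bool; apply/mapP/idP => [[y yx E]|]; last by exists (last x p).
  by rewrite (@decode_inj 6 _ _ hl _ E) //; apply: (@code_nbrs_window 5 x).
have k6 : 5 - n.+1 < 6 by lia.
have [U S] := code_nbrs_uniq k6 hx.
have W := code_nbrs_window k6 hx; rewrite (_ : (5 - n.+1).+1 = 5 - n) in W; last by lia.
have hx' : in_window (5 - n) x by apply: in_windowS hx; lia.
have hp' : {subset x :: p <= in_window (5 - n)}.
  by move=> y; rewrite inE => /orP[/eqP->//|/hp]; apply: in_windowS; lia.
have U' : uniq (map decode (nbc x)).
  by rewrite map_inj_in_uniq // => y z /W hy /W hz; exact: (@decode_inj (5 - n)).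
rewrite cycle_walksS code_walksS sumnE big_map big_mkcond.
transitivity (\sum_(w <- map decode (nbc x))
   if w \notin decode x :: map decode p then cycle_walks n (decode x :: map decode p) w else 0).
  rewrite (big_uniq _ U') [RHS]big_mkcond; apply: eq_bigr => w _.
  by rewrite (adj_decode _ k6 hx); case: (w \in map decode _).
rewrite big_map; apply: eq_big_seq => y yx.
have -> : (decode y \notin decode x :: map decode p) = (y \notin x :: p).
  congr negb; rewrite -(map_cons decode x p); apply/mapP/idP => [[z zx E]|]; last by exists y.
  by rewrite (@decode_inj (5 - n) _ _ (W _ yx) (hp' _ zx) E).
case: ifP => [yn|/negbT]; last by rewrite negbK => ->.
by rewrite (negbTE yn) -(map_cons decode x p) IHn //; [lia | exact: W].
Qed.
End Transfer.

Lemma mem_all (A : eqType) (P : pred A) l x : all P l -> x \in l -> P x.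
Proof. by move/allP; apply. Qed.

Section TubeCount.
Variable t : nat.
Hypothesis t1 : 0 < t.
Hypothesis cubic : forall v : tube t, #|[set w | adj v w]| = 3.

Lemma code_values i0 : i0 <= t ->
  [/\ forall j, j < 6 -> code_walks (lo0 i0) (hi0 t i0) (odd i0) 5 [::] (inr (6, j)) =
        if (i0 == 0) || (i0 == t) then 10 else 8,
      i0 = 0 -> code_walks (lo0 i0) (hi0 t i0) (odd i0) 5 [::] (inl true) = 6 &
      i0 = t -> code_walks (lo0 i0) (hi0 t i0) (odd i0) 5 [::] (inl false) = 6].
Proof.
move=> i0t; pose u := if t - i0 <= 6 then Some (6 - (t - i0)) else None.
have uE : omap (fun k => 12 - k) u = hi0 t i0.
  by rewrite /u /hi0; case: ifP => //= h; congr Some; lia.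
have inoff n : (if n <= 6 then Some (6 - n) else None) \in
    [:: None; Some 0; Some 1; Some 2; Some 3; Some 4; Some 5; Some 6].
  by case: n => [|[|[|[|[|[|[|n]]]]]]].
have l6 n : ((if n <= 6 then Some (6 - n) else None) == Some 6) = (n == 0).
  by case: n => [|[|[|[|[|[|[|n]]]]]]].
have pin : odd i0 \in [:: true; false] by case: odd.
have := mem_all (mem_all (mem_all code_tableT (inoff i0)) (inoff (t - i0))) pin.
rewrite -/(lo0 i0) -/u uE /u {2 4}/lo0 !l6.
have -> : (t - i0 == 0) = (i0 == t) by lia.
have -> : (i0 == 0) && (i0 == t) = false by lia.
have -> : (if lo0 i0 is Some k then odd i0 != odd k else false) = false.
  by rewrite /lo0; case: ifP => // h; rewrite oddB //=; case: odd.
rewrite /= => /and3P[/andP[h0 /andP[h1 /andP[h2 /andP[h3 /andP[h4 /andP[h5 _]]]]]] ha hb].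
split.
- by case=> [|[|[|[|[|[|]]]]]] // _; apply/eqP.
- by move=> e; apply/eqP; move: ha; rewrite e.
- by move=> e; apply/eqP; move: hb; rewrite e eqxx.
Qed.

(** The ends give 12, the first and last ring 60 each, every other ring 48. The $4t+7$ cycles are
    $3t$ hexagonal faces, $t+1$ rings and six dual squares. *)
Lemma tube_rooted6 : rooted6 (tube t) = 12 * (4 * t + 7).
Proof.
have nil k i : {subset [::] <= in_window t i k} by [].
have ends : cycle_walks 5 [::] (inl true : tube t) + cycle_walks 5 [::] (inl false : tube t) = 12.
  have [_ /(_ erefl) ha _] := code_values (leq0n t).
  have [_ _ /(_ erefl) hb] := code_values (leqnn t).
  have wb : in_window t t (5 - 5) (inl false) by rewrite /= subnn.
  by rewrite (etrans (@code_walksE t cubic 0 (leq0n t) 5 [::] (inl true) isT isT (nil _ _)) ha)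
    (etrans (@code_walksE t cubic t (leqnn t) 5 [::] (inl false) isT wb (nil _ _)) hb).
have ring (i : 'I_t.+1) (j : 'I_6) : cycle_walks 5 [::] (inr (i, j) : tube t) =
    if (i == 0 :> nat) || (i == t :> nat) then 10 else 8.
  have [/(_ j (ltn_ord j)) h _ _] := code_values (leq_ord i).
  have w : in_window t i (5 - 5) (inr (6, j : nat)).
    by rewrite /=; have := leq_ord i; have := ltn_ord j; clear; lia.
  have <- : decode t i (inr (6, j : nat)) = inr (i, j) by rewrite /decode addnK !inord_val.
  exact: etrans (@code_walksE t cubic i (leq_ord i) 5 [::] (inr (6, j : nat)) isT w (nil _ _)) h.
rewrite /rooted6; under eq_bigr do rewrite -cycle_walks5.
transitivity (cycle_walks 5 [::] (inl true : tube t) + cycle_walks 5 [::] (inl false : tube t)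
  + \sum_(p : 'I_t.+1 * 'I_6) cycle_walks 5 [::] (inr p : tube t)).
  by rewrite big_sumType big_bool.
rewrite ends.
rewrite sum_pair (eq_bigr (fun i : 'I_t.+1 => 6 * if (i == 0 :> nat) || (i == t :> nat) then 10 else 8)).
  case: t t1 => // n _; rewrite big_ord_recl big_ord_recr /= /bump /= add1n eqxx.
  rewrite (eq_bigr (fun=> 48)) ?sum_nat_const ?card_ord; first by clear; lia.
  by move=> i _; rewrite /bump /= add1n eqSS (ltn_eqF (ltn_ord i)).
by move=> i _; rewrite (eq_bigr _ (fun j _ => ring i j)) sum_nat_const card_ord.
Qed.
End TubeCount.

(** * Isomorphism invariance and conclusion *)

Lemma iso_card (G H : sgraph) : graph_iso G H -> #|G| = #|H|.
Proof. by case=> f fB _; apply: bij_eq_card fB. Qed.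

Lemma iso_cubic (G H : sgraph) : graph_iso G H -> (forall v : G, #|[set w | adj v w]| = 3) ->
  forall v : H, #|[set w | adj v w]| = 3.
Proof.
move=> [f [g fK gK] fE] cub v; rewrite -(cub (g v)) -(card_imset _ (can_inj fK)).
apply: eq_card => w; rewrite inE; apply/idP/imsetP => [vw|[u + ->]].
  by exists (g w); rewrite ?gK // inE -fE !gK.
by rewrite inE -fE gK.
Qed.

Lemma iso_rooted6 (G H : sgraph) : graph_iso G H -> rooted6 G = rooted6 H.
Proof.
move=> [f fB fE]; have fI := bij_inj fB; rewrite /rooted6.
rewrite [RHS](reindex f) /=; last exact: onW_bij; apply: eq_bigr => a _.
rewrite [RHS](reindex f) /=; last exact: onW_bij; apply: eq_bigr => b _.
rewrite [RHS](reindex f) /=; last exact: onW_bij; apply: eq_bigr => c _.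
rewrite [RHS](reindex f) /=; last exact: onW_bij; apply: eq_bigr => d _.
rewrite [RHS](reindex f) /=; last exact: onW_bij; apply: eq_bigr => e _.
rewrite [RHS](reindex f) /=; last exact: onW_bij; apply: eq_bigr => g _.
by rewrite /cyc6 -(map_inj_uniq fI) !fE.
Qed.

Lemma num_matchings_small (G : sgraph) k : #|G| < k.*2 -> num_matchings G k = 0.
Proof.
move=> lt; rewrite num_matchingsE; apply: eq_card0 => M; rewrite inE.
apply/negP => /and4P[sM tM /eqP cM _].
have := max_card (mem (cover M)); rewrite (cover_matching sM tM cM).
by rewrite leqNgt lt.
Qed.

Local Open Scope ring_scope.

Theorem theorem3p12 (G : plane_graph) (hG : fullerene46 G)
    (h : nat) (hh : num_faces G 6 = h) :
  [/\ graph_iso G cube -> num_matchings G 6 = 0%N,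
      in_tubes G ->
        (num_matchings G 6)%:R =
          81 / 80 * h%:R ^+ 6 - 81 / 80 * h%:R ^+ 5 - 99 / 16 * h%:R ^+ 4
          + 405 / 16 * h%:R ^+ 3 - 1873 / 40 * h%:R ^+ 2
          + 1231 / 30 * h%:R - 9 :> rat
    & forall y : nat, ~ in_tubes G -> ~ graph_iso G cube ->
        #|dual_squares G| = y ->
        (num_matchings G 6)%:R =
          81 / 80 * h%:R ^+ 6 - 81 / 80 * h%:R ^+ 5 - 99 / 16 * h%:R ^+ 4
          + 405 / 16 * h%:R ^+ 3 - 1873 / 40 * h%:R ^+ 2
          + 407 / 10 * h%:R - 16 + y%:R :> rat].
Proof.
have [cub f46 sq6] := hG; have tT := turn_turning cub f46 sq6.
have nV := card_vertices cub f46 sq6; rewrite hh in nV.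
have formula c := num_matchings6 cub (no_triangle tT) (no_pentagon tT) (no_K23 tT) (c := c)
  nV (rooted4_squares cub f46 sq6).
split.
- move=> /iso_card nC; apply: num_matchings_small; rewrite nC.
  by rewrite card_ffun card_bool card_ord.
- move=> [t t1 iso]; have cubT := iso_cubic iso cub.
  have r6 : rooted6 G = (12 * (4 * t + 7))%N by rewrite (iso_rooted6 iso) tube_rooted6.
  have ht : h = (3 * t)%N.
    move: (iso_card iso); rewrite nV card_sum card_prod !card_ord card_bool; lia.
  (* Here [c] is $4h/3+7$, which changes 397/10 to 1231/30 and -16 to -9. *)
  rewrite (formula _ r6) ht natrD !natrM.
  move: (t%:R : rat) => T; lra.
move=> y nt nc yE.
have ncap : ~ capped (@turn G) by case/(capped_tube tT).
(* The 6-cycles are the hexagonal faces and the dual squares; the former raise 397/10 to 407/10. *)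
have r6 : rooted6 G = (12 * (h + y))%N.
  by rewrite (rooted6_split cub f46 sq6 ncap) num_chorded card_chorded yE hh mulnDr.
rewrite (formula _ r6) natrD; lra.
Qed.
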